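(* Let $a=\exp(G)$ be the log-normal coefficient field described in the context, and set $p_\diamond=d+1$. (i) There exists a stationary random field $r_\diamond:\mathbb{R}^d\to(0,\infty)$ which is $\frac18$-Lipschitz and such that for all $x\in\mathbb{R}^d$ and all $r\ge r_\diamond(x)$ $$\tfrac12\,\mathbb{E}\big[a^{p_\diamond}+a^{-p_\diamond}\big]\le \frac{1}{|B_r(x)|}\int_{B_r(x)}\big(a^{p_\diamond}+a^{-p_\diamond}\big)\le 2\,\mathbb{E}\big[a^{p_\diamond}+a^{-p_\diamond}\big],$$ and which satisfies, for some constant $C>0$, $$\mathbb{E}\Big[\exp\big(\tfrac1C\log^2(1+r_\diamond)\big)\Big]\le 2.$$ (ii) Let $0<\varepsilon\le 1$ and define for all $R\ge 1$ $$r_\clubsuit(R):=\Big(R^{-\frac{\varepsilon}{2}}\sup_{B_R}(a+a^{-1})\Big)^2.$$ There exists $C>0$ (depending on $\varepsilon$) such that $$\sup_{R\ge1}\mathbb{E}\Big[\exp\big(\tfrac1C\log^2(1+r_\clubsuit(R))\big)\Big]\le 2.$$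
   Context: Coefficients: $d\ge1$; $G:\mathbb{R}^d\to\mathbb{R}$ is a centered stationary Gaussian random field with covariance function $\mathcal{C}(x)=\mathbb{E}[G(x)G(0)]$; $\mathcal{C}$ is integrable on $\mathbb{R}^d$ and $2\gamma$-Hölder continuous at $0$ for some $0<\gamma<\frac12$, i.e. $|\mathcal{C}(x)-\mathcal{C}(0)|\le L|x|^{2\gamma}$ for $x$ near $0$ and some $L<\infty$. One takes the version of $G$ with continuous sample paths and sets $a(x):=\exp(G(x))$. Notation: $\mathbb{E}$ is the expectation; $B_r(x)$ is the ball of radius $r$ centered at $x$, $B_r:=B_r(0)$. By stationarity $\mathbb{E}[a^{p}+a^{-p}]$ does not depend on the point of evaluation, nor does the law of $r_\diamond(x)$ depend on $x$; $r_\diamond$ without argument stands for $r_\diamond(0)$. *)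

(* Defs.v *)
From HB Require Import structures.
From mathcomp Require Import all_boot all_order all_algebra.
From mathcomp Require Import all_classical all_reals all_analysis.

Set Implicit Arguments.
Unset Strict Implicit.
Unset Printing Implicit Defensive.

Import Order.TTheory GRing.Theory Num.Def Num.Theory.
Import numFieldNormedType.Exports.

Local Open Scope classical_set_scope.
Local Open Scope ring_scope.

Definition measure_rV_display : measure_display -> measure_display.
Proof. exact. Qed.

(* The product sigma-algebra on R^n: for row vectors over the reals, the Borel
   sigma-algebra. *)
Section measurable_rV.
Context {R : realType} {n : nat}.

Let coords : 'I_n -> 'rV[R]_n -> measurableTypeR R := fun i v => v ord0 i.

Let rV_set0 : g_sigma_preimage coords set0.
Proof. exact: sigma_algebra0. Qed.

Let rV_setC A : g_sigma_preimage coords A -> g_sigma_preimage coords (~` A).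
Proof. exact: sigma_algebraC. Qed.

Let rV_bigcup (F : _^nat) : (forall i, g_sigma_preimage coords (F i)) ->
  g_sigma_preimage coords (\bigcup_i (F i)).
Proof. exact: sigma_algebra_bigcup. Qed.

HB.instance Definition _ :=
  @isMeasurable.Build (measure_rV_display default_measure_display)
    'rV[R]_n (g_sigma_preimage coords) rV_set0 rV_setC rV_bigcup.

End measurable_rV.

Section measurable_rV_lemmas.
Context {R : realType}.

Lemma measurable_rV_coord n (i : 'I_n) :
  measurable_fun [set: 'rV[R]_n] (fun v => v ord0 i).
Proof.
move=> _ Y mY; rewrite setTI; apply: sub_sigma_algebra => /=.
rewrite -bigcup_seq/=; exists i => /=; first by rewrite mem_index_enum.
by exists Y => //; rewrite setTI.
Qed.

Lemma measurable_fun_rVP d (T : measurableType d) n (f : T -> 'rV[R]_n) :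
  measurable_fun [set: T] f <->
  forall i, measurable_fun [set: T] (fun x => f x ord0 i).
Proof.
split=> [mf i|mf].
  exact: (measurableT_comp (measurable_rV_coord i) mf).
move=> _ A mA; rewrite setTI; move: A mA.
apply: smallest_sub => /=.
  split => /=.
  - by rewrite preimage_set0.
  - by move=> A mA; rewrite setTD preimage_setC; exact: measurableC.
  - by move=> F mF; rewrite preimage_bigcup; exact: bigcup_measurable.
move=> A; rewrite -bigcup_seq/= => -[i _ [B mB <-]].
rewrite setTI; have := mf i measurableT B mB; rewrite setTI.
exact.
Qed.

End measurable_rV_lemmas.

Section lebesgue_rV.
Context {R : realType}.

Definition rV_cons n (p : measurableTypeR R * 'rV[R]_n) : 'rV[R]_n.+1 :=
  \row_i (if unlift ord0 i is Some j then p.2 ord0 j else p.1).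

Definition rV_uncons n (v : 'rV[R]_n.+1) : measurableTypeR R * 'rV[R]_n :=
  (v ord0 ord0, \row_i v ord0 (lift ord0 i)).

Lemma rV_cons0 n (p : measurableTypeR R * 'rV[R]_n) :
  rV_cons p ord0 ord0 = p.1.
Proof. by rewrite mxE unlift_none. Qed.

Lemma rV_consS n (p : measurableTypeR R * 'rV[R]_n) i :
  rV_cons p ord0 (lift ord0 i) = p.2 ord0 i.
Proof. by rewrite mxE liftK. Qed.

Lemma rV_consK n : cancel (@rV_cons n) (@rV_uncons n).
Proof.
move=> p; rewrite /rV_uncons rV_cons0 [RHS]surjective_pairing; congr pair.
by apply/rowP => i; rewrite mxE rV_consS.
Qed.

Lemma rV_unconsK n : cancel (@rV_uncons n) (@rV_cons n).
Proof.
move=> v; apply/rowP => i; case: (unliftP ord0 i) => [j ->|->].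
  by rewrite rV_consS mxE.
by rewrite rV_cons0.
Qed.

Lemma measurable_rV_cons n : measurable_fun setT (@rV_cons n).
Proof.
apply/measurable_fun_rVP => i; case: (unliftP ord0 i) => [j ->|->].
  under eq_fun do rewrite rV_consS.
  exact: (measurableT_comp (measurable_rV_coord j) measurable_snd).
by under eq_fun do rewrite rV_cons0; exact: measurable_fst.
Qed.

Lemma measurable_rV_uncons n : measurable_fun setT (@rV_uncons n).
Proof.
apply/measurable_fun_pairP; split => /=.
  exact: measurable_rV_coord.
apply/measurable_fun_rVP => i.
rewrite [X in measurable_fun _ X](_ : _ = fun v : 'rV[R]_n.+1 => v ord0 (lift ord0 i)).
  exact: measurable_rV_coord.
by apply/funext => v /=; rewrite mxE.
Qed.

Section prod_rV.
Variables (n : nat) (mu : {sigma_finite_measure set 'rV[R]_n -> \bar R}).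

Definition prod_rV : set 'rV[R]_n.+1 -> \bar R :=
  pushforward (@lebesgue_measure R \x mu)%E (@rV_cons n).

HB.instance Definition _ := isMeasurableFun.Build _ _ _ _
  (@rV_cons n) (@measurable_rV_cons n).

Let prod_rV0 : prod_rV set0 = 0%E.
Proof. exact: measure0. Qed.

Let prod_rV_ge0 A : (0 <= prod_rV A)%E.
Proof. exact: measure_ge0. Qed.

Let prod_rV_sigma_additive : semi_sigma_additive prod_rV.
Proof. exact: measure_semi_sigma_additive. Qed.

HB.instance Definition _ := isMeasure.Build _ _ _ prod_rV
  prod_rV0 prod_rV_ge0 prod_rV_sigma_additive.

Let prod_rV_sigma_finite : sigma_finite setT prod_rV.
Proof.
have /sigma_finiteP[F [TF ndF Foo]] := sigma_finiteT (@lebesgue_measure R).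
have /sigma_finiteP[H [TH ndH Hoo]] := sigma_finiteT mu.
have preE k : @rV_cons n @^-1` (@rV_uncons n @^-1` (F k `*` H k)) = F k `*` H k.
  by rewrite -comp_preimage (_ : _ \o _ = id)//; exact/funext/rV_consK.
exists (fun k => @rV_uncons n @^-1` (F k `*` H k)).
  apply/esym; rewrite -subTset => v _ /=.
  have [i _ Fi] : (\bigcup_i F i) (@rV_uncons n v).1 by rewrite -TF.
  have [j _ Hj] : (\bigcup_i H i) (@rV_uncons n v).2 by rewrite -TH.
  exists (maxn i j) => //; split.
    by move: Fi; exact/subsetPset/ndF/leq_maxl.
  by move: Hj; exact/subsetPset/ndH/leq_maxr.
move=> k; have [mFk Fkoo] := Foo k; have [mHk Hkoo] := Hoo k; split.
  rewrite -[X in measurable X]setTI; apply: measurable_rV_uncons => //.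
  exact: measurableX.
rewrite /prod_rV /pushforward preE product_measure1E//.
by rewrite lte_mul_pinfty// ge0_fin_numE.
Qed.

HB.instance Definition _ := Measure_isSigmaFinite.Build _ _ _ prod_rV
  prod_rV_sigma_finite.

End prod_rV.

Fixpoint lebesgue_rV n : {sigma_finite_measure set 'rV[R]_n -> \bar R} :=
  match n with
  | 0 => \d_(0 : 'rV[R]_0)
  | n'.+1 => prod_rV (lebesgue_rV n')
  end.

Lemma lebesgue_rV_box n (A : 'I_n -> set (measurableTypeR R)) :
  (forall i, measurable (A i)) ->
  lebesgue_rV n [set v : 'rV[R]_n | forall i, A i (v ord0 i)] =
  (\big[mule/1%E]_(i < n) lebesgue_measure (A i))%E.
Proof.
elim: n A => [A _|n IH A mA].
  by rewrite big_ord0 /= diracE mem_set// => -[].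
rewrite big_ord_recl -IH// -product_measure1E//; last first.
  rewrite (_ : mkset _ =
      \bigcap_(i in setT) [set v : 'rV[R]_n | A (lift ord0 i) (v ord0 i)]).
    apply: fin_bigcap_measurable => // i _.
    by rewrite -[X in measurable X]setTI; exact: measurable_rV_coord _ _ (mA _).
  by apply/seteqP; split => v /= + i; [move=> /(_ i) | move=> /(_ i I)].
rewrite /= /prod_rV /pushforward; congr product_measure1.
apply/seteqP; split => p /=.
  move=> Ap; split=> [|i]; first by have := Ap ord0; rewrite rV_cons0.
  by have := Ap (lift ord0 i); rewrite rV_consS.
move=> [A0 AS] i; case: (unliftP ord0 i) => [j ->|->].
  by rewrite rV_consS.
by rewrite rV_cons0.
Qed.

End lebesgue_rV.

Section euclidean.
Context {R : realType} {d : nat}.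

(* the library norm [`|x|] on ['rV_d] is the supremum norm *)
Definition enorm (x : 'rV[R]_d) : R := sqrtr (\sum_i x ord0 i ^+ 2).

Definition eball (x : 'rV[R]_d) (r : R) : set 'rV[R]_d :=
  [set y | enorm (y - x) < r].

Definition ball_avg (f : 'rV[R]_d -> R) (x : 'rV[R]_d) (r : R) : \bar R :=
  (((fine (lebesgue_rV d (eball x r)))^-1)%:E *
   \int[lebesgue_rV d]_(y in eball x r) (f y)%:E)%E.

Definition holder_at0 (f : 'rV[R]_d -> R) (alpha : R) : Prop :=
  exists L : R, \forall x \near (0 : 'rV[R]_d),
    `|f x - f 0| <= L * enorm x `^ alpha.

End euclidean.

(* degenerate Gaussian laws are allowed; [normal_prob m 0] is a junk value *)
Definition gaussian_law {R : realType} (mu : set (measurableTypeR R) -> \bar R) :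
    Prop :=
  exists m s : R, 0 <= s /\
    forall A, measurable A ->
      mu A = if s == 0 then \d_(m : measurableTypeR R) A else normal_prob m s A.

Section random_fields.
Context {disp : measure_display} {T : measurableType disp} {R : realType}.
Context {P : probability T R} {d : nat}.
Implicit Types X : 'rV[R]_d -> {RV P >-> R}.

Definition gaussian_field X : Prop :=
  forall n (x : 'I_n -> 'rV[R]_d) (c : 'I_n -> R),
    gaussian_law (pushforward P (fun w => \sum_(i < n) c i * X (x i) w)).

Definition centered_field X : Prop := forall x, ('E_P[X x] = 0)%E.

Definition stationary_field X : Prop :=
  forall n (x : 'I_n -> 'rV[R]_d) (z : 'rV[R]_d) (A : set 'rV[R]_n),
    measurable A ->
    P [set w | A (\row_i X (x i + z) w)] = P [set w | A (\row_i X (x i) w)].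

Definition continuous_paths X : Prop :=
  forall w, continuous (fun x => X x w : R).

Definition covariance_fun X (x : 'rV[R]_d) : R :=
  fine ('E_P[(fun w => X x w * X 0 w)%R])%E.

End random_fields.

Section lognormal.
Context {disp : measure_display} {T : measurableType disp} {R : realType}.
Context {P : probability T R} {d : nat}.

Definition lognormal (G : 'rV[R]_d -> {RV P >-> R}) (x : 'rV[R]_d) (w : T) : R :=
  expR (G x w).

Definition sum_pow_inv (p : nat) (a : R) : R := a ^+ p + a ^- p.

Definition exp_log2_moment (C : R) (X : T -> R) : \bar R :=
  'E_P[(fun w => expR (C^-1 * ln (1 + X w) ^+ 2))%R]%E.

Definition r_club (a : 'rV[R]_d -> T -> R) (eps rho : R) (w : T) : R :=
  (rho `^ (- (eps / 2)) *
   sup [set a y w + (a y w)^-1 | y in eball 0 rho]) ^+ 2.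

End lognormal.

Arguments exp_log2_moment {disp T R} P.

(* Main.v *)
From HB Require Import structures.
Require Import Defs.
From mathcomp Require Import all_boot all_order all_algebra.
From mathcomp Require Import all_classical all_reals all_analysis.
From mathcomp Require Import measurable_realfun.
From mathcomp Require Import ring lra.
Import Order.TTheory GRing.Theory Num.Def Num.Theory.
Import numFieldNormedType.Exports.
Set Implicit Arguments.
Unset Strict Implicit.
Unset Printing Implicit Defensive.
Local Open Scope classical_set_scope.
Local Open Scope ring_scope.

(** Both parts follow from tail bounds [P (X > exp t) <= K exp (- c t ^ 2)], which
    [exp_square_moment_of_tails] converts into the stated moments of
    [log ^ 2 (1 + X)].

    Suprema. The increment [G x - G y] is Gaussian with variance
    [2 (C 0 - C (x - y))], at most a multiple of [|x - y| ^ (2 gamma)]. Chaining along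
    dyadic points yields a Gaussian tail for the supremum of [|G|] over a unit
    cube, uniformly in the position of the cube ([sup_cube_tail]), and a ball of
    radius [rho] is covered by at most [(4 rho) ^ d] such cubes. At the threshold
    [(n + eps log rho) / 2] the union bound costs [exp (d log rho)], which the Gaussian
    factor in [eps log rho] absorbs uniformly in [rho]; this is the second part
    ([r_club_moment]).

    Averages. As [a ^ p + a ^ - p] is the sum of [exp (p G)] and [exp (- p G)], it
    is enough to study the average [Z] of [exp (s G)] over a ball of radius [r],
    whose mean is [M = exp (s ^ 2 C 0 / 2)]. By the Cameron-Martin formula
    ([exp_moment_tilt]) the weight [exp (s G y)] turns [Z] into the average [Z_y] of
    [exp (s ^ 2 C (z - y)) exp (s G z)] over [z]. Averaging over [y] gives
    [E Z ^ (j + 1) = M E Z_y ^ j], hence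
    [E (Z - M) ^ (2 k) = M E ((Z_y - M) ^ (2 k - 1) - (Z - M) ^ (2 k - 1))].
    The difference [Z_y - Z] is bounded by a multiple of the average of
    [|C (z - y)| exp (s G z)], whose moments are explicit and small: the
    integrability of [C] makes the average of [|C|] over the ball at most of order
    [1 / r]. Young's inequality absorbs the remaining power of [Z - M]
    ([centered_moment_le]), and the result is
    [P (|Z - M| >= M / 4) <= Theta ^ (k ^ 2) r ^ (- k)] for all [k]
    ([ball_mean_deviation]). Taking [k] proportional to [log r] leaves
    [exp (- c log ^ 2 r)].

    The radius. Call a ball bad if the average of [a ^ p + a ^ - p] over it is not
    within a factor two of the expectation. On a geometric scale of radii with
    ratio close to one, boundedly many balls per scale decide whether there is a
    bad ball of radius [r] with center [y] and [|y| < 8 r], so that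
    [r - |y| / 8 > exp (lam n)] for some bad ball only with probability
    [K exp (- c n ^ 2)] ([bad_event_tail]). The field
    [rd x = 1 + sup (r - |x - y| / 8)], over the bad balls of center [y] and radius
    [r], is [1 / 8]-Lipschitz by construction, exceeds the radii of all bad balls
    around [x], and commutes with translations of the path of [G]. As badness is an
    open condition on [(y, r)], the supremum may be taken over rational parameters,
    whence its measurability; stationarity is then inherited from the law of [G] on
    the space of continuous paths ([stationary_path_functional]). *)

(** * The exponential function near zero *)

Section elementary.
Context {R : realType}.
Implicit Types x y z : R.

Lemma expR_sub1_le x : expR x - 1 <= x * expR x.
Proof.
have h : 1 - x <= expR (- x) by rewrite expR_ge1Dx.
have := ler_wpM2r (expR_ge0 x) h.
by rewrite -expRD addNr expR0 mulrBl mul1r; lra.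
Qed.

Lemma expR_sub1_ge x : x <= expR x - 1.
Proof. by have := expR_ge1Dx x; lra. Qed.

Lemma norm_expR_sub1 x : `|expR x - 1| <= `|x| * expR `|x|.
Proof.
have [x0|x0] := leP 0 x.
  rewrite ger0_norm ?(ger0_norm x0) ?expR_sub1_le// subr_ge0.
  by rewrite -expR0 ler_expR.
rewrite ltr0_norm ?(ltr0_norm x0); last first.
  by rewrite subr_lt0 -expR0 ltr_expR.
have : 1 <= expR (- x) by rewrite -expR0 ler_expR; lra.
have := expR_sub1_ge x; move=> h1 h2.
have : 0 <= (- x) * (expR (- x) - 1) by apply: mulr_ge0; lra.
lra.
Qed.

Lemma sqr_le_expR x : 0 <= x -> x ^+ 2 <= 2 * expR x.
Proof.
move=> x0; have := expR_ge1Dxn 1 x0; rewrite /= => h.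
have e : (2`!)%:R = 2 :> R by [].
by move: h; rewrite e; nra.
Qed.

Lemma le_expR_id x : x <= expR x.
Proof. by have := expR_ge1Dx x; lra. Qed.

Lemma expR_norm_le x : expR `|x| <= expR x + expR (- x).
Proof.
have [x0|x0] := leP 0 x; first by rewrite ger0_norm// lerDl expR_ge0.
by rewrite ltr0_norm// lerDr expR_ge0.
Qed.

(** The difference quotient of the exponential at [0], along a varying
    increment. *)
Lemma cvg_expR_quotient (N w : R^nat) (l : R) : (forall n, 0 < N n) ->
  (N n)^-1 @[n --> \oo] --> (0 : R) -> w n @[n --> \oo] --> l ->
  N n * (expR (w n / N n) - 1) @[n --> \oo] --> l.
Proof.
move=> N0 cN wl.
have wn : w n / N n @[n --> \oo] --> (0 : R).
  by rewrite -[0](mulr0 l); exact: cvgM.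
have ew : expR (w n / N n) @[n --> \oo] --> (1 : R).
  by rewrite -[X in _ --> X]expR0; exact: (cvg_comp _ _ wn (@continuous_expR R 0)).
apply: (@squeeze_cvgr _ _ _ _ w (fun n => w n * expR (w n / N n))) => //.
  near=> n; have n0 := N0 n.
  apply/andP; split.
    rewrite -ler_pdivrMl// mulrC; exact: expR_sub1_ge.
  rewrite -ler_pdivlMl// mulrA [_^-1 * _]mulrC; exact: expR_sub1_le.
by rewrite -[l in X in _ --> X]mulr1; exact: cvgM.
Unshelve. all: by end_near. Qed.

End elementary.

(** * Moments of Gaussian laws *)

Lemma integral_cst_probability d (T : measurableType d) (R : realType)
  (P : probability T R) (r : R) : (\int[P]_w r%:E = r%:E)%E.
Proof.
rewrite (integral_cst P measurableT).
by rewrite [X in (_ * X)%E](_ : _ = 1%E) ?mule1//; exact: probability_setT.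
Qed.

Section normal_mgf.
Context {R : realType}.
Local Notation mu := (@lebesgue_measure R).
Local Open Scope ereal_scope.

Lemma ge0_integral_normal_prob (m s : R) (f : R -> \bar R) :
  measurable_fun [set: R] f -> (forall x, 0 <= f x) ->
  \int[normal_prob m s]_x f x = \int[mu]_x (f x * (normal_pdf m s x)%:E).
Proof.
move=> mf f0; have dom := normal_prob_dominates m s.
rewrite -(Radon_Nikodym_SigmaFinite.change_of_variables dom)//.
have iRN := Radon_Nikodym_SigmaFinite.f_integrable dom.
apply: ae_eq_integral => //.
- by apply: emeasurable_funM => //; exact: measurable_int iRN.
- apply: emeasurable_funM => //; apply/measurable_EFinP.
  exact: measurable_normal_pdf.
- apply: ae_eqe_mul2l; apply: integral_ae_eq => //.
    by apply/measurable_EFinP; exact: measurable_normal_pdf.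
  by move=> E _ mE; rewrite -Radon_Nikodym_SigmaFinite.f_integral.
Qed.

(** Completing the square: an exponential weight shifts the mean of a normal
    law. *)
Lemma expR_normal_pdf (m s t x : R) : s != 0%R ->
  (expR (t * x) * normal_pdf m s x =
   expR (t * m + t ^+ 2 * s ^+ 2 / 2) * normal_pdf (m + t * s ^+ 2) s x)%R.
Proof.
move=> s0; rewrite !normal_pdfE//.
rewrite mulrCA [RHS]mulrCA; congr (_ * _)%R.
rewrite /normal_fun -!expRD; congr expR.
by field.
Qed.

Lemma normal_mgf (m s t : R) : s != 0%R ->
  \int[normal_prob m s]_x (expR (t * x))%:E =
  (expR (t * m + t ^+ 2 * s ^+ 2 / 2))%:E.
Proof.
move=> s0; rewrite ge0_integral_normal_prob//; last first.
  apply/measurable_EFinP; exact: measurableT_comp.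
under eq_integral do rewrite -EFinM expR_normal_pdf// EFinM.
rewrite integralZl//=; last exact: integrable_normal_pdf.
by rewrite integral_normal_pdf mule1.
Qed.

(** The value [s = 0] covers the degenerate laws. *)
Lemma gaussian_law_mgf d (T : measurableType d) (P : probability T R)
    (X : T -> R) : measurable_fun setT X ->
  gaussian_law (pushforward P X) ->
  exists m s : R, forall t,
    \int[P]_w (expR (t * X w))%:E = (expR (t * m + t ^+ 2 * s ^+ 2 / 2))%:E.
Proof.
move=> mX [m [s [_ lawX]]]; exists m, s => t.
pose X' : {mfun T >-> measurableTypeR R} := HB.pack (X : T -> measurableTypeR R)
  (isMeasurableFun.Build _ _ T (measurableTypeR R) X mX).
have mexp : measurable_fun [set: R] (fun x : R => (expR (t * x))%:E).
  apply/measurable_EFinP; exact: measurableT_comp.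
transitivity (\int[distribution P X']_x (expR (t * x))%:E).
  by rewrite ge0_integral_distribution// => x; rewrite lee_fin expR_ge0.
have [s0|s0] := eqVneq s 0%R.
  transitivity (\int[\d_(m : measurableTypeR R)]_x (expR (t * x))%:E).
    apply: (@eq_measure_integral _ (measurableTypeR R) R setT
      (\d_(m : measurableTypeR R)) (distribution P X')) => A mA _.
    by have := lawX A mA; rewrite s0 eqxx.
  rewrite integral_dirac// diracT mul1e s0 expr0n/= mulr0 mul0r addr0.
  by [].
rewrite -normal_mgf//.
apply: (@eq_measure_integral _ (measurableTypeR R) R setT
  (normal_prob m s) (distribution P X')) => A mA _.
by have := lawX A mA; rewrite (negbTE s0).
Qed.

End normal_mgf.

Section moments_of_mgf.
Context {R : realType} d (T : measurableType d) (P : probability T R).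
Variables (X : T -> R) (m s : R).
Hypothesis mX : measurable_fun setT X.
Local Open Scope ereal_scope.
Hypothesis mgf : forall t,
  \int[P]_w (expR (t * X w))%:E = (expR (t * m + t ^+ 2 * s ^+ 2 / 2))%:E.

Lemma measurable_expRM t : measurable_fun setT (fun w => expR (t * X w)).
Proof. by apply: measurableT_comp => //=; exact/measurable_funM. Qed.

Lemma integrable_mgf t : P.-integrable setT (fun w => (expR (t * X w))%:E).
Proof.
apply/integrableP; split.
  by apply/measurable_EFinP; exact: measurable_expRM.
under eq_integral do rewrite gee0_abs ?lee_fin ?expR_ge0//.
by rewrite mgf ltry.
Qed.

Let dom t w := (expR (t * X w) + expR (- t * X w))%R.

Let integrable_dom t : P.-integrable setT (EFin \o dom t).
Proof.
have -> : EFin \o dom t =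
    (fun w => (expR (t * X w))%:E) \+ (fun w => (expR (- t * X w))%:E).
  by apply/funext => w; rewrite /dom /= EFinD.
by apply: integrableD => //; exact: integrable_mgf.
Qed.

(** The mean is the limit of the means of [n (exp (X / n) - 1)], which
    exponentials of [2 X] and [- 2 X] dominate. *)
Lemma mgf_mean : P.-integrable setT (EFin \o X) /\ \int[P]_w (X w)%:E = m%:E.
Proof.
pose f n w := (n.+1%:R * (expR (X w / n.+1%:R) - 1))%R.
have mf n : measurable_fun setT (fun w => (f n w)%:E).
  apply/measurable_EFinP; apply: measurable_funM => //.
  apply: measurable_funB => //.
  by apply: measurableT_comp => //=; exact/measurable_funM.
have := @dominated_convergence _ _ _ P setT measurableT
  (fun n w => (f n w)%:E) (EFin \o X) (EFin \o dom 2) mf.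
case.
- exact/measurable_EFinP.
- apply: aeW => w _; apply/fine_cvgP; split; first exact: nearW.
  by apply: (@cvg_expR_quotient _ (fun n => n.+1%:R)) => //;
    [exact: cvg_harmonic|exact: cvg_cst].
- exact: integrable_dom.
- apply: aeW => w n _ /=; rewrite lee_fin /f /dom normrM ger0_norm//.
  have n0 : (0 < n.+1%:R :> R)%R by [].
  have -> : (- 2 * X w = - (2 * X w))%R by rewrite mulNr.
  apply: le_trans (expR_norm_le _).
  apply: (@le_trans _ _ (n.+1%:R * (`|X w / n.+1%:R| * expR `|X w / n.+1%:R|))%R).
    by rewrite ler_wpM2l// norm_expR_sub1.
  rewrite mulrA normrM (ger0_norm (_ : 0 <= n.+1%:R^-1)%R) ?invr_ge0//.
  rewrite [(n.+1%:R * _)%R]mulrC divfK ?gt_eqF//.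
  rewrite normrM (ger0_norm (_ : 0 <= 2 :> R)%R)// mulr_natl mulr2n expRD.
  apply: ler_pM => //; first exact: le_expR_id.
  rewrite ler_expR ler_pdivrMr// ler_peMr//.
  by rewrite ler1n.
move=> iX _ cX; split => //.
have : [sequence \int[P]_w (f n w)%:E]_n @ \oo --> m%:E.
  have -> : [sequence \int[P]_w (f n w)%:E]_n = (fun n => (n.+1%:R * (expR
      ((m + s ^+ 2 / 2 * n.+1%:R^-1) / n.+1%:R) - 1))%:E).
    apply/funext => n /=; rewrite /f.
    under eq_integral do rewrite EFinM EFinB mulrC.
    rewrite integralZl//; last first.
      apply: integrableB => //; first exact: integrable_mgf.
      exact: finite_measure_integrable_cst.
    rewrite integralB_EFin//; last 2 first.
    - exact: integrable_mgf.
    - exact: finite_measure_integrable_cst.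
    rewrite mgf /= (integral_cst_probability P 1) -EFinB -EFinM.
    congr (_ * (expR _ - 1))%:E; field.
    by rewrite nat1r pnatr_eq0.
  apply/fine_cvgP; split; first exact: nearW.
  apply: (@cvg_expR_quotient _ (fun n => n.+1%:R)) => //; first exact: cvg_harmonic.
  rewrite -[m in X in _ --> X]addr0; apply: cvgD; first exact: cvg_cst.
  rewrite -[(0 : R)%R](mulr0 (s ^+ 2 / 2)%R).
  by apply: cvgMl_tmp; exact: cvg_harmonic.
move/cvg_lim => <-//; apply/esym/cvg_lim => //.
Qed.

(** Likewise with the second difference quotient
    [n ^ 2 (exp (X / n) + exp (- X / n) - 2)]. *)
Lemma mgf_variance : m = 0%R ->
  P.-integrable setT (fun w => (X w ^+ 2)%:E) /\
  \int[P]_w (X w ^+ 2)%:E = (s ^+ 2)%:E.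
Proof.
move=> m0.
pose f n w := (n.+1%:R ^+ 2 *
  (expR (X w / n.+1%:R) + expR (- (X w / n.+1%:R)) - 2))%R.
have fE n w : f n w = ((n.+1%:R * (expR (X w / n.+1%:R) - 1)) ^+ 2 *
    expR (- (X w / n.+1%:R)))%R.
  rewrite /f exprMn -[RHS]mulrA; congr (_ * _)%R.
  have e1 : (expR (X w / n.+1%:R) * expR (- (X w / n.+1%:R)) = 1)%R.
    by rewrite -expRD subrr expR0.
  move: e1; set a := expR _; set b := expR _ => e1.
  have -> : ((a - 1) ^+ 2 * b = a * (a * b) - 2 * (a * b) + b)%R by ring.
  by rewrite e1; ring.
have mf n : measurable_fun setT (fun w => (f n w)%:E).
  apply/measurable_EFinP; apply: measurable_funM => //.
  apply: measurable_funB => //; apply: measurable_funD => //.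
    by apply: measurableT_comp => //=; exact/measurable_funM.
  apply: measurableT_comp => //=; apply: measurable_funN.
  exact/measurable_funM.
have := @dominated_convergence _ _ _ P setT measurableT
  (fun n w => (f n w)%:E) (fun w => (X w ^+ 2)%:E)
  (fun w => 2%:E * (EFin \o dom 4) w) mf.
case.
- by apply/measurable_EFinP; exact: measurable_funX.
- apply: aeW => w _; apply/fine_cvgP; split; first exact: nearW.
  rewrite [X in X @ _ --> _](_ : _ = fun n =>
    ((n.+1%:R * (expR (X w / n.+1%:R) - 1)) ^+ 2 *
    expR (- (X w / n.+1%:R)))%R); last by apply/funext => n /=; rewrite fE.
  have hX : ((n.+1%:R * (expR (X w / n.+1%:R) - 1)) @[n --> \oo] --> X w)%R.
    by apply: (@cvg_expR_quotient _ (fun n => n.+1%:R)) => //;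
    [exact: cvg_harmonic|exact: cvg_cst].
  rewrite -[X in _ --> X]mulr1; apply: cvgM.
    by rewrite expr2; apply: cvgM.
  rewrite -[X in _ --> X]expR0 -[X in expR X]oppr0.
  have h0 : ((X w / n.+1%:R) @[n --> \oo] --> (0 : R))%R.
    by rewrite -[X in _ --> X](mulr0 (X w)); apply: cvgMl_tmp; exact: cvg_harmonic.
  exact: (cvg_comp _ _ (cvgN h0) (@continuous_expR R _)).
- by apply: integrableZl => //; exact: integrable_dom.
- apply: aeW => w n _ /=; rewrite lee_fin fE /dom normrM normrX.
  have n0 : (0 < n.+1%:R :> R)%R by [].
  have n1 : (1 <= n.+1%:R :> R)%R by rewrite ler1n.
  have -> : (- 4 * X w = - (4 * X w))%R by rewrite mulNr.
  apply: (@le_trans _ _ (2 * expR `|4 * X w|)%R); last first.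
    by rewrite ler_pM2l// expR_norm_le.
  have hn : (`|X w / n.+1%:R| <= `|X w|)%R.
    rewrite normrM (ger0_norm (_ : 0 <= n.+1%:R^-1)%R) ?invr_ge0//.
    by rewrite ler_pdivrMr// ler_peMr.
  apply: (@le_trans _ _ ((`|X w| * expR `|X w|) ^+ 2 * expR `|X w|)%R).
    apply: ler_pM => //; rewrite ?sqr_ge0//; last first.
      rewrite ger0_norm ?expR_ge0// ler_expR.
      by rewrite (le_trans _ hn)// -normrN ler_norm.
    rewrite lerXn2r ?nnegrE ?mulr_ge0 ?expR_ge0// normrM ger0_norm//.
    apply: (@le_trans _ _ (n.+1%:R * (`|X w / n.+1%:R| * expR `|X w / n.+1%:R|))%R).
      by rewrite ler_wpM2l// norm_expR_sub1.
    rewrite mulrA normrM (ger0_norm (_ : 0 <= n.+1%:R^-1)%R) ?invr_ge0//.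
    rewrite [(n.+1%:R * _)%R]mulrC divfK ?gt_eqF//.
    rewrite ler_wpM2l// ler_expR; move: hn.
    by rewrite normrM (ger0_norm (_ : 0 <= n.+1%:R^-1)%R) ?invr_ge0.
  rewrite exprMn normrM (ger0_norm (_ : 0 <= 4 :> R)%R)//.
  have -> : (4 * `|X w| = `|X w| + (`|X w| + `|X w| + `|X w|))%R by ring.
  rewrite expRD [leRHS]mulrA -[leLHS]mulrA; apply: ler_pM.
  - exact: sqr_ge0.
  - by rewrite mulr_ge0 ?sqr_ge0 ?expR_ge0.
  - exact: sqr_le_expR.
  - by rewrite expr2 -!expRD.
move=> iX _ cX; split => //.
have : [sequence \int[P]_w (f n w)%:E]_n @ \oo --> (s ^+ 2)%:E.
  have -> : [sequence \int[P]_w (f n w)%:E]_n = (fun n =>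
      (2 * (n.+1%:R ^+ 2 * (expR
      ((s ^+ 2 / 2) / n.+1%:R ^+ 2) - 1)))%:E).
    apply/funext => n /=; rewrite /f.
    have i1 := integrable_mgf n.+1%:R^-1.
    have i2 := integrable_mgf (- n.+1%:R^-1).
    have ic : P.-integrable setT (EFin \o cst (2 : R)%R).
      exact: finite_measure_integrable_cst.
    have e1 w : (- (X w / n.+1%:R) = - n.+1%:R^-1 * X w)%R by rewrite mulNr mulrC.
    have e2 w : (X w / n.+1%:R = n.+1%:R^-1 * X w)%R by rewrite mulrC.
    under eq_integral do rewrite EFinM EFinB EFinD e1 e2.
    rewrite integralZl//; last by apply: integrableB => //; exact: integrableD.
    rewrite integralB//; last exact: integrableD.
    rewrite integralD// !mgf /= (integral_cst_probability P 2).
    rewrite -EFinM m0 !mulr0 !add0r sqrrN exprVn; congr (_ %:E).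
    have -> : (n.+1%:R ^- 2 * s ^+ 2 / 2 = s ^+ 2 / 2 / n.+1%:R ^+ 2)%R.
      by rewrite -mulrA mulrC.
    by ring.
  apply/fine_cvgP; split; first exact: nearW.
  rewrite -[(s ^+ 2)%R in X in _ --> X](@divfK _ 2%R)// [X in _ --> X]mulrC.
  apply: cvgMl_tmp; apply: (@cvg_expR_quotient _ (fun n => n.+1%:R ^+ 2)%R).
  - by move=> n; rewrite exprn_gt0.
  - rewrite -[X in _ --> X](mulr0 (0 : R)%R).
    under eq_fun do rewrite expr2 invfM.
    by apply: cvgM; exact: cvg_harmonic.
  - exact: cvg_cst.
move/cvg_lim => <-//; apply/esym/cvg_lim => //.
Qed.

End moments_of_mgf.

(** * From Gaussian tails to moments *)

Section series_bounds.
Context {R : realType}.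
Local Open Scope ereal_scope.

Lemma nneseries_le_geometric (u : (\bar R)^nat) (A q : R) :
  (0 <= A)%R -> (0 <= q < 1)%R -> (forall n, 0 <= u n) ->
  (forall n, u n <= (A * q ^+ n)%:E) ->
  \sum_(0 <= n <oo) u n <= (A / (1 - q))%:E.
Proof.
move=> A0 /andP[q0 q1] u0 uA.
apply: lime_le; first by apply: is_cvg_nneseries.
near=> n.
apply: (@le_trans _ _ (\sum_(0 <= i < n) (A * q ^+ i)%:E)).
  by apply: lee_sum => i _.
rewrite sumEFin lee_fin ler_pdivlMr; last by rewrite subr_gt0.
have -> : (\sum_(0 <= i < n) A * q ^+ i = A * \sum_(0 <= i < n) q ^+ i)%R.
  by rewrite big_distrr.
rewrite -mulrA mulrC -[leRHS]mul1r; apply: ler_wpM2r => //.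
have geo k : ((\sum_(0 <= i < k) q ^+ i) * (1 - q) = 1 - q ^+ k)%R.
  elim: k => [|k IH]; first by rewrite big_geq// mul0r expr0 subrr.
  by rewrite big_nat_recr//= mulrDl IH exprS; ring.
rewrite geo.
by rewrite gerBl exprn_ge0.
Unshelve. all: by end_near. Qed.

(** The integral of a nonnegative function is the supremum of those of the simple
    functions below it. *)
Lemma ge0_le_integralT d (T : measurableType d) (mu : {measure set T -> \bar R})
    (f g : T -> \bar R) : (forall x, 0 <= f x) ->
  (forall x, f x <= g x) -> \int[mu]_x f x <= \int[mu]_x g x.
Proof.
move=> f0 fg; rewrite !ge0_integralTE//; last first.
  by move=> x; exact: le_trans (fg x).
apply: le_ereal_sup => _ [h hf <-]; exists h => // x.
exact: le_trans (fg x).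
Qed.

(** Bernoulli's inequality, applied to the power [N] of [expR (x / N)]. *)
Lemma expR_div_le (x : R) (N : nat) : (0 < N)%N -> (0 <= x)%R ->
  (expR (x / N%:R) <= 1 + expR x / N%:R)%R.
Proof.
move=> N0 x0; have N0' : (0 < N%:R :> R)%R by rewrite ltr0n.
have bern (n : nat) (y : R) : (0 <= y)%R -> (1 + n%:R * y <= (1 + y) ^+ n)%R.
  move=> y0; elim: n => [|n IH]; first by rewrite mul0r addr0 expr0.
  rewrite exprS mulrDl mul1r -natr1.
  have : (y <= y * (1 + y) ^+ n)%R.
    by rewrite ler_peMr// exprn_ege1// lerDl.
  by move: IH; set a := ((1 + y) ^+ n)%R; lra.
have h := bern N (expR (x / N%:R) - 1)%R.
have e0 : (0 <= expR (x / N%:R) - 1)%R.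
  by rewrite subr_ge0 -expR0 ler_expR divr_ge0// ltW.
have := h e0; rewrite addrCA subrr addr0 -expRM_natl.
have -> : (N%:R * (x / N%:R) = x)%R by rewrite mulrC divfK// gt_eqF.
move=> h1; rewrite -lerBlDl ler_pdivlMr//.
by apply: le_trans h1; rewrite mulrC lerDr.
Qed.

(** The exponential of [de * X ^ 2] is at most its bound on the first level where
    [X] is controlled, and for small [de] the tails make the sum over the levels
    finite. Dividing the exponent by a large integer then moves the moment as
    close to one as desired. *)
Lemma exp_square_moment_of_tails (K c a b : R) :
  (0 < K)%R -> (0 < c)%R -> (0 <= a)%R -> (0 <= b)%R ->
  exists C : R, (0 < C)%R /\
  forall d (T : measurableType d) (P : probability T R) (X : T -> R)
    (E : (set T)^nat),
  (forall w, 0 <= X w)%R -> (forall n, measurable (E n)) ->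
  (forall n, P (E n) <= (K * expR (- c * n%:R ^+ 2))%:E) ->
  (forall n w, ~ E n w -> X w <= a * n%:R + b)%R ->
  \int[P]_w (expR (C^-1 * X w ^+ 2))%:E <= 2%:E.
Proof.
move=> K0 c0 a0 b0.
(* half of the Gaussian decay of the tails absorbs [de * X ^ 2] *)
pose de : R := (c / (8 * a ^+ 2 + 8))%R.
have den0 : (0 < 8 * a ^+ 2 + 8)%R by rewrite ltr_wpDl// mulr_ge0 ?sqr_ge0.
have de0 : (0 < de)%R by rewrite divr_gt0.
have dec : (4 * a ^+ 2 * de <= c / 2)%R.
  rewrite /de mulrCA mulrA ler_pdivrMr//.
  have := sqr_ge0 a; nra.
pose B : R := (de * (4 * a ^+ 2 + 2 * b ^+ 2))%R.
pose q := expR (- (c / 2)).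
have q01 : (0 <= q < 1)%R by rewrite expR_ge0/= expR_lt1 oppr_lt0 divr_gt0.
pose K' : R := (expR (de * b ^+ 2) + K * expR B / (1 - q))%R.
have K'0 : (0 <= K')%R.
  rewrite addr_ge0 ?expR_ge0// divr_ge0 ?mulr_ge0 ?expR_ge0 ?(ltW K0)//.
  by rewrite subr_ge0 ltW//; case/andP: q01.
pose N := (Num.truncn K').+1.
have N0 : (0 < N%:R :> R)%R by rewrite ltr0n.
have NK : (K' <= N%:R)%R by rewrite ltW// truncnS_gt.
exists (N%:R / de)%R; split; first by rewrite divr_gt0.
move=> d T P X E X0 mE PE XE.
pose r n : R := expR (de * (a * n.+1%:R + b) ^+ 2).
pose S w := \sum_(0 <= n <oo) (r n * \1_(E n) w)%:E.
have term0 n w : 0 <= (r n * \1_(E n) w)%:E.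
  by rewrite lee_fin mulr_ge0 ?expR_ge0// indicE ler0n.
have S0 w : 0 <= S w by apply: nneseries_ge0 => n _ _.
have mterm n : measurable_fun setT (fun w => (r n * \1_(E n) w)%:E).
  apply/measurable_EFinP; apply: measurable_funM => //.
have mS : measurable_fun setT S.
  by apply: ge0_emeasurable_sum => // n w _ _; exact: term0.
have dom w : (expR (de * X w ^+ 2))%:E <= (expR (de * b ^+ 2))%:E + S w.
  have [nE0|E0] := pselect (~ E 0%N w).
    rewrite -[leLHS]adde0 leeD// lee_fin ler_expR ler_pM2l//.
    rewrite lerXn2r ?nnegrE ?X0//.
    by have := XE _ _ nE0; rewrite mulr0 add0r.
  have {}E0 : E 0%N w by apply: contrapT.
  have one n : E n w -> (X w <= a * n.+1%:R + b)%R ->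
      (expR (de * X w ^+ 2))%:E <= (expR (de * b ^+ 2))%:E + S w.
    move=> En Xn; rewrite -[leLHS]add0e leeD ?lee_fin ?expR_ge0//.
    apply: (@le_trans _ _ (r n * \1_(E n) w)%:E).
      rewrite indicE mem_set// mulr1 lee_fin ler_expR ler_pM2l//.
      rewrite lerXn2r ?nnegrE ?X0// addr_ge0// mulr_ge0//.
    apply: (@le_trans _ _ (\sum_(0 <= k < n.+1) (r k * \1_(E k) w)%:E)).
      rewrite big_nat_recr//= leeDr// sume_ge0// => k _; exact: term0.
    by apply: nneseries_lim_ge => k _ _; exact: term0.
  (* [S] is infinite if no level controls [X] *)
  have [alln|] := pselect (forall n, E n w).
    have SY : S w = +oo.
      apply/eqyP => A A0; apply: (@le_trans _ _ (\sum_(0 <= k < (Num.truncn A).+1) 1%:E)).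
        rewrite sumEFin lee_fin big_const_nat subn0 iter_addr_0 ltW//.
        exact: truncnS_gt.
      apply: (@le_trans _ _ (\sum_(0 <= k < (Num.truncn A).+1) (r k * \1_(E k) w)%:E)).
        apply: lee_sum => k _; rewrite lee_fin indicE mem_set// mulr1.
        by rewrite -expR0 ler_expR mulr_ge0 ?sqr_ge0// ltW.
      by apply: nneseries_lim_ge => k _ _; exact: term0.
    by rewrite SY addey ?leey.
  move=> /existsNP nE.
  have nE' : exists n, `[<~ E n w>] by case: nE => n En; exists n; exact/asboolP.
  have [[|n] /asboolP nEn nmin] := ex_minnP nE'; first by [].
  apply: (one n); last exact: XE.
  apply: contrapT => nEn'; have /asboolP/nmin := nEn'.
  by rewrite ltnn.
have intS : \int[P]_w S w <= (K * expR B / (1 - q))%:E.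
  rewrite integral_nneseries//.
  apply: nneseries_le_geometric => //.
  - by rewrite mulr_ge0 ?expR_ge0// ltW.
  - by move=> n; apply: integral_ge0.
  - move=> n; under eq_integral do rewrite EFinM.
    rewrite ge0_integralZl//; last 2 first.
    + by apply/measurable_EFinP; exact: measurable_indic.
    + by rewrite lee_fin expR_ge0.
    rewrite integral_indic// setIT.
    apply: (@le_trans _ _ ((r n)%:E * (K * expR (- c * n%:R ^+ 2))%:E)).
      by apply: lee_wpmul2l; [rewrite lee_fin expR_ge0|exact: PE].
    rewrite -EFinM lee_fin mulrCA -mulrA ler_pM2l// -expRM_natl /r -!expRD ler_expR.
    have nn : (n%:R <= n%:R ^+ 2 :> R)%R.
      by rewrite -natrX ler_nat; case: (n) => // k; rewrite leq_pmulr.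
    have h1 : ((a * n.+1%:R + b) ^+ 2 <= 4 * a ^+ 2 * n%:R ^+ 2 + (4 * a ^+ 2 + 2 * b ^+ 2))%R.
      rewrite -natr1 -subr_ge0.
      set x := (n%:R : R)%R.
      have -> : (4 * a ^+ 2 * x ^+ 2 + (4 * a ^+ 2 + 2 * b ^+ 2) - (a * (x + 1) + b) ^+ 2
        = 2 * (a * (x - 1)) ^+ 2 + (a * (x + 1) - b) ^+ 2)%R by ring.
      have := sqr_ge0 (a * (x - 1))%R; have := sqr_ge0 (a * (x + 1) - b)%R.
      by move=> ? ?; lra.
    have h2 := ler_wpM2l (ltW de0) h1.
    have h3 := ler_wpM2r (sqr_ge0 (n%:R : R)%R) dec.
    have h4 := ler_wpM2l (ltW c0) nn.
    rewrite /B; move: h2 h3 h4; set x := (n%:R : R)%R; move=> h2 h3 h4; lra.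
pose h w := 1 + N%:R^-1%:E * ((expR (de * b ^+ 2))%:E + S w).
apply: (@le_trans _ _ (\int[P]_w h w)).
  apply: ge0_le_integralT => w; first by rewrite lee_fin expR_ge0.
  rewrite invf_div.
  apply: (@le_trans _ _ (1 + N%:R^-1%:E * (expR (de * X w ^+ 2))%:E)).
    rewrite -EFinM -EFinD lee_fin mulrAC [(_^-1 * _)%R]mulrC.
    by apply: expR_div_le => //; rewrite mulr_ge0 ?sqr_ge0// ltW.
  by rewrite leeD2l// lee_wpmul2l// lee_fin invr_ge0 ltW.
rewrite ge0_integralD//; last 2 first.
- move=> w _; rewrite mule_ge0 ?adde_ge0 ?lee_fin ?expR_ge0 ?invr_ge0//.
- apply: measurable_funeM; apply: emeasurable_funD => //.
rewrite (integral_cst_probability P 1).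
have mS' : measurable_fun setT (fun w => (expR (de * b ^+ 2))%:E + S w).
  exact: emeasurable_funD.
have S'0 w : setT w -> 0 <= (expR (de * b ^+ 2))%:E + S w.
  by move=> _; rewrite adde_ge0 ?lee_fin ?expR_ge0.
have Ni0 : 0 <= (N%:R^-1 : R)%:E by rewrite lee_fin invr_ge0.
rewrite ge0_integralZl//.
rewrite ge0_integralD//.
rewrite integral_cst_probability.
rewrite (_ : 2%:E = 1 + 1)// leeD2l//.
apply: (@le_trans _ _ (N%:R^-1%:E * K'%:E)).
  by rewrite lee_wpmul2l ?lee_fin ?invr_ge0// EFinD leeD2l.
by rewrite -EFinM lee_fin ler_pdivrMl// mulr1.
Qed.

End series_bounds.

(** * Linear combinations of the values of a Gaussian field *)

Section gaussian_combinations.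
Context {disp : measure_display} {T : measurableType disp} {R : realType}.
Context {P : probability T R} {d : nat}.
Variable G : 'rV[R]_d -> {RV P >-> R}.
Hypotheses (gG : gaussian_field G) (cG : centered_field G)
  (sG : stationary_field G).
Local Notation C := (covariance_fun G).
Implicit Types (l : seq (R * 'rV[R]_d)) (x y z : 'rV[R]_d).

Definition comb l (w : T) : R := \sum_(p <- l) p.1 * G p.2 w.

Lemma measurable_comb l : measurable_fun setT (comb l).
Proof.
rewrite /comb; apply: measurable_sum => p.
exact: measurable_funM.
Qed.

Lemma comb_mgf l : exists m s : R, forall t,
  (\int[P]_w (expR (t * comb l w))%:E =
   (expR (t * m + t ^+ 2 * s ^+ 2 / 2))%:E)%E.
Proof.
apply: gaussian_law_mgf; first exact: measurable_comb.
have := gG (fun i : 'I_(size l) => (tnth (in_tuple l) i).2)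
  (fun i => (tnth (in_tuple l) i).1).
rewrite [X in pushforward P X](_ : _ = comb l)//.
by apply/funext => w; rewrite /comb [RHS]big_tnth.
Qed.

Lemma comb1 x w : comb [:: (1, x)] w = G x w.
Proof. by rewrite /comb big_seq1 mul1r. Qed.

Lemma gauss_mean x : P.-integrable setT (EFin \o G x) /\
  (\int[P]_w (G x w)%:E = 0)%E.
Proof.
have [m [s h]] := comb_mgf [:: (1, x)].
have {}h t : (\int[P]_w (expR (t * G x w))%:E =
   (expR (t * m + t ^+ 2 * s ^+ 2 / 2))%:E)%E.
  by rewrite -h; apply: eq_integral => w _; rewrite comb1.
have [//|iG _] := mgf_mean _ h; split => //.
by have := cG x; rewrite unlock.
Qed.

Lemma comb_mean l : (\int[P]_w (comb l w)%:E = 0)%E.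
Proof.
under eq_integral do rewrite -sumEFin.
rewrite integral_sum//; last first.
  move=> p; under eq_fun do rewrite EFinM.
  by apply: integrableZl => //; have [] := gauss_mean p.2.
rewrite big1// => p _.
under eq_integral do rewrite EFinM.
have [iG G0] := gauss_mean p.2.
by rewrite integralZl// G0 mule0.
Qed.

Lemma comb_moments l : exists s : R,
  [/\ forall t, (\int[P]_w (expR (t * comb l w))%:E =
        (expR (t ^+ 2 * s ^+ 2 / 2))%:E)%E,
      P.-integrable setT (fun w => (comb l w ^+ 2)%:E)
    & (\int[P]_w (comb l w ^+ 2)%:E = (s ^+ 2)%:E)%E].
Proof.
have [m [s h]] := comb_mgf l; exists s.
have [_ me] := mgf_mean (measurable_comb l) h.
have m0 : m = 0 by apply: EFin_inj; rewrite -me comb_mean.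
have [i2 e2] := mgf_variance (measurable_comb l) h m0.
by split => // t; rewrite h m0 mulr0 add0r.
Qed.

Lemma integrable_GG x y : P.-integrable setT (fun w => (G x w * G y w)%:E).
Proof.
have sq z : P.-integrable setT (fun w => (G z w ^+ 2)%:E).
  have [s [_ + _]] := comb_moments [:: (1, z)].
  by under eq_fun do rewrite comb1.
apply: (le_integrable measurableT _ _ (integrableD measurableT (sq x) (sq y))).
  by apply/measurable_EFinP; exact: measurable_funM.
move=> w _; rewrite -EFinD !abse_EFin lee_fin.
rewrite [leRHS]ger0_norm ?addr_ge0 ?sqr_ge0// normrM.
rewrite -(real_normK (num_real (G x w))) -(real_normK (num_real (G y w))).
have := sqr_ge0 (`|G x w| - `|G y w|).
have : 0 <= `|G x w| * `|G y w| by rewrite mulr_ge0.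
nra.
Qed.

(** The product depends on the pair of the values at [x] and [y], which has the law
    of the pair at [x - y] and [0]. *)
Lemma integral_GG x y : (\int[P]_w (G x w * G y w)%:E = (C (x - y))%:E)%E.
Proof.
have fC : (C (x - y))%:E = (\int[P]_w (G (x - y) w * G 0 w)%:E)%E.
  rewrite /covariance_fun unlock fineK//.
  exact: integrable_fin_num (integrable_GG _ _).
rewrite {}fC.
pose pt (b : bool) : 'I_2 -> 'rV[R]_d :=
  fun i => (if i == 0 then x - y else 0) + (if b then y else 0).
pose X b (w : T) : 'rV[R]_2 := \row_i G (pt b i) w.
have mX b : measurable_fun setT (X b).
  apply/measurable_fun_rVP => i.
  have -> : (fun w => X b w ord0 i) = G (pt b i) by apply/funext => w; rewrite mxE.
  exact: measurable_funPT.
pose Xm b : {mfun T >-> 'rV[R]_2} := HB.pack (X b)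
  (isMeasurableFun.Build _ _ T _ (X b) (mX b)).
pose f (v : 'rV[R]_2) := (v ord0 0 * v ord0 1)%:E.
have mf : measurable_fun [set: 'rV[R]_2] f.
  by apply/measurable_EFinP; apply: measurable_funM; exact: measurable_rV_coord.
have fX b w : f (X b w) = (G (pt b 0) w * G (pt b 1) w)%:E by rewrite /f !mxE.
have iX b : P.-integrable setT (f \o Xm b).
  by apply: eq_integrable (integrable_GG (pt b 0) (pt b 1)) => // w _ /=; rewrite fX.
have eqX b : (\int[P]_w (G (pt b 0) w * G (pt b 1) w)%:E =
    \int[distribution P (Xm b)]_v f v)%E.
  by rewrite integral_distribution//; apply: eq_integral => w _ /=; rewrite fX.
have := eqX true; rewrite /pt/= subrK add0r => ->.
have := eqX false; rewrite /pt/= !addr0 => ->.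
apply: eq_measure_integral => A mA _.
have := @sG 2 (pt false) y A mA; rewrite /distribution /pushforward/=.
have -> : (fun w => A (\row_i G (pt false i + y) w)) = (fun w => A (X true w)).
  by apply/funext => w; congr A; apply/rowP => i; rewrite !mxE /pt addr0.
by [].
Qed.

Definition comb_var l : R := \sum_(p <- l) \sum_(q <- l) p.1 * q.1 * C (p.2 - q.2).

Lemma integral_comb_sqr l : (\int[P]_w (comb l w ^+ 2)%:E = (comb_var l)%:E)%E.
Proof.
have e w : ((comb l w ^+ 2)%:E =
   \sum_(p <- l) \sum_(q <- l) (p.1 * q.1)%:E * (G p.2 w * G q.2 w)%:E)%E.
  rewrite expr2 {1}/comb big_distrl/= -sumEFin; apply: eq_bigr => p _.
  rewrite /comb big_distrr/= -sumEFin; apply: eq_bigr => q _.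
  by rewrite -EFinM; congr EFin; ring.
under eq_integral do rewrite e.
have i2 p q : P.-integrable setT (fun w => (p.1 * q.1)%:E * (G p.2 w * G q.2 w)%:E)%E.
  by apply: integrableZl => //; exact: integrable_GG.
rewrite integral_sum//; last by move=> p; apply: integrable_sum => // q _; exact: i2.
rewrite /comb_var -sumEFin; apply: eq_bigr => p _.
rewrite integral_sum// -sumEFin; apply: eq_bigr => q _.
by rewrite integralZl ?integral_GG//; exact: integrable_GG.
Qed.

(** A centered Gaussian law is determined by its variance. *)
Lemma integral_expR_comb (t : R) l :
  (\int[P]_w (expR (t * comb l w))%:E = (expR (t ^+ 2 * comb_var l / 2))%:E)%E.
Proof.
have [s [h _ h2]] := comb_moments l.
rewrite h; congr (expR (_ * _ / 2))%:E; apply: EFin_inj.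
by rewrite -h2 integral_comb_sqr.
Qed.

Lemma comb_var_ge0 l : 0 <= comb_var l.
Proof.
rewrite -lee_fin -integral_comb_sqr; apply: integral_ge0 => w _.
by rewrite lee_fin sqr_ge0.
Qed.

Lemma covariance_sym x : C (- x) = C x.
Proof.
apply: EFin_inj; rewrite -[x]subr0 -integral_GG -[- (x - 0)]add0r subr0.
by rewrite -integral_GG; apply: eq_integral => w _; rewrite mulrC.
Qed.

(** The sum and the difference of [G x] and [G 0] have nonnegative variances. *)
Lemma covariance_norm_le x : `|C x| <= C 0.
Proof.
have h (e : R) : e ^+ 2 = 1 -> 0 <= 2 * C 0 + e * (C x + C (- x)).
  move=> e1; have := comb_var_ge0 [:: (1, x); (e, 0)].
  rewrite /comb_var !big_cons !big_nil/= !subrr subr0 sub0r.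
  move: e1; rewrite expr2 => e1.
  by rewrite e1 mul1r !mulr1 !mul1r !addr0; lra.
have sym := covariance_sym x.
have h1 := h 1 (expr1n _ _); have h2 := h (-1).
rewrite sqrrN expr1n in h2; have {}h2 := h2 erefl.
by rewrite sym in h1 h2; rewrite ler_norml; lra.
Qed.

(** Chernoff's bound on both sides, at the optimal parameter [u / v]. *)
Lemma comb_tail l (v u : R) : 0 < v -> comb_var l <= v -> 0 < u ->
  (P [set w | (u <= `|comb l w|)%R] <= (2 * expR (- (u ^+ 2 / (2 * v))))%:E)%E.
Proof.
move=> v0 lv u0.
have tail (e : R) : e ^+ 2 = 1 ->
    (P [set w | (u <= e * comb l w)%R] <= (expR (- (u ^+ 2 / (2 * v))))%:E)%E.
  move=> e1.
  have mX : measurable_fun setT (fun w => e * comb l w).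
    by apply: measurable_funM => //; exact: measurable_comb.
  pose X : {RV P >-> R} := HB.pack (fun w => e * comb l w)
    (isMeasurableFun.Build _ _ T R _ mX).
  have r0 : 0 < u / v by rewrite divr_gt0.
  apply: (le_trans (chernoff X u r0)).
  rewrite /mmt_gen_fun unlock.
  have -> : (\int[P]_w ((expR \o u / v \o* X) w)%:E =
     \int[P]_w (expR ((e * (u / v)) * comb l w))%:E)%E.
    apply: eq_integral => w _ /=; congr (expR _)%:E.
    by rewrite mulrAC.
  rewrite integral_expR_comb -EFinM lee_fin -expRD ler_expR exprMn e1 mul1r.
  have -> : - (u ^+ 2 / (2 * v)) = (u / v) ^+ 2 * v / 2 - u / v * u.
    by field; rewrite gt_eqF.
  rewrite lerD2r ler_pM2r// ler_pM2l// exprn_gt0//.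
have mU (e : R) : measurable [set w | u <= e * comb l w].
  rewrite -[X in measurable X]setTI.
  apply: measurable_fun_ler => //; apply: measurable_funM => //.
  exact: measurable_comb.
have -> : [set w | u <= `|comb l w|] =
    [set w | u <= 1 * comb l w] `|` [set w | u <= (-1) * comb l w].
  by apply/seteqP; split => w /=; rewrite mul1r mulN1r ler_normr => /orP.
apply: (le_trans (measureU2 _ _ _)) => //.
rewrite mulr_natl mulr2n EFinD leeD ?tail ?expr1n ?sqrrN ?expr1n//.
Qed.

End gaussian_combinations.

(** * The Euclidean norm and Lebesgue measure *)

Section euclidean_norm.
Context {R : realType} {n : nat}.
Implicit Types (x y z : 'rV[R]_n).

Let sqs_ge0 x : 0 <= \sum_i x ord0 i ^+ 2.
Proof. by apply: sumr_ge0 => i _; exact: sqr_ge0. Qed.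

Lemma enorm_ge0 x : 0 <= enorm x.
Proof. exact: sqrtr_ge0. Qed.

Lemma sqr_enorm x : enorm x ^+ 2 = \sum_i x ord0 i ^+ 2.
Proof. by rewrite sqr_sqrtr. Qed.

Lemma enorm0 : enorm (0 : 'rV[R]_n) = 0.
Proof. by rewrite /enorm big1 ?sqrtr0// => i _; rewrite mxE expr0n. Qed.

Lemma enormN x : enorm (- x) = enorm x.
Proof.
by congr Num.sqrt; apply: eq_bigr => i _; rewrite mxE sqrrN.
Qed.

Lemma enormZ (t : R) x : enorm (t *: x) = `|t| * enorm x.
Proof.
rewrite -(sqrtr_sqr t) /enorm -sqrtrM ?sqr_ge0//; congr Num.sqrt.
by rewrite mulr_sumr; apply: eq_bigr => i _; rewrite mxE exprMn.
Qed.

Lemma enormB_sym x y : enorm (x - y) = enorm (y - x).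
Proof. by rewrite -enormN opprB. Qed.

(** Lagrange's identity writes the defect as a sum of squares. *)
Lemma cauchy_schwarz x y : \sum_i x ord0 i * y ord0 i <= enorm x * enorm y.
Proof.
have h : (\sum_i x ord0 i * y ord0 i) ^+ 2 <= (enorm x * enorm y) ^+ 2.
  rewrite exprMn !sqr_enorm -subr_ge0.
  suff -> : (\sum_i x ord0 i ^+ 2) * (\sum_i y ord0 i ^+ 2) -
      (\sum_i x ord0 i * y ord0 i) ^+ 2 =
      2^-1 * \sum_i \sum_j (x ord0 i * y ord0 j - x ord0 j * y ord0 i) ^+ 2.
    rewrite mulr_ge0 ?invr_ge0// sumr_ge0// => i _; apply: sumr_ge0 => j _.
    exact: sqr_ge0.
  have e i j : (x ord0 i * y ord0 j - x ord0 j * y ord0 i) ^+ 2 =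
      x ord0 i ^+ 2 * y ord0 j ^+ 2 + x ord0 j ^+ 2 * y ord0 i ^+ 2 -
      2 * ((x ord0 i * y ord0 i) * (x ord0 j * y ord0 j)) by ring.
  under [in RHS]eq_bigr => i _ do under eq_bigr => j _ do rewrite e.
  under [in RHS]eq_bigr => i _.
    rewrite big_split/= big_split/= -mulr_sumr -mulr_suml sumrN -!mulr_sumr.
    over.
  rewrite big_split/= big_split/= -!mulr_suml sumrN -!mulr_sumr.
  set A := \sum_i _; set B := \sum_i _; set S := \sum_i _.
  by rewrite -mulr_suml -/S; field.
have [s0|s0] := leP 0 (\sum_i x ord0 i * y ord0 i).
  by rewrite -ler_sqr ?nnegrE// mulr_ge0 ?enorm_ge0.
by rewrite (le_trans (ltW s0))// mulr_ge0 ?enorm_ge0.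
Qed.

Lemma enormD_le x y : enorm (x + y) <= enorm x + enorm y.
Proof.
rewrite -ler_sqr ?nnegrE ?addr_ge0 ?enorm_ge0// sqrrD !sqr_enorm.
have -> : \sum_i (x + y) ord0 i ^+ 2 = \sum_i x ord0 i ^+ 2 +
    (\sum_i x ord0 i * y ord0 i) *+ 2 + \sum_i y ord0 i ^+ 2.
  rewrite -sumrMnl -!big_split/=; apply: eq_bigr => i _.
  by rewrite mxE sqrrD.
by rewrite lerD2r lerD2l lerMn2r/= cauchy_schwarz.
Qed.

Lemma enorm_triangle x y z : enorm (x - z) <= enorm (x - y) + enorm (y - z).
Proof. by rewrite (le_trans _ (enormD_le _ _))// subrKA. Qed.

Lemma coord_le_enorm x i : `|x ord0 i| <= enorm x.
Proof.
rewrite -ler_sqr ?nnegrE ?enorm_ge0// sqr_enorm real_normK ?num_real//.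
by rewrite (bigD1 i)//= lerDl sumr_ge0// => j _; exact: sqr_ge0.
Qed.

Lemma enorm_le_coord x (M : R) : 0 <= M -> (forall i, `|x ord0 i| <= M) ->
  enorm x <= n%:R * M.
Proof.
move=> M0 xM; rewrite -ler_sqr ?nnegrE ?enorm_ge0 ?mulr_ge0// sqr_enorm.
apply: (@le_trans _ _ (\sum_(i < n) M ^+ 2)).
  apply: ler_sum => i _; rewrite -(real_normK (num_real (x _ _))).
  by rewrite lerXn2r ?nnegrE.
rewrite sumr_const card_ord exprMn -[leLHS]mulr_natl ler_wpM2r ?sqr_ge0//.
by rewrite -natrX ler_nat; case: (n) => // k; rewrite expnS leq_pmulr.
Qed.

Lemma measurable_enorm : measurable_fun [set: 'rV[R]_n] (@enorm R n).
Proof.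
apply: (@measurableT_comp _ _ _ _ _ _ (@Num.sqrt R)).
  exact: (continuous_measurable_fun (@sqrt_continuous R)).
apply: measurable_sum => i; apply: measurable_funX.
exact: measurable_rV_coord.
Qed.

Lemma measurable_affine_rV (t : R) (u : 'rV[R]_n) :
  measurable_fun [set: 'rV[R]_n] (fun v : 'rV[R]_n => t *: v + u).
Proof.
apply/measurable_fun_rVP => i.
have -> : (fun v : 'rV[R]_n => (t *: v + u) ord0 i) =
    (fun v => t * v ord0 i + u ord0 i) by apply/funext => v; rewrite !mxE.
apply: measurable_funD => //; apply: measurable_funM => //.
exact: measurable_rV_coord.
Qed.

Lemma measurable_eball x (r : R) : measurable (eball x r).
Proof.
rewrite -[X in measurable X]setTI.
apply: measurable_fun_ltr => //.
have := measurableT_comp measurable_enorm (measurable_affine_rV 1 (- x)).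
by under eq_fun do rewrite /= scale1r.
Qed.

End euclidean_norm.

Section lebesgue_affine.
Context {R : realType}.
Local Open Scope ereal_scope.

Lemma lebesgue_measure_affine (t u : R) (A : set (measurableTypeR R)) :
  (0 < t)%R -> measurable A ->
  lebesgue_measure ((fun x : measurableTypeR R => t * x + u)%R @^-1` A) =
  t^-1%:E * lebesgue_measure A.
Proof.
move=> t0 mA.
have mf : measurable_fun [set: measurableTypeR R]
    (fun x : measurableTypeR R => (t * x + u)%R : measurableTypeR R).
  by apply: measurable_funD => //; exact: mulrl_measurable.
pose f : {mfun measurableTypeR R >-> measurableTypeR R} := HB.pack
  (fun x : measurableTypeR R => (t * x + u)%R : measurableTypeR R)
  (isMeasurableFun.Build _ _ (measurableTypeR R) (measurableTypeR R) _ mf).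
pose k : {nonneg R} := NngNum (ltW t0).
have := @lebesgue_measure_unique R (mscale k (pushforward lebesgue_measure f)).
move=> /(_ mf) lebE; rewrite [in RHS]lebE//; last first.
  move=> _ [[a b] _ <-].
  rewrite [RHS](_ : _ = t%:E * lebesgue_measure
    ((fun x : measurableTypeR R => (t * x + u)%R) @^-1` `]a, b]%classic))//=.
  have -> : (fun x : measurableTypeR R => (t * x + u)%R) @^-1` `]a, b]%classic =
      `](a - u) / t, (b - u) / t]%classic%R.
    apply/seteqP; split => x /=; rewrite !in_itv/= ltr_pdivrMr// ler_pdivlMr//;
      by rewrite ltrBlDr lerBrDr mulrC.
  rewrite !lebesgue_measure_itv/= !lte_fin ltr_pM2r ?invr_gt0// ltrD2r.
  case: ifPn => _; last by rewrite mule0.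
  rewrite -!EFinB -EFinM; congr EFin.
  by field; rewrite gt_eqF.
transitivity (t^-1%:E * (t%:E * lebesgue_measure
  ((fun x : measurableTypeR R => (t * x + u)%R) @^-1` A))); last by [].
by rewrite muleA -EFinM mulVf ?gt_eqF// mul1e.
Qed.

Lemma ge0_integral_lebesgue_affine (t u : R) (f : R -> \bar R) :
  (0 < t)%R -> measurable_fun [set: R] f -> (forall x, 0 <= f x) ->
  \int[lebesgue_measure]_x f (t * x + u)%R =
  t^-1%:E * \int[lebesgue_measure]_x f x.
Proof.
move=> t0 mf f0.
have mg : measurable_fun [set: measurableTypeR R]
    (fun x : measurableTypeR R => (t * x + u)%R : measurableTypeR R).
  by apply: measurable_funD => //; exact: mulrl_measurable.
pose g : {mfun measurableTypeR R >-> measurableTypeR R} := HB.pack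
  (fun x : measurableTypeR R => (t * x + u)%R : measurableTypeR R)
  (isMeasurableFun.Build _ _ (measurableTypeR R) (measurableTypeR R) _ mg).
have ti0 : (0 <= t^-1)%R by rewrite invr_ge0 ltW.
pose k : {nonneg R} := NngNum ti0.
rewrite -[RHS](@ge0_integral_mscale _ _ _ _ setT measurableT k)//.
rewrite [LHS](_ : _ = \int[pushforward lebesgue_measure g]_x f x); last first.
  by rewrite ge0_integral_pushforward.
apply: eq_measure_integral => A mA _.
by have := lebesgue_measure_affine u t0 mA.
Qed.

(** The coordinates are rescaled one after the other, along the construction of
    the measure. *)
Lemma lebesgue_rV_affine n (t : R) (u : 'rV[R]_n) (A : set 'rV[R]_n) :
  (0 < t)%R -> measurable A ->
  lebesgue_rV n ((fun v : 'rV[R]_n => t *: v + u)%R @^-1` A) =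
  ((t ^+ n)^-1)%:E * lebesgue_rV n A.
Proof.
move=> t0; elim: n u A => [|n IH] u A mA.
  rewrite expr0 invr1 mul1e /=.
  have -> // : (fun v : 'rV[R]_0 => t *: v + u)%R @^-1` A = A.
  by apply/seteqP; split => v /=; rewrite !thinmx0.
have mB (B : set 'rV[R]_n.+1) : measurable B -> measurable (@rV_cons R n @^-1` B).
  by move=> mB; rewrite -[X in measurable X]setTI; exact: measurable_rV_cons.
have mTA : measurable ((fun v : 'rV[R]_n.+1 => t *: v + u)%R @^-1` A).
  by rewrite -[X in measurable X]setTI; exact: measurable_affine_rV.
rewrite /= /prod_rV /pushforward /product_measure1.
pose u0 : R := u ord0 ord0; pose u' : 'rV[R]_n := (\row_i u ord0 (lift ord0 i))%R.
pose phi (x : measurableTypeR R) := lebesgue_rV n (xsection (@rV_cons R n @^-1` A) x).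
have mphi : measurable_fun [set: measurableTypeR R] phi.
  exact: measurable_fun_xsection (mB _ mA).
transitivity (\int[lebesgue_measure]_x (((t ^+ n)^-1)%:E * phi (t * x + u0)%R)).
  apply: eq_integral => x _ /=; rewrite /phi -(IH u'); last first.
    exact: measurable_xsection (mB _ mA).
  congr (lebesgue_rV n _); apply/seteqP; split => v; rewrite /xsection/= !inE/=;
    congr A; apply/rowP => i; rewrite !mxE; case: (unliftP ord0 i) => [j ->|->];
    by rewrite ?mxE.
rewrite ge0_integralZl//; last 2 first.
- apply: (@measurableT_comp _ _ _ _ _ _ phi) => //.
  by apply: measurable_funD => //; exact: mulrl_measurable.
- by rewrite lee_fin invr_ge0 exprn_ge0// ltW.
rewrite (@ge0_integral_lebesgue_affine _ _ phi)//.
by rewrite muleA -EFinM exprSr invfM.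
Qed.

Lemma ge0_integral_lebesgue_rV_affine n (t : R) (u : 'rV[R]_n)
    (f : 'rV[R]_n -> \bar R) (D : set 'rV[R]_n) :
  (0 < t)%R -> measurable D -> measurable_fun D f -> (forall x, 0 <= f x) ->
  \int[lebesgue_rV n]_(x in (fun v => t *: v + u)%R @^-1` D) f (t *: x + u)%R =
  ((t ^+ n)^-1)%:E * \int[lebesgue_rV n]_(x in D) f x.
Proof.
move=> t0 mD mf f0.
pose g : {mfun 'rV[R]_n >-> 'rV[R]_n} := HB.pack
  (fun v : 'rV[R]_n => t *: v + u)%R
  (isMeasurableFun.Build _ _ _ _ _ (measurable_affine_rV t u)).
have ti0 : (0 <= (t ^+ n)^-1)%R by rewrite invr_ge0 exprn_ge0// ltW.
pose k : {nonneg R} := NngNum ti0.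
rewrite -[RHS](@ge0_integral_mscale _ _ _ _ D mD k)//.
rewrite [LHS](_ : _ = \int[pushforward (lebesgue_rV n) g]_(x in D) f x); last first.
  by rewrite ge0_integral_pushforward.
apply: eq_measure_integral => A mA _.
by have := lebesgue_rV_affine u t0 mA.
Qed.

End lebesgue_affine.

(** * Balls, translations and joint measurability *)

Section ball_volume.
Context {R : realType} {n : nat}.
Local Notation mu := (@lebesgue_rV R n).
Implicit Types (x y : 'rV[R]_n) (r : R).

Definition unit_volume : R := fine (mu (eball 0 1)).

Let box (l : R) : set 'rV[R]_n :=
  [set v | forall i, `]- l, l[%classic (v ord0 i)].

Let mbox l : measurable (box l).
Proof.
have -> : box l = \bigcap_(i in [set: 'I_n])
    ((fun v : 'rV[R]_n => v ord0 i) @^-1` `]- l, l[%classic).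
  by apply/seteqP; split => v /= h i; [move=> _|]; exact: h.
apply: fin_bigcap_measurable => // i _.
rewrite -[X in measurable X]setTI; apply: measurable_rV_coord => //.
Qed.

Let vol_box l : 0 < l -> mu (box l) = ((l *+ 2) ^+ n)%:E.
Proof.
move=> l0; rewrite (@lebesgue_rV_box R n (fun=> `]- l, l[%classic))//.
transitivity (\prod_(i < n) (l *+ 2)%:E)%E.
  by apply: eq_bigr => i _; rewrite lebesgue_measure_itv/= lte_fin gtrN// opprK.
by rewrite prodEFin prodr_const card_ord.
Qed.

(** The unit ball lies between two cubes. *)
Lemma unit_ball_volume : (0 < unit_volume) /\ mu (eball 0 1) = unit_volume%:E.
Proof.
have n1 : (0 < n.+1%:R :> R) by [].
have upper : eball (0 : 'rV[R]_n) 1 `<=` box 1.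
  move=> v; rewrite /eball /= subr0 => v1 i; rewrite /= in_itv/= -ltr_norml.
  exact: le_lt_trans (coord_le_enorm v i) v1.
have lower : box n.+1%:R^-1 `<=` eball (0 : 'rV[R]_n) 1.
  move=> v /= vi; rewrite /eball/= subr0.
  apply: (@le_lt_trans _ _ (n%:R * n.+1%:R^-1)).
    apply: enorm_le_coord; first by rewrite invr_ge0.
    by move=> i; have := vi i; rewrite /= in_itv/= -ltr_norml; exact: ltW.
  by rewrite ltr_pdivrMr// mul1r ltr_nat.
have lt1 : (mu (eball 0 1) <= mu (box 1))%E :=
  le_measure mu (mem_set (measurable_eball 0 1)) (mem_set (mbox 1)) upper.
have lt2 : (mu (box n.+1%:R^-1) <= mu (eball 0 1))%E :=
  le_measure mu (mem_set (mbox n.+1%:R^-1))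
  (mem_set (measurable_eball 0 1)) lower.
rewrite vol_box// in lt1; rewrite vol_box ?invr_gt0// in lt2.
have fin : mu (eball 0 1) \is a fin_num.
  by rewrite ge0_fin_numE// (le_lt_trans lt1)// ltry.
have e : mu (eball 0 1) = unit_volume%:E by rewrite /unit_volume fineK.
split => //; rewrite -lte_fin -e (lt_le_trans _ lt2)// lte_fin.
by rewrite exprn_gt0// pmulrn_rgt0// invr_gt0.
Qed.

Lemma unit_volume_gt0 : 0 < unit_volume.
Proof. by have [] := unit_ball_volume. Qed.

Lemma eball_affine x r : 0 < r ->
  (fun v : 'rV[R]_n => r *: v + x) @^-1` (eball x r) = eball 0 1.
Proof.
move=> r0; have e v : (r * enorm v < r) = (enorm (v : 'rV[R]_n) < 1).
  by rewrite -[X in _ < X]mulr1 ltr_pM2l.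
by apply/seteqP; split => v; rewrite /eball /= addrK subr0 enormZ gtr0_norm// e.
Qed.

Lemma volume_eball x r : 0 < r -> mu (eball x r) = (r ^+ n * unit_volume)%:E.
Proof.
move=> r0; have := lebesgue_rV_affine x r0 (measurable_eball x r).
rewrite eball_affine// (unit_ball_volume.2) => /(congr1 (fun z => (r ^+ n)%:E * z)%E).
rewrite -EFinM => ->.
by rewrite muleA -EFinM mulfV ?mul1e// expf_neq0// gt_eqF.
Qed.

Lemma le_eball x y r r' : r + enorm (x - y) <= r' -> eball x r `<=` eball y r'.
Proof.
move=> rr z; rewrite /eball/= => zx.
rewrite (le_lt_trans (enorm_triangle z x y))// (lt_le_trans _ rr)//.
by rewrite ltrD2r.
Qed.

End ball_volume.

Section lebesgue_translation.
Context {R : realType} {n : nat}.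
Local Notation mu := (@lebesgue_rV R n).

Lemma eball_shift (x z : 'rV[R]_n) (r : R) :
  (fun v : 'rV[R]_n => 1 *: v + z) @^-1` (eball (x + z) r) = eball x r.
Proof.
by apply/seteqP; split => v; rewrite /eball/= scale1r opprD addrACA subrr addr0.
Qed.

Lemma integral_eball_shift (x z : 'rV[R]_n) (r : R) (f : 'rV[R]_n -> \bar R) :
  measurable_fun setT f -> (forall v, 0 <= f v)%E ->
  (\int[mu]_(v in eball x r) f (v + z)%R =
   \int[mu]_(v in eball (x + z) r) f v)%E.
Proof.
move=> mf f0.
have := @ge0_integral_lebesgue_rV_affine R n 1 z f (eball (x + z) r) ltr01
  (measurable_eball _ _) (measurable_funTS mf) f0.
rewrite expr1n invr1 mul1e eball_shift => <-.
by apply: eq_integral => v _; rewrite scale1r.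
Qed.

Lemma integral_shift (z : 'rV[R]_n) (f : 'rV[R]_n -> \bar R) :
  measurable_fun setT f -> (forall v, 0 <= f v)%E ->
  (\int[mu]_v f (v + z)%R = \int[mu]_v f v)%E.
Proof.
move=> mf f0.
have := @ge0_integral_lebesgue_rV_affine R n 1 z f setT ltr01 measurableT mf f0.
rewrite expr1n invr1 mul1e preimage_setT => <-.
by apply: eq_integral => v _; rewrite scale1r.
Qed.

End lebesgue_translation.

Section joint_measurability.
Context {R : realType} {n : nat} d (T : measurableType d).
Variable g : 'rV[R]_n -> T -> R.
Hypothesis mg : forall z, measurable_fun setT (g z).
Hypothesis cg : forall w, continuous (g ^~ w).

Let grid (k : nat) (z : 'rV[R]_n) : 'rV[int]_n :=
  \row_i Num.floor (k.+1%:R * z ord0 i).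

Let node (k : nat) (j : 'rV[int]_n) : 'rV[R]_n :=
  \row_i ((j ord0 i)%:~R / k.+1%:R).

Let measurable_cell k j : measurable (grid k @^-1` [set j]).
Proof.
have -> : grid k @^-1` [set j] = \bigcap_(i in [set: 'I_n])
    ((fun v : 'rV[R]_n => k.+1%:R * v ord0 i) @^-1`
       `[(j ord0 i)%:~R, (j ord0 i + 1)%:~R[%classic).
  apply/seteqP; split => z /=.
    by move=> <- i _ /=; rewrite in_itv/= mxE floor_itv// num_real.
  move=> h; apply/rowP => i; rewrite mxE; apply: floor_def.
  by have := h i I; rewrite /= in_itv.
apply: fin_bigcap_measurable => // i _.
rewrite -[X in measurable X]setTI.
have mf : measurable_fun [set: 'rV[R]_n] (fun v : 'rV[R]_n => k.+1%:R * v ord0 i).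
  by apply: measurable_funM => //; exact: measurable_rV_coord.
exact: mf.
Qed.

Let node_grid_cvg z : node k (grid k z) @[k --> \oo] --> z.
Proof.
apply/cvg_ballP => e e0; near=> k.
split => // i j; rewrite /ball/= !ord1 /node /grid !mxE.
have k0 : 0 < (k.+1%:R : R) by [].
have /andP[h1 h2] := floor_itv (k.+1%:R * z ord0 j).
have -> : z ord0 j - (Num.floor (k.+1%:R * z ord0 j))%:~R / k.+1%:R =
  (k.+1%:R * z ord0 j - (Num.floor (k.+1%:R * z ord0 j))%:~R) / k.+1%:R.
  by rewrite mulrBl mulrAC mulfV ?mul1r// gt_eqF.
rewrite ger0_norm; last by rewrite divr_ge0// subr_ge0.
rewrite ltr_pdivrMr//.
apply: (@lt_le_trans _ _ 1); first by rewrite ltrBlDl -intrD1.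
rewrite -ler_pdivrMl// mulr1.
near: k.
exists (Num.truncn e^-1) => // k /= hk.
by rewrite (le_trans (ltW (truncnS_gt _)))// ler_nat.
Unshelve. all: by end_near. Qed.

(** A field that is continuous in space and measurable in the event is jointly
    measurable: it is the limit of its values at the nodes of finer grids. *)
Lemma measurable_continuous_field :
  measurable_fun setT (fun p : 'rV[R]_n * T => g p.1 p.2).
Proof.
apply: (@measurable_fun_cvg _ _ _ _
  (fun k (p : 'rV[R]_n * T) => g (node k (grid k p.1)) p.2)).
  move=> k _ Y mY; rewrite setTI.
  have -> : (fun p : 'rV[R]_n * T => g (node k (grid k p.1)) p.2) @^-1` Y =
      \bigcup_(j in [set: 'rV[int]_n])
        ((grid k @^-1` [set j]) `*` (g (node k j) @^-1` Y)).
    apply/seteqP; split => [[z w] /= Yzw|[z w] /= [j _ [/= -> //]]].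
    by exists (grid k z).
  apply: countable_bigcupT_measurable => // j.
  apply: measurableX; first exact: measurable_cell.
  by rewrite -[X in measurable X]setTI; exact: mg.
move=> [z w] _ /=.
apply: (@continuous_cvg _ _ _ _ _ (fun k => node k (grid k z)) (g ^~ w) z) => //.
  exact: cg.
Qed.

End joint_measurability.

(** * Integrals over balls *)

Section ball_mass.
Context {R : realType} {n : nat}.
Local Notation lam := (@lebesgue_rV R n).
Local Notation V := (@unit_volume R n).
Implicit Types (F g : 'rV[R]_n -> R) (x y z : 'rV[R]_n) (r : R).

Lemma continuous_bounded_eball g y r : continuous g ->
  exists S : R, forall z, eball y r z -> `|g z| <= S.
Proof.
move=> cg.
pose I i := `[y ord0 i - r, y ord0 i + r]%classic.
pose D : set 'rV[R]_n := [set v | forall i, I i (v ord0 i)].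
have cD : compact D by exact: (@rV_compact R n I (fun i => @segment_compact _ _ _)).
have cgD : compact (g @` D).
  apply: continuous_compact => //; exact: continuous_subspaceT.
have [S [_ hS]] := compact_bounded cgD.
exists (S + 1) => z zr; apply: (hS (S + 1)); first by rewrite ltrDl.
exists z => //= i; rewrite /I /= in_itv/=.
have := le_lt_trans (coord_le_enorm (z - y) i) zr.
by rewrite !mxE ltr_norml => /andP[]; lra.
Qed.

(** A path is a field on a one-point event space. *)
Lemma measurable_continuous_rV g : continuous g ->
  measurable_fun [set: 'rV[R]_n] g.
Proof.
move=> cg; have mg : measurable_fun setT (fun p : 'rV[R]_n * unit => g p.1).
  apply: (@measurable_continuous_field R n _ unit (fun z _ => g z)) => [z|_ z].
    exact: measurable_cst.
  exact: cg.
exact: (measurableT_comp mg (@measurable_pair2 _ _ _ _ tt)).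
Qed.

Lemma continuous_expRM (s : R) g : continuous g -> continuous (fun z => expR (s * g z)).
Proof.
move=> cg.
have cs : continuous (fun z => s * g z).
  by move=> z; exact: (continuous_comp (cg z) (@mulrl_continuous _ s _)).
by move=> z; exact: (continuous_comp (cs z) (@continuous_expR _ _)).
Qed.

Definition ball_mass F y r : R := fine (\int[lam]_(z in eball y r) (F z)%:E)%E.

Section nonneg_continuous.
Variable F : 'rV[R]_n -> R.
Hypotheses (cF : continuous F) (F0 : forall z, 0 <= F z).

Let mF : measurable_fun setT (EFin \o F).
Proof. by apply/measurable_EFinP; exact: measurable_continuous_rV. Qed.

Lemma integral_ball_le y r r' (S : R) : 0 < r -> r <= r' ->
  (forall z, eball y r' z -> F z <= S) ->
  (\int[lam]_(z in eball y r') (F z)%:E <=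
   \int[lam]_(z in eball y r) (F z)%:E + (S * V * (r' ^+ n - r ^+ n))%:E)%E.
Proof.
move=> r0 rr FS; have r'0 : 0 < r' by exact: lt_le_trans rr.
have sub : eball y r `<=` eball y r' by apply: le_eball; rewrite subrr enorm0 addr0.
have mB := @measurable_eball R n y.
have mD : measurable (eball y r' `\` eball y r) by exact: measurableD.
rewrite -[X in (\int[_]_(_ in X) _ <= _)%E](setDUK sub).
rewrite ge0_integral_setU//; last 3 first.
- exact: measurable_funTS.
- by move=> z _; rewrite lee_fin.
- by rewrite disj_set2E setDIK.
apply: leeD => //.
apply: (@le_trans _ _ (\int[lam]_(z in eball y r' `\` eball y r) (cst S%:E z))%E).
  apply: ge0_le_integral => //; first by move=> z _; rewrite lee_fin.
    exact: measurable_funTS.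
  by move=> z [zr _]; rewrite lee_fin; exact: FS.
rewrite integral_cst// [X in (_ * X)%E](_ : _ = (V * (r' ^+ n - r ^+ n))%:E).
  by rewrite -EFinM mulrA.
have := volume_eball y r0; have := volume_eball y r'0 => /= v' v.
have : (lam (eball y r') = lam (eball y r) + lam (eball y r' `\` eball y r))%E.
  by rewrite -{1}(setDUK sub) measureU//; exact: setDIK.
rewrite v' v; case: (lam (eball y r' `\` eball y r)) => [u| |]//= [] h.
by congr EFin; lra.
Qed.

Lemma integral_ball_fin y r : (\int[lam]_(z in eball y r) (F z)%:E)%E \is a fin_num.
Proof.
rewrite ge0_fin_numE; last by apply: integral_ge0 => z _; rewrite lee_fin.
have [r0|r0] := leP r 0.
  rewrite [eball y r](_ : _ = set0) ?integral_set0//.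
  apply/seteqP; split => // z; rewrite /eball/= => /lt_le_trans/(_ r0).
  by rewrite ltNge enorm_ge0.
have [S hS] := continuous_bounded_eball y r cF.
apply: (@le_lt_trans _ _ (\int[lam]_(z in eball y r) (cst S%:E z))%E).
  apply: ge0_le_integral => //.
  - exact: measurable_eball.
  - by move=> z _; rewrite lee_fin.
  - exact: measurable_funTS.
  - by move=> z zB; rewrite lee_fin (le_trans (ler_norm _))// hS.
rewrite integral_cst; last exact: measurable_eball.
by move: (volume_eball y r0) => /= ->; rewrite -EFinM ltry.
Qed.

Lemma ball_massE y r : (ball_mass F y r)%:E = (\int[lam]_(z in eball y r) (F z)%:E)%E.
Proof. by rewrite fineK// integral_ball_fin. Qed.

Lemma ball_mass_subset y r y' r' : r + enorm (y - y') <= r' ->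
  ball_mass F y r <= ball_mass F y' r'.
Proof.
move=> h; rewrite -lee_fin !ball_massE; apply: ge0_subset_integral => //.
- exact: measurable_eball.
- exact: measurable_eball.
- exact: measurable_funTS.
- by move=> z _; rewrite lee_fin.
- exact: le_eball.
Qed.

(** [F] is bounded on the largest ball, so that its integral grows at most as fast as
    the volume. *)
Lemma ball_mass_growth y r0 : exists2 S : R, 0 <= S & forall r r',
  0 < r -> r <= r' -> r' <= r0 ->
  ball_mass F y r' <= ball_mass F y r + S * (r' ^+ n - r ^+ n).
Proof.
have [S hS] := continuous_bounded_eball y r0 cF.
have V0 := @unit_volume_gt0 R n.
exists (maxr S 0 * V); first by rewrite mulr_ge0 ?(ltW V0)// le_max lexx orbT.
move=> r r' r_gt0 rr r'0; rewrite -lee_fin EFinD !ball_massE.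
apply: integral_ball_le => // z zr.
rewrite le_max (le_trans (ler_norm _))// hS//.
exact: lt_le_trans r'0.
Qed.

Lemma ball_avgE x r : 0 < r ->
  ball_avg F x r = (ball_mass F x r / (r ^+ n * V))%:E.
Proof.
move=> r0; rewrite /ball_avg -ball_massE -EFinM.
by have /= -> := volume_eball x r0; rewrite /= mulrC.
Qed.

End nonneg_continuous.

Lemma ball_mass_shift F x z r : continuous F -> (forall y, 0 <= F y) ->
  ball_mass F (x + z) r = ball_mass (fun y => F (y + z)) x r.
Proof.
move=> cF F0; rewrite /ball_mass -(@integral_eball_shift _ _ x z r (EFin \o F))//.
- by apply/measurable_EFinP; exact: measurable_continuous_rV.
Qed.

End ball_mass.

Section measurable_ball_mass.
Context {R : realType} {n : nat} d (T : measurableType d).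
Variable F : 'rV[R]_n -> T -> R.
Hypothesis mF : forall z, measurable_fun setT (F z).
Hypothesis cF : forall w, continuous (F ^~ w).
Hypothesis F0 : forall z w, 0 <= F z w.

Lemma measurable_ball_mass y r :
  measurable_fun setT (fun w => ball_mass (F ^~ w) y r).
Proof.
apply: measurableT_comp => //.
pose f (p : T * 'rV[R]_n) : \bar R := (F p.2 p.1 * \1_(eball y r) p.2)%:E.
have mf : measurable_fun setT f.
  apply/measurable_EFinP; apply: measurable_funM.
    have m1 : measurable_fun setT (fun p : T * 'rV[R]_n => (p.2, p.1)).
      by apply/measurable_fun_pairP; split; [exact: measurable_snd|exact: measurable_fst].
    exact: (measurableT_comp (measurable_continuous_field mF cF) m1).
  apply: (measurableT_comp _ measurable_snd).
  by apply: measurable_indic; exact: measurable_eball.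
have f0 p : (0 <= f p)%E by rewrite lee_fin mulr_ge0.
have := @measurable_fun_fubini_tonelli_F _ _ _ _ R (@lebesgue_rV R n) f mf f0.
congr (measurable_fun _ _); apply/funext => w.
rewrite [RHS]integral_mkcond; apply: eq_integral => z _.
rewrite patchE /f indicE; case: ifPn => _ /=; first by rewrite mulr1.
by rewrite mulr0.
Qed.

End measurable_ball_mass.

(** * Absorption of moments *)

Section perturbed_powers.
Context {R : realType}.
Implicit Types (x y z b M : R).

Lemma norm_subXX x y n : `|x ^+ n.+1 - y ^+ n.+1| <=
  n.+1%:R * `|x - y| * (`|y| + `|x - y|) ^+ n.
Proof.
rewrite subrXX normrM mulrC -mulrA [leRHS]mulrCA mulrC ler_wpM2l//.
apply: (le_trans (ler_norm_sum _ _ _)).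
have -> : n.+1%:R * (`|y| + `|x - y|) ^+ n = \sum_(i < n.+1) (`|y| + `|x - y|) ^+ n.
  by rewrite sumr_const card_ord mulr_natl.
apply: ler_sum => i _; rewrite normrM !normrX /=.
have hx : `|x| <= `|y| + `|x - y|.
  by rewrite -{1}(subrK y x) addrC (le_trans (ler_normD _ _)).
have hy : `|y| <= `|y| + `|x - y| by rewrite lerDl.
apply: (@le_trans _ _ ((`|y| + `|x - y|) ^+ (n - i) * (`|y| + `|x - y|) ^+ i)).
  apply: ler_pM; rewrite ?exprn_ge0//.
  - by rewrite lerXn2r ?nnegrE// addr_ge0.
  - by rewrite lerXn2r ?nnegrE// addr_ge0.
by rewrite -exprD subnK// -ltnS.
Qed.

(** Young's inequality behind the absorption of the moment in its own bound:
    either the increment is small compared to [z ^ 2], and the left side is at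
    most half of [z ^ 2k], or [z ^ 2] is itself bounded by the increment. *)
Lemma perturbed_power_le M z b k : 0 <= M -> 
  M * ((z + b) ^+ (k.*2.+1) - z ^+ (k.*2.+1)) <=
  2^-1 * z ^+ (k.+1.*2) +
  ((2 * M * k.+1.*2%:R * 4 ^+ k) ^+ k.+1 * `|b| ^+ k.+1 +
   M * k.+1.*2%:R * 4 ^+ k * `|b| ^+ (k.*2.+1)).
Proof.
move=> M0.
set N : R := k.+1.*2%:R; have N0 : 0 <= N by [].
have h1 := norm_subXX (z + b) z k.*2; rewrite [z + b - z]addrAC subrr add0r in h1.
have h2 : (`|z| + `|b|) ^+ k.*2 <= 4 ^+ k * (`|z| ^+ k.*2 + `|b| ^+ k.*2).
  rewrite -!mul2n !exprM.
  have e4 : (4 : R) = 2 ^+ 2 by rewrite expr2; ring.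
  wlog zb : z b {h1} / `|z| <= `|b|.
    move=> H; have [/H//|/ltW/H] := leP `|z| `|b|.
    by rewrite [_ + `|z|]addrC [_ + (`|z| ^+ 2) ^+ k]addrC.
  apply: (@le_trans _ _ (4 ^+ k * (`|b| ^+ 2) ^+ k)); last first.
    by rewrite ler_wpM2l ?exprn_ge0// lerDr exprn_ge0// exprn_ge0.
  rewrite -exprMn lerXn2r ?nnegrE ?mulr_ge0 ?exprn_ge0 ?addr_ge0//.
  rewrite e4 -exprMn lerXn2r ?nnegrE ?mulr_ge0 ?addr_ge0//; lra.
set Y := M * N * 4 ^+ k * `|b|.
have Y0 : 0 <= Y by rewrite !mulr_ge0// exprn_ge0.
have h3 : M * ((z + b) ^+ k.*2.+1 - z ^+ k.*2.+1) <=
    Y * (`|z| ^+ k.*2 + `|b| ^+ k.*2).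
  apply: (@le_trans _ _ (M * `|(z + b) ^+ k.*2.+1 - z ^+ k.*2.+1|)).
    by rewrite ler_wpM2l// ler_norm.
  rewrite /Y -!mulrA ler_wpM2l//.
  apply: (le_trans h1).
  rewrite -mulrA [4 ^+ k * _]mulrCA; apply: ler_pM => //.
  - by rewrite ler_nat doubleS.
  - by rewrite ler_wpM2l.
apply: (le_trans h3); rewrite mulrDr.
have -> : M * N * 4 ^+ k * `|b| ^+ k.*2.+1 = Y * `|b| ^+ k.*2.
  by rewrite exprS /Y; ring.
rewrite addrA lerD2r.
have -> : (2 * M * N * 4 ^+ k) ^+ k.+1 * `|b| ^+ k.+1 = (2 * Y) ^+ k.+1.
  by rewrite -exprMn /Y; congr (_ ^+ _); ring.
have ez j : z ^+ j.*2 = (`|z| ^+ 2) ^+ j.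
  by rewrite real_normK ?num_real// -exprM mul2n.
have ez' j : `|z| ^+ j.*2 = (`|z| ^+ 2) ^+ j by rewrite -exprM mul2n.
rewrite ez ez'; set t := `|z| ^+ 2.
have t0 : 0 <= t by rewrite exprn_ge0.
have [Yt|Yt] := leP (2 * Y) t.
  apply: (@le_trans _ _ (2^-1 * t ^+ k.+1)); last first.
    by rewrite lerDl exprn_ge0// mulr_ge0.
  by rewrite exprS mulrA ler_wpM2r ?exprn_ge0//; lra.
apply: (@le_trans _ _ ((2 * Y) ^+ k.+1)); last first.
  by rewrite lerDr mulr_ge0 ?invr_ge0// exprn_ge0.
rewrite exprS; apply: ler_pM; rewrite ?exprn_ge0//; first lra.
by rewrite lerXn2r ?nnegrE ?mulr_ge0// ltW.
Qed.

End perturbed_powers.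

Section shifted_moments.
Context {R : realType}.
Local Open Scope ereal_scope.

Definition all_moments d (T : measurableType d) (mu : {measure set T -> \bar R})
    (X : T -> R) : Prop :=
  forall k : nat, mu.-integrable setT (fun w => (X w ^+ k)%:E).

Lemma integrable_centered_moments d (T : measurableType d)
    (mu : {measure set T -> \bar R}) (X : T -> R) (M : R) (i j : nat) :
  all_moments mu X ->
  mu.-integrable setT (fun w => (X w ^+ i * (X w - M) ^+ j)%:E).
Proof.
move=> iX; elim: j i => [|j IH] i.
  by under eq_fun do rewrite expr0 mulr1.
have -> : (fun w => (X w ^+ i * (X w - M) ^+ j.+1)%:E) =
    (fun w => (X w ^+ i.+1 * (X w - M) ^+ j)%:E) \-
    (fun w => M%:E * (X w ^+ i * (X w - M) ^+ j)%:E).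
  by apply/funext => w /=; congr EFin; rewrite !exprS; ring.
by apply: integrableB => //; apply: integrableZl.
Qed.

(** Expanding one of the factors [A - M] shows that both sides satisfy the same
    recursion in [j]. *)
Lemma shifted_moments d1 d2 (T1 : measurableType d1) (T2 : measurableType d2)
    (mu : {measure set T1 -> \bar R}) (nu : {measure set T2 -> \bar R})
    (A : T1 -> R) (B : T2 -> R) (M : R) :
  all_moments mu A -> all_moments nu B ->
  (forall k, \int[mu]_w (A w ^+ k.+1)%:E = M%:E * \int[nu]_w (B w ^+ k)%:E) ->
  forall i j, \int[mu]_w (A w ^+ i.+1 * (A w - M) ^+ j)%:E =
    M%:E * \int[nu]_w (B w ^+ i * (B w - M) ^+ j)%:E.
Proof.
move=> iA iB AB i j; elim: j i => [|j IH] i.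
  under eq_integral do rewrite expr0 mulr1.
  under [in RHS]eq_integral do rewrite expr0 mulr1.
  exact: AB.
have split d (T : measurableType d) (m : {measure set T -> \bar R}) (X : T -> R) l :
    all_moments m X ->
    \int[m]_w (X w ^+ l * (X w - M) ^+ j.+1)%:E =
    \int[m]_w (X w ^+ l.+1 * (X w - M) ^+ j)%:E -
    M%:E * \int[m]_w (X w ^+ l * (X w - M) ^+ j)%:E.
  move=> iX; rewrite -integralZl//; last exact: integrable_centered_moments.
  rewrite -integralB//; last 2 first.
  - exact: integrable_centered_moments.
  - by apply: integrableZl => //; exact: integrable_centered_moments.
  apply: eq_integral => w _; rewrite -EFinM -EFinB.
  by congr EFin; rewrite !exprS; ring.
rewrite split// split// !IH.
have fB l : \int[nu]_w (B w ^+ l * (B w - M) ^+ j)%:E \is a fin_num.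
  by apply: integrable_fin_num => //; exact: integrable_centered_moments.
rewrite -(fineK (fB i.+1)) -(fineK (fB i)) /=.
by congr EFin; ring.
Qed.

End shifted_moments.

(** * Exponential integrals and the Cameron-Martin formula *)

Lemma emeasurable_funX d (T : measurableType d) (R : realType)
    (f : T -> \bar R) k : measurable_fun setT f ->
  measurable_fun setT (fun x => f x ^+ k)%E.
Proof.
move=> mf; elim: k => [|k IH]; first exact: measurable_cst.
by under eq_fun do rewrite expeS; exact: emeasurable_funM.
Qed.

Section exponential_integrals.
Context {disp : measure_display} {T : measurableType disp} {R : realType}.
Context {P : probability T R} {d : nat}.
Variable G : 'rV[R]_d -> {RV P >-> R}.
Hypotheses (gG : gaussian_field G) (cG : centered_field G)
  (sG : stationary_field G) (pG : continuous_paths G).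
Local Notation C := (covariance_fun G).
Hypothesis mC : measurable_fun setT C.
Variables (mu : probability 'rV[R]_d R) (s : R).
Implicit Types (x y z : 'rV[R]_d) (L : seq 'rV[R]_d) (h : 'rV[R]_d -> R).
Local Open Scope ereal_scope.

Definition exp_integral h (w : T) : \bar R :=
  \int[mu]_z (h z * expR (s * G z w))%:E.
Local Notation I := exp_integral.

Let eG L (w : T) : R := expR (s * \sum_(x <- L) G x w).

(** Moments of the exponential integral, weighted by exponentials of the field at
    the points of [L]. The recursion on [k] moves integration points into [L]. *)
Definition exp_moment L h k : \bar R := \int[P]_w ((eG L w)%:E * I h w ^+ k).
Local Notation Phi := exp_moment.

Lemma measurable_field : measurable_fun setT (fun p : 'rV[R]_d * T => G p.1 p.2).
Proof.
apply: (@measurable_continuous_field _ _ _ _ (fun z w => G z w)) => [z|w].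
  exact: measurable_funPT.
exact: pG.
Qed.

Let mexpG : measurable_fun setT (fun p : 'rV[R]_d * T => expR (s * G p.1 p.2)).
Proof.
apply: measurableT_comp => //; apply: measurable_funM => //.
exact: measurable_field.
Qed.

Lemma exp_integral_ge0 h w : (forall z, 0 <= h z)%R -> 0 <= I h w.
Proof.
by move=> h0; apply: integral_ge0 => z _; rewrite lee_fin mulr_ge0 ?expR_ge0.
Qed.

Let mexp_slice w : measurable_fun setT (fun z => expR (s * G z w)).
Proof.
exact: (measurableT_comp mexpG (measurable_pair2 w)).
Qed.

Lemma measurable_exp_integrand h w : measurable_fun setT h ->
  measurable_fun setT (fun z => (h z * expR (s * G z w))%:E).
Proof. by move=> mh; apply/measurable_EFinP; exact: measurable_funM. Qed.

Lemma measurable_exp_integral2 (H : 'rV[R]_d -> 'rV[R]_d -> R) :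
  measurable_fun setT (fun p : 'rV[R]_d * 'rV[R]_d => H p.1 p.2) ->
  (forall y z, 0 <= H y z)%R ->
  measurable_fun setT (fun q : T * 'rV[R]_d => I (H q.2) q.1).
Proof.
move=> mH H0.
apply: (measurable_fun_fubini_tonelli_F (fun p : (T * 'rV[R]_d) * 'rV[R]_d =>
  (H p.1.2 p.2 * expR (s * G p.2 p.1.1))%:E)).
- apply/measurable_EFinP; apply: measurable_funM.
    have m1 : measurable_fun setT
        (fun p : (T * 'rV[R]_d) * 'rV[R]_d => (p.1.2, p.2)).
      apply/measurable_fun_pairP; split; last exact: measurable_snd.
      exact: measurableT_comp measurable_snd measurable_fst.
    exact: (measurableT_comp mH m1).
  have m2 : measurable_fun setT
      (fun p : (T * 'rV[R]_d) * 'rV[R]_d => (p.2, p.1.1)).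
    apply/measurable_fun_pairP; split; first exact: measurable_snd.
    exact: measurableT_comp measurable_fst measurable_fst.
  exact: (measurableT_comp mexpG m2).
- by move=> p; rewrite lee_fin mulr_ge0 ?expR_ge0.
Qed.

Lemma measurable_exp_integral h : measurable_fun setT h -> (forall z, 0 <= h z)%R ->
  measurable_fun setT (I h).
Proof.
move=> mh h0.
apply: (measurable_fun_fubini_tonelli_G (fun p : 'rV[R]_d * T =>
  (h p.1 * expR (s * G p.1 p.2))%:E)).
- apply/measurable_EFinP; apply: measurable_funM => //.
  exact: measurableT_comp mh measurable_fst.
- by move=> p; rewrite lee_fin mulr_ge0 ?expR_ge0.
Qed.

Let meG L : measurable_fun setT (eG L).
Proof.
apply: measurableT_comp => //; apply: measurable_funM => //.
by apply: measurable_sum => x; exact: measurable_funPT.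
Qed.

Let eGcons z L w : (eG (z :: L) w = expR (s * G z w) * eG L w)%R.
Proof. by rewrite /eG big_cons mulrDr expRD. Qed.

Section weights.
Variable h : 'rV[R]_d -> R.
Hypotheses (mh : measurable_fun setT h) (h0 : forall z, (0 <= h z)%R).

Let mIk k : measurable_fun setT (fun w => I h w ^+ k).
Proof. by apply: emeasurable_funX; exact: measurable_exp_integral. Qed.

Let term L k (p : 'rV[R]_d * T) := (eG (p.1 :: L) p.2)%:E * I h p.2 ^+ k.

Let mterm L k : measurable_fun setT (term L k).
Proof.
apply: emeasurable_funM; last exact: measurableT_comp (mIk k) measurable_snd.
apply/measurable_EFinP.
have -> : (fun p : 'rV[R]_d * T => eG (p.1 :: L) p.2) =
    (fun p => expR (s * G p.1 p.2) * eG L p.2)%R.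
  by apply/funext => p; rewrite eGcons.
apply: measurable_funM => //.
exact: measurableT_comp (meG L) measurable_snd.
Qed.

Let term_ge0 L k p : 0 <= term L k p.
Proof.
by rewrite mule_ge0 ?lee_fin ?expR_ge0// expe_ge0// exp_integral_ge0.
Qed.

Lemma exp_moment_ge0 L k : 0 <= Phi L h k.
Proof.
apply: integral_ge0 => w _.
by rewrite mule_ge0 ?lee_fin ?expR_ge0// expe_ge0// exp_integral_ge0.
Qed.

Lemma measurable_exp_moment L k : measurable_fun setT (fun z => Phi (z :: L) h k).
Proof.
exact: (measurable_fun_fubini_tonelli_F (term L k)).
Qed.

(** Tonelli: the integration point of one factor of the power joins [L]. *)
Lemma exp_momentS L k : Phi L h k.+1 = \int[mu]_z ((h z)%:E * Phi (z :: L) h k).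
Proof.
transitivity (\int[P]_w \int[mu]_z ((h z)%:E * term L k (z, w))).
  apply: eq_integral => w _; rewrite expeS.
  rewrite [RHS](_ : _ = \int[mu]_z (((eG L w)%:E * I h w ^+ k) *
      (h z * expR (s * G z w))%:E)); last first.
    apply: eq_integral => z _; rewrite /term/= eGcons !EFinM.
    by rewrite [RHS]muleC !muleA.
  rewrite ge0_integralZl//.
  - by rewrite -/(I h w) muleCA muleC.
  - exact: measurable_exp_integrand.
  - by move=> z _; rewrite lee_fin mulr_ge0 ?expR_ge0.
  - by rewrite mule_ge0 ?lee_fin ?expR_ge0// expe_ge0// exp_integral_ge0.
rewrite -(@fubini_tonelli _ _ _ _ _ mu P
  (fun p : 'rV[R]_d * T => (h p.1)%:E * term L k p)).
- apply: eq_integral => z _ /=; rewrite ge0_integralZl//.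
    exact: (measurableT_comp (mterm L k) (measurable_pair1 z)).
  by rewrite lee_fin.
- apply: emeasurable_funM => //; apply/measurable_EFinP.
  exact: measurableT_comp mh measurable_fst.
- by move=> p; rewrite mule_ge0 ?lee_fin.
Qed.

End weights.

Definition cov_sum L : R := (\sum_(x <- L) \sum_(y <- L) C (x - y))%R.

Lemma exp_moment0 L h : Phi L h 0 = (expR (s ^+ 2 * cov_sum L / 2))%:E.
Proof.
have e w : eG L w = expR (s * comb G [seq (1%R, x) | x <- L] w).
  rewrite /eG /comb big_map; congr (expR (_ * _))%R.
  by apply: eq_bigr => x _; rewrite mul1r.
transitivity (\int[P]_w (expR (s * comb G [seq (1%R, x) | x <- L] w))%:E).
  by apply: eq_integral => w _; rewrite expe0 mule1 e.
rewrite integral_expR_comb//; congr (expR (_ * _ / 2))%:E.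
rewrite /comb_var /cov_sum big_map; apply: eq_bigr => x _.
by rewrite big_map; apply: eq_bigr => y _; rewrite /= !mul1r.
Qed.

Lemma cov_sum_cons y L :
  (cov_sum (y :: L) = C 0 + 2 * (\sum_(x <- L) C (x - y)) + cov_sum L)%R.
Proof.
rewrite /cov_sum !big_cons subrr.
under [X in (_ + X)%R]eq_bigr do rewrite big_cons.
rewrite big_split/=.
have -> : (\sum_(x <- L) C (y - x) = \sum_(x <- L) C (x - y))%R.
  by apply: eq_bigr => x _; rewrite -[RHS]covariance_sym// opprB.
ring.
Qed.

Lemma cov_sum_le L : (cov_sum L <= C 0 * (size L)%:R ^+ 2)%R.
Proof.
apply: (@le_trans _ _ (\sum_(x <- L) \sum_(y <- L) C 0)%R).
  apply: ler_sum => x _; apply: ler_sum => y _.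
  by rewrite (le_trans (ler_norm _))// covariance_norm_le.
rewrite !big_const_seq !count_predT !iter_addr_0 -mulrnA -[leLHS]mulr_natr.
by rewrite expr2 natrM.
Qed.

Let tilt y h z : R := (h z * expR (s ^+ 2 * C (z - y)))%R.

Let mtilt y h : measurable_fun setT h -> measurable_fun setT (tilt y h).
Proof.
move=> mh; apply: measurable_funM => //; apply: measurableT_comp => //.
apply: measurable_funM => //.
have := measurableT_comp mC (measurable_affine_rV 1 (- y)%R).
by under eq_fun do rewrite /= scale1r.
Qed.

Let tilt_ge0 y h : (forall z, 0 <= h z)%R -> forall z, (0 <= tilt y h z)%R.
Proof. by move=> h0 z; rewrite mulr_ge0 ?expR_ge0. Qed.

(** The Cameron-Martin formula: weighting the probability by [exp (s G y)]
    shifts the field by [s C (. - y)]. *)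
Lemma exp_moment_tilt k L y h : measurable_fun setT h -> (forall z, 0 <= h z)%R ->
  Phi (y :: L) h k =
  (expR (s ^+ 2 * C 0 / 2 + s ^+ 2 * \sum_(x <- L) C (x - y)))%:E *
    Phi L (fun z => h z * expR (s ^+ 2 * C (z - y)))%R k.
Proof.
rewrite -/(tilt y h).
elim: k L h => [|k IH] L h mh h0.
  rewrite !exp_moment0 -EFinM -expRD cov_sum_cons.
  by congr (expR _)%:E; field.
rewrite !exp_momentS//; [|exact: mtilt|exact: tilt_ge0].
have mt : measurable_fun setT
    (fun z => (tilt y h z)%:E * Phi (z :: L) (tilt y h) k).
  apply: emeasurable_funM; first by apply/measurable_EFinP; exact: mtilt.
  by apply: measurable_exp_moment; [exact: mtilt|exact: tilt_ge0].
have t0 z : setT z -> 0 <= (tilt y h z)%:E * Phi (z :: L) (tilt y h) k.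
  move=> _; rewrite mule_ge0 ?lee_fin ?tilt_ge0//.
  by apply: exp_moment_ge0; exact: tilt_ge0.
rewrite -ge0_integralZl ?lee_fin ?expR_ge0//.
apply: eq_integral => z _.
have -> : Phi [:: z, y & L] h k = Phi [:: y, z & L] h k.
  by apply: eq_integral => w _; rewrite /eG !big_cons addrCA.
rewrite IH// !muleA -!EFinM; congr (_%:E * _).
rewrite /tilt big_cons mulrCA -expRD; congr (_ * expR _)%R; ring.
Qed.

(** Every integration point costs a factor [kappa], and no covariance exceeds
    [C 0]. *)
Lemma exp_moment_le L h (kappa : R) k :
  measurable_fun setT h -> (forall z, 0 <= h z)%R -> (0 <= kappa)%R ->
  \int[mu]_z (h z)%:E <= kappa%:E ->
  Phi L h k <=
    (kappa ^+ k * expR (s ^+ 2 * (C 0 * (size L + k)%:R ^+ 2) / 2))%:E.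
Proof.
move=> mh h0 k0 hk; elim: k L => [|k IH] L.
  rewrite exp_moment0 expr0 mul1r addn0 lee_fin ler_expR ler_pM2r//.
  by rewrite ler_wpM2l ?sqr_ge0// cov_sum_le.
rewrite exp_momentS//.
set c := (kappa ^+ k * expR (s ^+ 2 * (C 0 * (size L + k.+1)%:R ^+ 2) / 2))%R.
have c0 : (0 <= c)%R by rewrite mulr_ge0 ?exprn_ge0 ?expR_ge0.
apply: (@le_trans _ _ (\int[mu]_z (c%:E * (h z)%:E))).
  apply: ge0_le_integralT => z.
    by rewrite mule_ge0 ?lee_fin// exp_moment_ge0.
  rewrite muleC lee_wpmul2r ?lee_fin//.
  by have := IH (z :: L); rewrite /= addSnnS.
rewrite ge0_integralZl//; last 2 first.
- exact/measurable_EFinP.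
- by move=> z _; rewrite lee_fin.
apply: (@le_trans _ _ (c%:E * kappa%:E)); first by rewrite lee_wpmul2l ?lee_fin.
by rewrite -EFinM lee_fin /c mulrAC (exprSr kappa).
Qed.

End exponential_integrals.

(** * Centered moments of exponential averages *)

Lemma muleBr_fin (R : realType) (k : R) (a b : \bar R) :
  a \is a fin_num -> b \is a fin_num ->
  (k%:E * a - k%:E * b = k%:E * (a - b))%E.
Proof.
by case: a b => [a| |] [b| |]//= _ _; congr EFin; rewrite mulrBr.
Qed.

Section moment_bound.
Context {disp : measure_display} {T : measurableType disp} {R : realType}.
Context {P : probability T R} {d : nat}.
Variable G : 'rV[R]_d -> {RV P >-> R}.
Hypotheses (gG : gaussian_field G) (cG : centered_field G)
  (sG : stationary_field G) (pG : continuous_paths G).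
Local Notation C := (covariance_fun G).
Hypothesis mC : measurable_fun setT C.
Variables (mu : probability 'rV[R]_d R) (s : R).
Local Open Scope ereal_scope.
Local Notation I := (exp_integral G mu s).
Local Notation Phi := (exp_moment G mu s).

Let one : 'rV[R]_d -> R := cst 1%R.
Hypothesis Ifin : forall w, I one w < +oo.

Definition exp_average (w : T) : R := fine (I one w).
Local Notation A := exp_average.

Let M : R := expR (s ^+ 2 * C 0 / 2).
Let K : R := (s ^+ 2 * expR (s ^+ 2 * C 0))%R.

Let K0 : (0 <= K)%R.
Proof. by rewrite mulr_ge0 ?sqr_ge0 ?expR_ge0. Qed.

Let I_bounded (h : 'rV[R]_d -> R) (c : R) w : measurable_fun setT h ->
  (forall z, 0 <= h z <= c)%R -> I h w \is a fin_num.
Proof.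
move=> mh hc; have h0 z : (0 <= h z)%R by case/andP: (hc z).
have c0 : (0 <= c)%R by have /andP[] := hc 0%R; exact: le_trans.
rewrite ge0_fin_numE; last exact: exp_integral_ge0.
apply: (@le_lt_trans _ _ (c%:E * I one w)); last first.
  by apply: lte_mul_pinfty => //.
rewrite -ge0_integralZl//.
- apply: ge0_le_integralT => z; first by rewrite lee_fin mulr_ge0 ?expR_ge0.
  rewrite -EFinM lee_fin mul1r ler_wpM2r ?expR_ge0//.
  by case/andP: (hc z).
- exact: measurable_exp_integrand.
- by move=> z _; rewrite lee_fin mul1r expR_ge0.
Qed.

Let H (y z : 'rV[R]_d) : R := expR (s ^+ 2 * C (z - y)).
Let V (y z : 'rV[R]_d) : R := (K * `|C (z - y)|)%R.

Let mdiff : measurable_fun setT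
  (fun p : 'rV[R]_d * 'rV[R]_d => C (p.2 - p.1)).
Proof.
have m1 : measurable_fun setT (fun p : 'rV[R]_d * 'rV[R]_d => (p.2 - p.1)%R).
  apply/measurable_fun_rVP => i.
  have -> : (fun p : 'rV[R]_d * 'rV[R]_d => (p.2 - p.1)%R ord0 i) =
      (fun p => p.2 ord0 i - p.1 ord0 i)%R by apply/funext => p; rewrite !mxE.
  apply: measurable_funB.
    exact: measurableT_comp (measurable_rV_coord i) measurable_snd.
  exact: measurableT_comp (measurable_rV_coord i) measurable_fst.
exact: measurableT_comp mC m1.
Qed.

Let mH : measurable_fun setT (fun p : 'rV[R]_d * 'rV[R]_d => H p.1 p.2).
Proof. by apply: measurableT_comp => //; exact: measurable_funM. Qed.

Let mV : measurable_fun setT (fun p : 'rV[R]_d * 'rV[R]_d => V p.1 p.2).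
Proof. by apply: measurable_funM => //; exact: measurableT_comp. Qed.

Let mHy y : measurable_fun setT (H y).
Proof. exact: (measurableT_comp mH (measurable_pair1 y)). Qed.

Let mVy y : measurable_fun setT (V y).
Proof. exact: (measurableT_comp mV (measurable_pair1 y)). Qed.

Let C0 : (0 <= C 0)%R.
Proof. exact: le_trans (normr_ge0 _) (covariance_norm_le gG cG sG 0). Qed.

Let H_bound y z : (0 <= H y z <= expR (s ^+ 2 * C 0))%R.
Proof.
rewrite expR_ge0/= ler_expR ler_wpM2l ?sqr_ge0//.
exact: le_trans (ler_norm _) (covariance_norm_le gG cG sG _).
Qed.

Let V_bound y z : (0 <= V y z <= K * C 0)%R.
Proof. by rewrite mulr_ge0//= ler_wpM2l// covariance_norm_le. Qed.

Let one_bound z : (0 <= one z <= 1)%R.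
Proof. by rewrite /one/= ler01 lexx. Qed.

Let H_V y z : (`|H y z - 1| <= V y z)%R.
Proof.
rewrite (le_trans (norm_expR_sub1 _))// /V /K normrM ger0_norm ?sqr_ge0//.
have := covariance_norm_le gG cG sG (z - y); have := normr_ge0 (C (z - y)).
set a := (s ^+ 2)%R; have a0 : (0 <= a)%R := sqr_ge0 s.
move: `|C (z - y)|%R => c c0 cC0.
have e1 : (expR (a * c) <= expR (a * C 0))%R by rewrite ler_expR ler_wpM2l.
by apply: (le_trans (ler_wpM2l (mulr_ge0 a0 c0) e1)); rewrite mulrAC.
Qed.

(** Weighting the probability by [exp (s G y)] replaces the average [A] by
    [B (., y)], and [W (., y)] bounds the difference of the two. *)
Let B (q : T * 'rV[R]_d) : R := fine (I (H q.2) q.1).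
Let W (q : T * 'rV[R]_d) : R := fine (I (V q.2) q.1).

Let AE w : (A w)%:E = I one w.
Proof. by rewrite /A fineK//; exact: I_bounded one_bound. Qed.

Let BE q : (B q)%:E = I (H q.2) q.1.
Proof. by rewrite /B fineK//; exact: I_bounded (H_bound _). Qed.

Let WE q : (W q)%:E = I (V q.2) q.1.
Proof. by rewrite /W fineK//; exact: I_bounded (V_bound _). Qed.

Let A_ge0 w : (0 <= A w)%R.
Proof. by rewrite -lee_fin AE exp_integral_ge0// => z; rewrite /one/= ler01. Qed.

Let B_ge0 q : (0 <= B q)%R.
Proof.
by rewrite -lee_fin BE exp_integral_ge0// => z; have /andP[] := H_bound q.2 z.
Qed.

Let W_ge0 q : (0 <= W q)%R.
Proof.
by rewrite -lee_fin WE exp_integral_ge0// => z; have /andP[] := V_bound q.2 z.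
Qed.

Lemma measurable_exp_average : measurable_fun setT A.
Proof.
by apply: measurableT_comp => //; exact: measurable_exp_integral.
Qed.

Let mB : measurable_fun setT B.
Proof.
apply: measurableT_comp => //; apply: measurable_exp_integral2 => // y z.
by have /andP[] := H_bound y z.
Qed.

Let mW : measurable_fun setT W.
Proof.
apply: measurableT_comp => //; apply: measurable_exp_integral2 => // y z.
by have /andP[] := V_bound y z.
Qed.

Let I_add (h1 h2 : 'rV[R]_d -> R) w :
  measurable_fun setT h1 -> measurable_fun setT h2 ->
  (forall z, 0 <= h1 z)%R -> (forall z, 0 <= h2 z)%R ->
  I (h1 \+ h2)%R w = I h1 w + I h2 w.
Proof.
move=> m1 m2 h10 h20; rewrite /exp_integral -ge0_integralD//.
- by apply: eq_integral => z _; rewrite mulrDl EFinD.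
- by move=> z _; rewrite lee_fin mulr_ge0 ?expR_ge0.
- exact: measurable_exp_integrand.
- by move=> z _; rewrite lee_fin mulr_ge0 ?expR_ge0.
- exact: measurable_exp_integrand.
Qed.

Let I_le (h1 h2 : 'rV[R]_d -> R) w : (forall z, 0 <= h1 z <= h2 z)%R ->
  I h1 w <= I h2 w.
Proof.
move=> h12; apply: ge0_le_integralT => z; have /andP[h0 h] := h12 z.
  by rewrite lee_fin mulr_ge0 ?expR_ge0.
by rewrite lee_fin ler_wpM2r ?expR_ge0.
Qed.

Let B_A_W q : (`|B q - A q.1| <= W q)%R.
Proof.
case: q => w y /=; have H0 z : (0 <= H y z)%R by case/andP: (H_bound y z).
have V0 z : (0 <= V y z)%R by case/andP: (V_bound y z).
have one0 z : (0 <= one z)%R by rewrite /one/= ler01.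
have mone : measurable_fun setT one by exact: measurable_cst.
have h1 : (B (w, y))%:E <= (A w + W (w, y))%:E.
  rewrite EFinD BE AE WE /= -I_add//; apply: I_le => z; rewrite H0/= /one/=.
  by have := H_V y z; rewrite ler_norml => /andP[_]; lra.
have h2 : (A w)%:E <= (B (w, y) + W (w, y))%:E.
  rewrite EFinD BE AE WE /= -I_add//; apply: I_le => z; rewrite one0/= /one/=.
  by have := H_V y z; rewrite ler_norml => /andP[+ _]; lra.
by move: h1 h2; rewrite !lee_fin ler_norml => h1 h2; lra.
Qed.

Let Q := (P \x mu)%E.

Let int_Q (f : T * 'rV[R]_d -> \bar R) : measurable_fun setT f ->
  (forall q, 0 <= f q) ->
  \int[Q]_q f q = \int[mu]_y \int[P]_w f (w, y).
Proof. by move=> mf f0; rewrite fubini_tonelli2. Qed.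

Let EFin_pow (x : R) k : ((x ^+ k)%:E = x%:E ^+ k)%E.
Proof. by elim: k => [//|k IH]; rewrite exprS EFinM IH expeS. Qed.

Let moment0 h k : Phi [::] h k = \int[P]_w (I h w ^+ k).
Proof.
apply: eq_integral => w _.
by rewrite big_nil mulr0 expR0 mul1e.
Qed.

Let EA k : \int[P]_w (A w ^+ k)%:E = Phi [::] one k.
Proof.
by rewrite moment0; apply: eq_integral => w _; rewrite EFin_pow AE.
Qed.

Let EB k : \int[Q]_q (B q ^+ k)%:E = \int[mu]_y Phi [::] (H y) k.
Proof.
rewrite int_Q; last 2 first.
- by apply/measurable_EFinP; exact: measurable_funX.
- by move=> q; rewrite lee_fin exprn_ge0.
apply: eq_integral => y _; rewrite moment0.
by apply: eq_integral => w _; rewrite EFin_pow BE.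
Qed.

Let EW k : \int[Q]_q (W q ^+ k)%:E = \int[mu]_y Phi [::] (V y) k.
Proof.
rewrite int_Q; last 2 first.
- by apply/measurable_EFinP; exact: measurable_funX.
- by move=> q; rewrite lee_fin exprn_ge0.
apply: eq_integral => y _; rewrite moment0.
by apply: eq_integral => w _; rewrite EFin_pow WE.
Qed.

(** The Cameron-Martin formula at every averaging point [y]. *)
Let EA_EB k : \int[P]_w (A w ^+ k.+1)%:E = M%:E * \int[Q]_q (B q ^+ k)%:E.
Proof.
rewrite EA EB exp_momentS//.
have mPhi : measurable_fun setT (fun y => Phi [::] (H y) k).
  have := @measurable_fun_fubini_tonelli_G _ _ T 'rV[R]_d R P
    (fun q => (B q ^+ k)%:E).
  rewrite /fubini_G => mG.
  rewrite [X in measurable_fun _ X](_ : _ = (fun y => \int[P]_w (B (w, y) ^+ k)%:E)).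
    apply: mG; first by apply/measurable_EFinP; exact: measurable_funX.
    by move=> q; rewrite lee_fin exprn_ge0.
  apply/funext => y; rewrite moment0.
  by apply: eq_integral => w _; rewrite EFin_pow BE.
transitivity (\int[mu]_y (M%:E * Phi [::] (H y) k)).
  have one0 z : (0 <= one z)%R by rewrite /one/= ler01.
  have mone : measurable_fun setT one by exact: measurable_cst.
  apply: eq_integral => y _.
  have := exp_moment_tilt gG cG sG pG mC mu s k [::] y mone one0.
  rewrite big_nil mulr0 addr0 => tilt.
  transitivity (Phi [:: y] one k); first exact: mul1e.
  have e : (fun z => one z * expR (s ^+ 2 * C (z - y)))%R = H y.
    by apply/funext => z; rewrite /one/= mul1r.
  by rewrite e in tilt.
have Phi0 y : setT y -> 0 <= Phi [::] (H y) k.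
  by move=> _; apply: exp_moment_ge0 => z; have /andP[] := H_bound y z.
have M0 : 0 <= M%:E by rewrite lee_fin expR_ge0.
by rewrite ge0_integralZl.
Qed.

Let A_moments : all_moments P A.
Proof.
move=> k; apply/integrableP; split.
  apply/measurable_EFinP; apply: measurable_funX.
  exact: measurable_exp_average.
under eq_integral do rewrite gee0_abs ?lee_fin ?exprn_ge0//.
have one0 z : (0 <= one z)%R by rewrite /one/= ler01.
have mone : measurable_fun setT one by exact: measurable_cst.
have := @exp_moment_le _ _ _ _ _ _ gG cG sG pG mu s [::] one 1%R k mone one0 ler01.
rewrite (integral_cst_probability mu 1) lexx => /(_ isT) h.
by rewrite EA (le_lt_trans h)// ltry.
Qed.

(** The moments of [B] are those of [A], up to the factor [M]. *)
Let B_moments : all_moments Q B.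
Proof.
move=> k; apply/integrableP; split.
  by apply/measurable_EFinP; exact: measurable_funX.
under eq_integral do rewrite gee0_abs ?lee_fin ?exprn_ge0//.
have fA : \int[P]_w (A w ^+ k.+1)%:E \is a fin_num.
  by apply: integrable_fin_num => //; exact: A_moments.
move: fA; rewrite EA_EB; set J := \int[Q]_q _.
have J0 : 0 <= J by apply: integral_ge0 => q _; rewrite lee_fin exprn_ge0.
rewrite ltey; apply: contraTN => /eqP ->.
by rewrite gt0_muley// lte_fin expR_gt0.
Qed.

Let lift_integral (f : T -> R) : P.-integrable setT (EFin \o f) ->
  Q.-integrable setT (fun q => (f q.1)%:E) /\
  \int[Q]_q (f q.1)%:E = \int[P]_w (f w)%:E.
Proof.
move=> fi; have mf : measurable_fun setT f by exact/measurable_EFinP/(measurable_int P).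
have mf1 : measurable_fun setT (fun q : T * 'rV[R]_d => f q.1).
  exact: measurableT_comp mf measurable_fst.
have i1 : Q.-integrable setT (fun q => (f q.1)%:E).
  apply/integrableP; split; first exact/measurable_EFinP.
  rewrite int_Q; last 2 first.
  - by apply: measurableT_comp => //; exact/measurable_EFinP.
  - by move=> q.
  rewrite /= (integral_cst mu measurableT (\int[P]_w `|(f w)%:E|)).
  rewrite [X in _ * X](_ : _ = 1) ?mule1.
    by have /integrableP[] := fi.
  exact: probability_setT.
split => //.
rewrite -(@integral12_prod_meas1 _ _ _ _ _ P mu) => //.
apply: eq_integral => w _ /=.
transitivity (\int[mu]_y (f w)%:E); first by [].
exact: integral_cst_probability.
Qed.

Variable kappa : R.
Hypotheses (kappa0 : (0 <= kappa)%R)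
  (kappaP : forall y, \int[mu]_z `|C (z - y)|%:E <= kappa%:E).

Let w k : R := ((K * kappa) ^+ k * expR (s ^+ 2 * (C 0 * k%:R ^+ 2) / 2))%R.

Let EW_le k : \int[Q]_q (W q ^+ k)%:E <= (w k)%:E.
Proof.
rewrite EW -[leRHS](integral_cst_probability mu).
have V0 y z : (0 <= V y z)%R by case/andP: (V_bound y z).
apply: ge0_le_integralT => y; first by apply: exp_moment_ge0 => z.
apply: exp_moment_le => //; first by rewrite mulr_ge0.
rewrite /V; under eq_integral do rewrite EFinM.
rewrite ge0_integralZl//.
- by rewrite (EFinM K kappa); apply: lee_wpmul2l; rewrite ?lee_fin.
- apply/measurable_EFinP; apply: measurableT_comp => //.
  exact: (measurableT_comp mdiff (measurable_pair1 y)).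
Qed.

Let W_moments : all_moments Q W.
Proof.
move=> k; apply/integrableP; split.
  by apply/measurable_EFinP; exact: measurable_funX.
under eq_integral do rewrite gee0_abs ?lee_fin ?exprn_ge0//.
by rewrite (le_lt_trans (EW_le k))// ltry.
Qed.

(** By [EA_EB] the moment is the integral of
    [M * ((B - M) ^ (2 k + 1) - (A - M) ^ (2 k + 1))], which [perturbed_power_le]
    bounds by half of the moment itself and by moments of [W]. *)
Lemma centered_moment_le k : \int[P]_w ((A w - M) ^+ k.+1.*2)%:E <=
  (2 * ((2 * M * k.+1.*2%:R * 4 ^+ k) ^+ k.+1 * w k.+1 +
        M * k.+1.*2%:R * 4 ^+ k * w k.*2.+1))%:E.
Proof.
have iA i j : P.-integrable setT (fun w => (A w ^+ i * (A w - M) ^+ j)%:E).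
  exact: integrable_centered_moments.
have iA0 j : P.-integrable setT (fun w => ((A w - M) ^+ j)%:E).
  by have := iA 0%N j; under eq_fun do rewrite expr0 mul1r.
have iB j : Q.-integrable setT (fun q => ((B q - M) ^+ j)%:E).
  have := @integrable_centered_moments _ _ _ Q B M 0 j B_moments.
  by under eq_fun do rewrite expr0 mul1r.
have iAQ j := lift_integral (iA0 j).
have [iAQo _] := iAQ k.*2.+1.
have [iQ eQ] := iAQ k.+1.*2.
have iD : Q.-integrable setT
    (fun q => ((B q - M) ^+ k.*2.+1)%:E - ((A q.1 - M) ^+ k.*2.+1)%:E).
  by apply: integrableB.
have key : \int[P]_w ((A w - M) ^+ k.+1.*2)%:E =
    \int[Q]_q (M%:E * (((B q - M) ^+ k.*2.+1)%:E - ((A q.1 - M) ^+ k.*2.+1)%:E)).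
  transitivity (\int[P]_w (A w ^+ 1 * (A w - M) ^+ k.*2.+1)%:E -
      M%:E * \int[P]_w ((A w - M) ^+ k.*2.+1)%:E).
    rewrite -integralZl// -integralB//; last by apply: integrableZl.
    apply: eq_integral => w' _ /=; congr EFin.
    by rewrite doubleS exprS expr1; ring.
  rewrite (shifted_moments A_moments B_moments EA_EB) -(iAQ _).2.
  under [X in M%:E * X - _]eq_integral do rewrite expr0 mul1r.
  rewrite integralZl// integralB//.
  by apply: muleBr_fin; apply: integrable_fin_num.
set c1 := ((2 * M * k.+1.*2%:R * 4 ^+ k) ^+ k.+1)%R.
set c2 := (M * k.+1.*2%:R * 4 ^+ k)%R.
have c10 : (0 <= c1)%R by rewrite exprn_ge0// !mulr_ge0 ?expR_ge0// exprn_ge0.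
have c20 : (0 <= c2)%R by rewrite !mulr_ge0 ?expR_ge0// exprn_ge0.
have i1 : Q.-integrable setT (fun q => c1%:E * (W q ^+ k.+1)%:E).
  by apply: integrableZl => //; exact: W_moments.
have i2 : Q.-integrable setT (fun q => c2%:E * (W q ^+ k.*2.+1)%:E).
  by apply: integrableZl => //; exact: W_moments.
have i3 : Q.-integrable setT (fun q => 2^-1%:E * ((A q.1 - M) ^+ k.+1.*2)%:E).
  by apply: integrableZl.
set X := \int[P]_w _ in key *.
have X0 : 0 <= X.
  by apply: integral_ge0 => w' _; rewrite lee_fin -mul2n exprM exprn_ge0// sqr_ge0.
have Xfin : X \is a fin_num by apply: integrable_fin_num => //; exact: iA0.
have : X <= 2^-1%:E * X + (c1 * w k.+1 + c2 * w k.*2.+1)%:E.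
  rewrite {1}key.
  apply: (@le_trans _ _ (\int[Q]_q (2^-1%:E * ((A q.1 - M) ^+ k.+1.*2)%:E +
     (c1%:E * (W q ^+ k.+1)%:E + c2%:E * (W q ^+ k.*2.+1)%:E)))).
    apply: le_integral => //.
    - by apply: integrableZl.
    - by apply: integrableD => //; apply: integrableD.
    - move=> q _; rewrite -!EFinB -!EFinM -!EFinD lee_fin.
      have -> : (B q - M = (A q.1 - M) + (B q - A q.1))%R by ring.
      apply: (le_trans (perturbed_power_le _ _ _ (expR_ge0 _))).
      rewrite lerD2l; apply: lerD; rewrite ler_wpM2l// lerXn2r ?nnegrE//.
  rewrite integralD//; last by apply: integrableD.
  rewrite integralD// !integralZl//; [|exact: W_moments..].
  rewrite eQ leeD2l// EFinD !EFinM.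
  by apply: leeD; apply: lee_wpmul2l; rewrite ?lee_fin// EW_le.
move: Xfin; case: X key X0 => // r _ r0 _.
by rewrite -EFinM -EFinD !lee_fin; lra.
Qed.

End moment_bound.

(** * Deviations of ball averages *)

Section moment_constants.
Context {R : realType}.

Lemma natr_le_exp4 n : (n%:R <= 4 ^+ n :> R).
Proof.
elim: n => [|n IH]; first by rewrite expr0.
rewrite -natr1 exprS.
have : (1 <= 4 ^+ n :> R) by rewrite exprn_ege1// ler1n.
by move: IH; set a := 4 ^+ n; lra.
Qed.

(** Every constant raised to a power at most [n ^ 2] is absorbed in a single
    [Theta ^ (n ^ 2)]. *)
Lemma moment_constants (M K kappa0 sg : R) : 1 <= M -> 0 <= K -> 0 <= kappa0 ->
  0 <= sg -> exists Theta : R, 1 <= Theta /\ forall (rho : R) k, 0 <= rho <= 1 ->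
  let w j := (K * (kappa0 * rho)) ^+ j * expR (sg * j%:R ^+ 2 / 2) in
  2 * ((2 * M * k.+1.*2%:R * 4 ^+ k) ^+ k.+1 * w k.+1 +
       M * k.+1.*2%:R * 4 ^+ k * w k.*2.+1)
  <= Theta ^+ (k.+1 ^ 2) * rho ^+ k.+1.
Proof.
move=> M1 K0 kp0 sg0.
pose E := expR sg; pose L := 1 + K * kappa0.
have E1 : 1 <= E by rewrite -expR0 ler_expR.
have Kk0 : 0 <= K * kappa0 by rewrite mulr_ge0.
have L1 : 1 <= L by rewrite lerDl.
pose Th0 := 16 * M * L ^+ 2 * E ^+ 2.
have L21 : 1 <= L ^+ 2 by rewrite exprn_ege1.
have E21 : 1 <= E ^+ 2 by rewrite exprn_ege1.
have M0 : 0 <= M by exact: le_trans M1.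
have Th01 : 1 <= Th0.
  by rewrite /Th0 -!mulrA !mulr_ege1// ler1n.
exists (4 * Th0); split; first by rewrite mulr_ege1// ler1n.
move=> rho k /andP[r0 r1] /=.
pose w j := (K * (kappa0 * rho)) ^+ j * expR (sg * j%:R ^+ 2 / 2).
rewrite -!/(w _).
set n := k.+1; pose N := (n ^ 2)%N.
have nN : (n <= N)%N by rewrite /N expnS expn1 leq_pmulr.
have N0 : (0 < N)%N by rewrite /N expn_gt0.
have pw (x : R) i j : 1 <= x -> (i <= j)%N -> x ^+ i <= x ^+ j.
  by move=> x1 ij; rewrite ler_weXn2l.
have h4 : n.*2%:R * 4 ^+ k * 2 <= 16 ^+ n :> R.
  have -> : (16 : R) = 4 * 4 by ring.
  rewrite exprMn -mul2n natrM /n [in leRHS]exprS mulrACA.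
  have := natr_le_exp4 k.+1; rewrite exprS => h.
  have p0 : (0 <= 4 ^+ k :> R) by rewrite exprn_ge0.
  have -> : 2 * k.+1%:R * 4 ^+ k * 2 = (4 * 4 ^+ k) * k.+1%:R :> R by ring.
  apply: (@le_trans _ _ ((4 * 4 ^+ k) * (4 * 4 ^+ k))).
    by rewrite ler_wpM2l// mulr_ge0.
  by rewrite mulrACA.
have a1 : (2 * M * n.*2%:R * 4 ^+ k) ^+ n <= (16 * M) ^+ N.
  apply: (@le_trans _ _ ((M * 16 ^+ n) ^+ n)).
    rewrite lerXn2r ?nnegrE ?mulr_ge0 ?exprn_ge0//.
    have -> : 2 * M * n.*2%:R * 4 ^+ k = M * (n.*2%:R * 4 ^+ k * 2) by ring.
    by rewrite ler_wpM2l.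
  rewrite !exprMn -exprM mulnn mulrC ler_wpM2l ?exprn_ge0//.
  exact: pw.
have a2 : M * n.*2%:R * 4 ^+ k <= (16 * M) ^+ N.
  apply: (@le_trans _ _ (M * 16 ^+ n)).
    rewrite -mulrA ler_wpM2l//; apply: le_trans h4.
    have : (0 <= n.*2%:R * 4 ^+ k :> R) by rewrite mulr_ge0 ?exprn_ge0.
    by set x := n.*2%:R * _; lra.
  rewrite exprMn mulrC; apply: ler_pM; rewrite ?exprn_ge0//.
    by apply: pw => //; rewrite ler1n.
  by rewrite -[leLHS]expr1 pw.
have rj j : (0 <= (K * (kappa0 * rho)) ^+ j <= L ^+ j * rho ^+ j).
  rewrite mulrA exprMn mulr_ge0 ?exprn_ge0//= ler_wpM2r ?exprn_ge0//.
  by rewrite lerXn2r ?nnegrE ?lerDr// (le_trans ler01).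
have LE : (L ^+ 2 * E ^+ 2) ^+ N = L ^+ (2 * N) * E ^+ (2 * N).
  by rewrite exprMn -!exprM.
have b1 : w n <= (L ^+ 2 * E ^+ 2) ^+ N * rho ^+ n.
  have /andP[q0 q1] := rj n.
  rewrite /w LE [in leRHS]mulrAC.
  apply: ler_pM; rewrite ?expR_ge0//.
    apply: (le_trans q1); rewrite ler_wpM2r ?exprn_ge0// pw//.
    by rewrite (leq_trans nN)// leq_pmull.
  rewrite /E -expRM_natl ler_expR -natrX.
  have sN : 0 <= sg * N%:R by rewrite mulr_ge0.
  by rewrite natrM -/N; lra.
have b2 : w k.*2.+1 <= (L ^+ 2 * E ^+ 2) ^+ N * rho ^+ n.
  have /andP[q0 q1] := rj k.*2.+1.
  rewrite /w LE [in leRHS]mulrAC.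
  have kn : (k.*2.+1 <= 2 * N)%N.
    by rewrite (@leq_trans n.*2)// -?mul2n ?leq_pmul2l// /n mul2n doubleS.
  apply: ler_pM; rewrite ?expR_ge0//.
    apply: (le_trans q1); apply: ler_pM; rewrite ?exprn_ge0//; first exact: le_trans L1.
      exact: pw.
    by rewrite ler_wiXn2l// ltnS -addnn leq_addr.
  rewrite /E -expRM_natl ler_expR -natrX.
  have h : (k.*2.+1 ^ 2 <= 4 * N)%N.
    have -> : (4 * N = n.*2 ^ 2)%N by rewrite /N -mul2n expnMn.
    by rewrite leq_exp2r// /n doubleS.
  have : sg * (k.*2.+1 ^ 2)%:R <= sg * (4 * N)%:R :> R.
    by rewrite ler_wpM2l// ler_nat.
  by rewrite !natrM; lra.
have [w10 w20] : 0 <= w n /\ 0 <= w k.*2.+1.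
  by split; rewrite mulr_ge0 ?expR_ge0//; [have /andP[] := rj n|have /andP[] := rj k.*2.+1].
set X := (16 * M) ^+ N * ((L ^+ 2 * E ^+ 2) ^+ N * rho ^+ n).
have t1 : (2 * M * n.*2%:R * 4 ^+ k) ^+ n * w n <= X.
  by apply: ler_pM => //; rewrite exprn_ge0// !mulr_ge0// exprn_ge0.
have t2 : M * n.*2%:R * 4 ^+ k * w k.*2.+1 <= X.
  by apply: ler_pM => //; rewrite !mulr_ge0// exprn_ge0.
have XE : X = Th0 ^+ N * rho ^+ n by rewrite /X (mulrA (_ ^+ N)) -exprMn /Th0;
  congr (_ ^+ N * _); ring.
have X0 : 0 <= X by rewrite (le_trans _ t1)// mulr_ge0// exprn_ge0// !mulr_ge0// exprn_ge0.
apply: (@le_trans _ _ (4 * X)); first by lra.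
rewrite exprMn -mulrA -XE ler_wpM2r//.
by rewrite -[leLHS]expr1 pw// ler1n.
Qed.

End moment_constants.

Section uniform_on_ball.
Context {R : realType} {n : nat}.
Local Notation lam := (@lebesgue_rV R n).
Variables (y : 'rV[R]_n) (r : R).
Hypothesis r0 : 0 < r.

(** The Dirac mass is the junk value of the normalization. *)
Definition uniform_ball : probability 'rV[R]_n R :=
  mnormalize (mrestr lam (measurable_eball y r)) (\d_(0 : 'rV[R]_n)).

Let v : R := r ^+ n * unit_volume (R := R) (n := n).

Let v0 : 0 < v.
Proof. by rewrite mulr_gt0 ?exprn_gt0// unit_volume_gt0. Qed.

Let mass : mrestr lam (measurable_eball y r) setT = v%:E.
Proof. by rewrite /mrestr setTI volume_eball. Qed.

Lemma integral_uniform_ball (f : 'rV[R]_n -> \bar R) :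
  measurable_fun setT f -> (forall z, 0 <= f z)%E ->
  (\int[uniform_ball]_z f z = v^-1%:E * \int[lam]_(z in eball y r) f z)%E.
Proof.
move=> mf f0.
have vi0 : 0 <= v^-1 by rewrite invr_ge0 ltW.
pose k : {nonneg R} := NngNum vi0.
transitivity (\int[mscale k (mrestr lam (measurable_eball y r))]_z f z)%E.
  apply: eq_measure_integral => A mA _; rewrite /uniform_ball/= /mnormalize.
  move: mass => /= massE; rewrite massE /= eqe gt_eqF//= /mscale/= muleC.
  by [].
rewrite ge0_integral_mscale//; congr (_ * _)%E.
rewrite (@ge0_negligible_integral _ _ _ _ setT (~` eball y r))//.
- rewrite setTD setCK; apply: eq_measure_integral => A mA Ay.
  rewrite /= /mrestr; congr (lam _); exact: setIidl.
- by apply: measurableC; exact: measurable_eball.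
- rewrite /= /mrestr; rewrite [X in lam X](_ : _ = set0) ?measure0//; exact: setICl.
Qed.

End uniform_on_ball.

Section ball_average_deviation.
Context {disp : measure_display} {T : measurableType disp} {R : realType}.
Context {P : probability T R} {d : nat}.
Variable G : 'rV[R]_d -> {RV P >-> R}.
Hypotheses (gG : gaussian_field G) (cG : centered_field G)
  (sG : stationary_field G) (pG : continuous_paths G).
Local Notation C := (covariance_fun G).
Hypothesis intC : (lebesgue_rV d).-integrable setT (EFin \o C).
Hypothesis d1 : (1 <= d)%N.
Local Notation lam := (@lebesgue_rV R d).

Definition ball_mean (s : R) g (y : 'rV[R]_d) (r : R) : R :=
  ball_mass (fun z => expR (s * g z)) y r / (r ^+ d * @unit_volume R d).

Let mC : measurable_fun setT C.
Proof. by apply/measurable_EFinP; exact: measurable_int intC. Qed.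

Let one : 'rV[R]_d -> R := cst 1.

Let path w : 'rV[R]_d -> R := fun z => G z w.

Let cpath w : continuous (path w).
Proof. exact: pG. Qed.

Let uniform_exp s y r w (r0 : 0 < r) :
  exp_integral G (uniform_ball y r) s one w = (ball_mean s (path w) y r)%:E.
Proof.
have cF := @continuous_expRM _ _ s _ (@cpath w).
rewrite /exp_integral /ball_mean [RHS]EFinM ball_massE//.
rewrite integral_uniform_ball//.
- by rewrite muleC; congr (_ * _)%E; apply: eq_integral => z _; rewrite mul1r.
- under eq_fun do rewrite mul1r.
  by apply/measurable_EFinP; exact: measurable_continuous_rV.
- by move=> z; rewrite lee_fin mul1r expR_ge0.
Qed.

Let exp_average_ball s y r w (r0 : 0 < r) :
  exp_average G (uniform_ball y r) s w = ball_mean s (path w) y r.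
Proof. by rewrite /exp_average [exp_integral _ _ _ _ _]uniform_exp. Qed.

(** The mean of [|C|] over a ball is at most its total mass over the volume of the
    ball, which grows at least linearly in the radius. *)
Let covariance_mass : exists c : R, 0 <= c /\
  forall y r, 1 <= r -> forall x,
    (\int[uniform_ball y r]_z `|C (z - x)|%:E <= (c * r^-1)%:E)%E.
Proof.
have /integrableP[mc fc] := intC.
have c0 : (0 <= \int[lam]_z `|C z|%:E)%E by apply: integral_ge0 => z _; rewrite lee_fin.
have cfin : (\int[lam]_z `|C z|%:E)%E \is a fin_num by rewrite ge0_fin_numE.
pose c := fine (\int[lam]_z `|C z|%:E)%E.
have V0 := @unit_volume_gt0 R d.
exists (c / @unit_volume R d); split.
  by rewrite divr_ge0// ?fine_ge0// ltW.
move=> y r r1 x; have r0 : 0 < r by exact: lt_le_trans r1.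
have mCs : measurable_fun setT (fun z : 'rV[R]_d => `|C (z - x)|%:E).
  apply/measurable_EFinP; apply: measurableT_comp => //.
  apply: (measurableT_comp mC); have := measurable_affine_rV 1 (- x).
  by under eq_fun do rewrite scale1r.
rewrite integral_uniform_ball//.
have h1 : (\int[lam]_(z in eball y r) `|C (z - x)|%:E <= c%:E)%E.
  rewrite /c fineK// -[leRHS](integral_shift (- x)).
  - apply: ge0_subset_integral => //; first exact: measurable_eball.
  - by apply/measurable_EFinP; apply: measurableT_comp.
  - by move=> z; rewrite lee_fin.
apply: (@le_trans _ _ ((r ^+ d * @unit_volume R d)^-1%:E * c%:E)%E).
  by apply: lee_wpmul2l; rewrite // lee_fin invr_ge0 mulr_ge0 ?exprn_ge0// ltW.
rewrite -EFinM lee_fin invfM [leLHS]mulrC -!mulrA ler_wpM2l// ?fine_ge0//.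
rewrite mulrC ler_wpM2l ?invr_ge0//; first exact: ltW.
rewrite lef_pV2 ?posrE ?exprn_gt0// -[leLHS]expr1.
by rewrite ler_weXn2l.
Qed.

(** Chebyshev's inequality for the moment of order [2 * k.+1]. The freedom to choose
    [k] according to [r] makes up for the growth of the constant. *)
Lemma ball_mean_deviation (s : R) : exists Theta : R, 1 <= Theta /\
  forall y r k, 1 <= r ->
  (P [set w | (expR (s ^+ 2 * C 0 / 2) / 4 <=
      `|ball_mean s (fun z => G z w) y r - expR (s ^+ 2 * C 0 / 2)|)%R] <=
   (Theta ^+ (k.+1 ^ 2) * r^-1 ^+ k.+1)%:E)%E.
Proof.
set M := expR _.
have C0 : 0 <= C 0 by rewrite (le_trans _ (covariance_norm_le gG cG sG 0)).
have M1 : 1 <= M by rewrite -expR0 ler_expR mulr_ge0// mulr_ge0// sqr_ge0.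
have [c [c0 cP]] := covariance_mass.
have K0 : 0 <= s ^+ 2 * expR (s ^+ 2 * C 0) by rewrite mulr_ge0 ?sqr_ge0 ?expR_ge0.
have sg0 : 0 <= s ^+ 2 * C 0 by rewrite mulr_ge0 ?sqr_ge0.
have [Th [Th1 ThP]] := moment_constants M1 K0 c0 sg0.
exists (16 * Th); split; first by rewrite mulr_ege1// ler1n.
move=> y r k r1; have r0 : 0 < r by exact: lt_le_trans r1.
have ri : 0 <= r^-1 <= 1 by rewrite invr_ge0 ltW//= invf_le1.
have cr0 : 0 <= c * r^-1 by rewrite mulr_ge0//; case/andP: ri.
have Ifin w : (exp_integral G (uniform_ball y r) s one w < +oo)%E.
  by rewrite uniform_exp// ltry.
have := centered_moment_le gG cG sG pG mC Ifin cr0 (cP y r r1) k.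
set A := exp_average G (uniform_ball y r) s => hm.
have mA : measurable_fun setT A by exact: measurable_exp_average.
have {}hm : (\int[P]_w ((A w - M) ^+ k.+1.*2)%:E <=
    (Th ^+ (k.+1 ^ 2) * r^-1 ^+ k.+1)%:E)%E.
  apply: (le_trans hm); rewrite lee_fin; apply: le_trans (ThP r^-1 k ri) => /=.
  by rewrite !(mulrA (s ^+ 2) (C 0)).
have -> : [set w | M / 4 <= `|ball_mean s (fun z => G z w) y r - M|] =
    [set w | M / 4 <= `|A w - M|].
  by apply/seteqP; split => w /=; rewrite /A exp_average_ball.
have mX : measurable_fun setT (fun w => A w - M) by exact: measurable_funB.
pose X : {RV P >-> R} := HB.pack (fun w => A w - M)
  (isMeasurableFun.Build _ _ T R _ mX).
have M40 : 0 < M / 4 by rewrite divr_gt0// (lt_le_trans ltr01).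
have := @markov _ _ _ P X (fun x => x ^+ k.+1.*2) (M / 4) M40.
have -> : [set w | ((M / 4)%:E <= `|(X w)%:E|)%E] = [set w | M / 4 <= `|A w - M|].
  by apply/seteqP; split => w /=; rewrite lee_fin.
set B := [set w | _].
have mB : measurable B.
  rewrite -[B]setTI; apply: measurable_fun_le => //.
  exact: measurableT_comp.
move=> /(_ (exprn_measurable _)) h.
have {}h : (((M / 4) ^+ k.+1.*2)%:E * P B <= (Th ^+ (k.+1 ^ 2) * r^-1 ^+ k.+1)%:E)%E.
  apply: le_trans hm; apply: le_trans (h _ _) _.
  - by move=> x x0; rewrite exprn_ge0.
  - by move=> a b; rewrite !nnegrE => a0 b0 ab; rewrite lerXn2r.
  - rewrite unlock; apply: ge0_le_integralT => w /=.
      by rewrite lee_fin exprn_ge0.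
    by rewrite lee_fin -mul2n !exprM real_normK// num_real.
have PB : P B \is a fin_num by exact: fin_num_measure.
move: h; rewrite -(fineK PB) -EFinM !lee_fin => h.
have p0 : 0 < (M / 4) ^+ k.+1.*2 by rewrite exprn_gt0.
have -> : fine (P B) = ((M / 4) ^+ k.+1.*2)^-1 * ((M / 4) ^+ k.+1.*2 * fine (P B)).
  by rewrite mulrA mulVf ?mul1r// gt_eqF.
apply: (@le_trans _ _ (((M / 4) ^+ k.+1.*2)^-1 * (Th ^+ (k.+1 ^ 2) * r^-1 ^+ k.+1))).
  by rewrite ler_wpM2l// invr_ge0 ltW.
rewrite mulrA ler_wpM2r ?exprn_ge0//; first by case/andP: ri.
rewrite [in leRHS]exprMn ler_wpM2r ?exprn_ge0// ?(le_trans ler01)//.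
rewrite -exprVn invf_div.
apply: (@le_trans _ _ (4 ^+ k.+1.*2)).
  rewrite lerXn2r ?nnegrE// ?divr_ge0 ?ler_pdivrMr ?(lt_le_trans ltr01)//.
  - by rewrite (le_trans ler01).
  - by rewrite ler_peMr.
rewrite -mul2n exprM.
have -> : (4 ^+ 2 = 16 :> R) by ring.
by rewrite ler_weXn2l ?ler1n// expnS expn1 leq_pmulr.
Qed.

End ball_average_deviation.

(** * Union bounds and Euclidean neighborhoods *)

Section union_bounds.
Context {disp : measure_display} {T : measurableType disp} {R : realType}.
Variable P : {measure set T -> \bar R}.

Lemma measurable_exists_fin (I : finType) (F : I -> set T) :
  (forall i, measurable (F i)) -> measurable [set w | exists i, F i w].
Proof.
move=> mF; have -> : [set w | exists i, F i w] = \bigcup_(i in [set: I]) F i.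
  by apply/seteqP; split => w /= [i]; [exists i|move=> _ ?; exists i].
exact: fin_bigcup_measurable.
Qed.

Lemma measure_exists_fin_le (I : finType) (F : I -> set T) (b : R) :
  (forall i, measurable (F i)) -> (forall i, P (F i) <= b%:E)%E ->
  (P [set w | exists i, F i w] <= (#|I|%:R * b)%:E)%E.
Proof.
move=> mF Fb.
have h (s : seq I) : measurable [set w | exists2 i, i \in s & F i w] /\
    (P [set w | exists2 i, i \in s & F i w] <= ((size s)%:R * b)%:E)%E.
  elim: s => [|i s [ms IH]].
    rewrite (_ : mkset _ = set0).
      by rewrite measure0 mul0r.
    by apply/seteqP; split => // w [].
  have -> : [set w | exists2 j, j \in i :: s & F j w] =
      F i `|` [set w | exists2 i, i \in s & F i w].
    apply/seteqP; split => w /=.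
      move=> [j]; rewrite inE => /orP[/eqP-> Fi|js Fj]; first by left.
      by right; exists j.
    move=> [Fi|[j js Fj]]; first by exists i; rewrite ?mem_head.
    by exists j => //; rewrite inE js orbT.
  split; first exact: measurableU.
  apply: (le_trans (measureU2 _ _ _)) => //.
  by rewrite /= -natr1 mulrDl mul1r EFinD addeC leeD.
have [_] := h (enum I); rewrite -cardE; apply: le_trans.
rewrite (_ : [set w | exists i, F i w] = [set w | exists2 i, i \in enum I & F i w])//.
apply/seteqP; split => w /= [i]; first by exists i; rewrite ?mem_enum.
by move=> _ ?; exists i.
Qed.

Lemma measure_bigcup_geometric (F : (set T)^nat) (A q : R) : 0 <= A -> 0 <= q < 1 ->
  (forall n, measurable (F n)) -> (forall n, P (F n) <= (A * q ^+ n)%:E)%E ->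
  (P (\bigcup_n F n) <= (A / (1 - q))%:E)%E.
Proof.
move=> A0 q01 mF FA.
apply: (@le_trans _ _ (\sum_(0 <= n <oo) P (F n))%E).
  by apply: generalized_Boole_inequality => //; exact: bigcup_measurable.
exact: nneseries_le_geometric.
Qed.

End union_bounds.

Section euclidean_topology.
Context {R : realType} {n : nat}.
Implicit Types x y z : 'rV[R]_n.

(** The Euclidean balls define the topology of the supremum norm. *)
Lemma nbhs_eball x (A : set 'rV[R]_n) : nbhs x A ->
  exists2 e : R, 0 < e & eball x e `<=` A.
Proof.
move=> /nbhs_ballP[e /= e0 eA]; exists e => // y xy; apply: eA; split => // i j.
rewrite /ball/= ord1 distrC.
have := coord_le_enorm (y - x) j; rewrite !mxE => h.
exact: le_lt_trans xy.
Qed.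

Lemma continuous_eball (g : 'rV[R]_n -> R) x (e : R) : {for x, continuous g} ->
  0 < e -> exists2 de : R, 0 < de & forall y, eball x de y -> `|g y - g x| < e.
Proof.
move=> cg e0.
have /nbhs_eball[de de0 h] : nbhs x (g @^-1` ball (g x) e).
  exact: (cg _ (nbhsx_ballx (g x) e e0)).
by exists de => // y /h; rewrite /= /ball/= distrC.
Qed.

Lemma enorm_row_le (f : 'I_n -> R) (M : R) : 0 <= M -> (forall i, `|f i| <= M) ->
  enorm (\row_i f i) <= n%:R * M.
Proof. by move=> M0 fM; apply: enorm_le_coord => // i; rewrite mxE. Qed.

End euclidean_topology.

(** * Chaining over a unit cube *)

Section chaining.
Context {disp : measure_display} {T : measurableType disp} {R : realType}.
Context {P : probability T R} {d : nat}.
Variable G : 'rV[R]_d -> {RV P >-> R}.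
Hypotheses (gG : gaussian_field G) (cG : centered_field G)
  (sG : stationary_field G) (pG : continuous_paths G).
Local Notation C := (covariance_fun G).
Variable alpha : R.
Hypotheses (alpha0 : 0 < alpha) (hC : holder_at0 C alpha).
Implicit Types (x y z : 'rV[R]_d) (t : R).

Let C0 : 0 <= C 0.
Proof. by rewrite (le_trans _ (covariance_norm_le gG cG sG 0)). Qed.

Lemma increment_variance x y :
  comb_var G [:: (1, x); (-1, y)] = 2 * (C 0 - C (x - y)).
Proof.
rewrite /comb_var !big_cons !big_nil/= !subrr -(opprB x y) covariance_sym//.
ring.
Qed.

(** Away from the origin the increments are bounded by [4 * C 0], so that the
    local modulus of continuity is a global one. *)
Lemma increment_variance_le : exists2 K : R, 0 < K &
  forall x y, comb_var G [:: (1, x); (-1, y)] <= K * enorm (x - y) `^ alpha.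
Proof.
have [L /nbhs_eball[de de0 hL]] := hC.
have da : 0 < de `^ alpha by rewrite powR_gt0.
pose K := 1 + 2 * `|L| + 4 * C 0 / de `^ alpha.
have q0 : 0 <= 4 * C 0 / de `^ alpha by rewrite divr_ge0 ?mulr_ge0// ltW.
have L0 := normr_ge0 L.
exists K; first by rewrite /K; lra.
move=> x y; rewrite increment_variance; set h := x - y.
have p0 : 0 <= enorm h `^ alpha by rewrite powR_ge0.
have [hd|hd] := ltP (enorm h) de.
  have /hL : eball 0 de h by rewrite /eball/= subr0.
  rewrite /= distrC => /(le_trans (ler_norm _)) h1.
  have h2 : L * enorm h `^ alpha <= `|L| * enorm h `^ alpha.
    by rewrite ler_wpM2r// ler_norm.
  have h3 : 0 <= (4 * C 0 / de `^ alpha) * enorm h `^ alpha by rewrite mulr_ge0.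
  set p := enorm h `^ alpha in p0 h1 h2 h3 *.
  have -> : K * p = p + 2 * (`|L| * p) + 4 * C 0 / de `^ alpha * p by rewrite /K; ring.
  by move: h1 h2 h3 p0; set u := _ / _ * p; set v := `|L| * p; set v' := L * p; lra.
have /(le_trans (ler_norm _)) h1 : `|- C h| <= C 0.
  by rewrite normrN; exact: covariance_norm_le.
have h2 : de `^ alpha <= enorm h `^ alpha.
  by rewrite ge0_ler_powR ?nnegrE ?enorm_ge0// ltW.
apply: (@le_trans _ _ (4 * C 0)); first by lra.
apply: (@le_trans _ _ ((4 * C 0 / de `^ alpha) * enorm h `^ alpha)).
  by rewrite -mulrA ler_peMr ?mulr_ge0// ler_pdivlMl// mulr1.
by rewrite ler_wpM2r// /K; lra.
Qed.

Section cube.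
Variable z : 'rV[R]_d.

Let node k (j : 'I_d -> nat) : 'rV[R]_d := z + \row_i ((j i)%:R * 2^-1 ^+ k).

Let half j : 'I_d -> nat := fun i => (j i)./2.

Let node_half k j : enorm (node k.+1 j - node k (half j)) <= d%:R * 2^-1 ^+ k.+1.
Proof.
have -> : node k.+1 j - node k (half j) =
    \row_i ((odd (j i))%:R * 2^-1 ^+ k.+1).
  apply/rowP => i; rewrite /node /half !mxE.
  rewrite -{1}(odd_double_half (j i)) natrD -muln2 natrM exprS.
  by set a := 2^-1 ^+ k; field.
apply: enorm_row_le => [|i]; first by rewrite exprn_ge0.
rewrite ger0_norm ?mulr_ge0 ?exprn_ge0// ler_piMl ?exprn_ge0//.
by rewrite lern1 leq_b1.
Qed.

Let digits k x : 'I_d -> nat := fun i => Num.truncn (2 ^+ k * (x ord0 i - z ord0 i)).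

Let cube x := forall i, z ord0 i <= x ord0 i < z ord0 i + 1.

Let digits_itv k x i : cube x ->
  (digits k x i)%:R <= 2 ^+ k * (x ord0 i - z ord0 i) < (digits k x i).+1%:R.
Proof.
move=> /(_ i) /andP[h1 h2]; apply: truncn_itv.
by rewrite mulr_ge0 ?exprn_ge0// subr_ge0.
Qed.

Let digits_lt k x i : cube x -> (digits k x i < 2 ^ k)%N.
Proof.
move=> cx; have /andP[h1 _] := digits_itv k i cx.
rewrite -(ltr_nat R) (le_lt_trans h1)// natrX.
have /andP[_ h2] := cx i.
by rewrite gtr_pMr ?exprn_gt0// ltrBlDl.
Qed.

Let half_digits k x : cube x -> half (digits k.+1 x) = digits k x.
Proof.
move=> cx; apply/funext => i; rewrite /half.
have /andP[] := digits_itv k.+1 i cx.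
set m := digits k.+1 x i => h1 h2; apply/esym; rewrite [LHS]/digits.
apply: truncn_def; move: h1 h2; rewrite exprS -mulrA; set y := 2 ^+ k * _.
have hm : m%:R = (odd m)%:R + m./2%:R * 2 :> R.
  by rewrite -{1}(odd_double_half m) natrD -muln2 natrM.
have o0 : 0 <= (odd m)%:R :> R by exact: ler0n.
have o1 : (odd m)%:R <= 1%:R :> R by rewrite ler_nat leq_b1.
by move: o0 o1; rewrite -!natr1 hm; set o := (odd m)%:R; lra.
Qed.

Let digits0 x : cube x -> node 0 (digits 0 x) = z.
Proof.
move=> cx; apply/rowP => i; rewrite !mxE.
by have := digits_lt 0 i cx; rewrite expn0 ltnS leqn0 => /eqP->; rewrite mul0r addr0.
Qed.

Let node_digits k x : cube x -> enorm (node k (digits k x) - x) <= d%:R * 2^-1 ^+ k.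
Proof.
move=> cx; apply: enorm_le_coord => [|i]; first by rewrite exprn_ge0.
have p0 : 0 < 2 ^+ k :> R by rewrite exprn_gt0.
have /andP[h1 h2] := digits_itv k i cx.
rewrite !mxE -(ler_pM2l p0) -[X in X * _ <= _](gtr0_norm p0) -normrM.
have -> : 2 ^+ k * (z ord0 i + (digits k x i)%:R * 2^-1 ^+ k - x ord0 i) =
    (digits k x i)%:R - 2 ^+ k * (x ord0 i - z ord0 i).
  by rewrite exprVn; field; rewrite gt_eqF.
rewrite exprVn divff ?gt_eqF// distrC ger0_norm ?subr_ge0//.
by move: h2; rewrite -natr1; lra.
Qed.

(** The thresholds [kq * q ^ k] decrease geometrically, but more slowly than the
    standard deviations [q ^ (2 k)] of the increments between a dyadic point of
    level [k] and its parent. Hence the probabilities of excess beat the number of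
    these points, while the thresholds have a finite sum. *)
Let root_event t : set T := [set w | t / 2 <= `|comb G [:: (1, z)] w|].

Variable kq : R.
Variable q : R.

Let step_event t k (j : {ffun 'I_d -> 'I_(2 ^ k.+1)}) : set T :=
  [set w | t * kq * q ^+ k.+1 <=
    `|comb G [:: (1, node k.+1 (fun i => j i)); (-1, node k (half (fun i => j i)))] w|].

Let level_event t k : set T := [set w | exists j, step_event t (k := k) j w].

Definition chain_event t : set T := root_event t `|` \bigcup_k level_event t k.

Let measurable_comb_ge u l : measurable [set w | u <= `|comb G l w|].
Proof.
rewrite -[X in measurable X]setTI; apply: measurable_fun_ler => //.
by apply: measurableT_comp => //; exact: measurable_comb.
Qed.

Lemma measurable_chain_event t : measurable (chain_event t).
Proof.
apply: measurableU; first exact: measurable_comb_ge.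
apply: bigcup_measurable => k _; apply: measurable_exists_fin => j.
exact: measurable_comb_ge.
Qed.

Hypotheses (q01 : 0 < q < 1) (kqE : kq = (1 - q) / 2).

(** Telescoping along the dyadic approximations of [x], whose thresholds add up
    to at most [t / 2]. *)
Lemma chain_event_bound t w : 0 <= t -> ~ chain_event t w ->
  forall x, cube x -> `|G x w| <= t.
Proof.
move=> t0 nE x cx.
have [q0 q1] := andP q01.
have r0 : `|G z w| <= t / 2.
  rewrite leNgt; apply/negP => h; apply: nE; left.
  rewrite /root_event/= /comb big_seq1 mul1r; exact: ltW.
have step k : `|G (node k.+1 (digits k.+1 x)) w - G (node k (digits k x)) w|
    <= t * kq * q ^+ k.+1.
  rewrite leNgt; apply/negP => h; apply: nE; right; exists k => //.
  exists [ffun i => Ordinal (digits_lt k.+1 i cx)].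
  rewrite /step_event/= /comb !big_cons big_nil/= mul1r mulN1r addr0.
  rewrite (_ : (fun i => _) = digits k.+1 x); last by apply/funext => i; rewrite ffunE.
  by rewrite half_digits// ltW.
have tel k : `|G (node k (digits k x)) w| <= t / 2 + t / 2 * (1 - q ^+ k).
  elim: k => [|k IH]; first by rewrite digits0// expr0 subrr mulr0 addr0.
  have := step k; set a := G (node k.+1 _) w.
  set b := G _ _ in IH * => sk; rewrite -(subrK b a).
  apply: (le_trans (ler_normD _ _)); apply: (le_trans (lerD sk IH)).
  rewrite kqE exprS; have tq : 0 <= t * q ^+ k by rewrite mulr_ge0// exprn_ge0// ltW.
  have -> : t * ((1 - q) / 2) * (q * q ^+ k) = (t * q ^+ k) * (q * (1 - q) / 2) by ring.
  have -> : t / 2 + t / 2 * (1 - q * q ^+ k) =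
     (t / 2 + t / 2 * (1 - q ^+ k)) + (t * q ^+ k) * ((1 - q) / 2) by field.
  rewrite addrC lerD2l ler_wpM2l//; nra.
have tel2 k : `|G (node k (digits k x)) w| <= t.
  apply: (le_trans (tel k)).
  have : 0 <= t / 2 * q ^+ k by rewrite mulr_ge0 ?divr_ge0// exprn_ge0// ltW.
  by rewrite mulrBr; lra.
apply/ler_addgt0Pr => e e0.
have cgx : {for x, continuous (fun y => G y w : R)} by exact: pG.
have [de de0 hde] := continuous_eball cgx e0.
pose k := Num.truncn (d%:R / de).
have xk : eball x de (node k (digits k x)).
  rewrite /eball/= (le_lt_trans (node_digits k cx))// exprVn ltr_pdivrMr ?exprn_gt0//.
  rewrite mulrC -ltr_pdivrMr// (lt_le_trans (truncnS_gt _))// -natrX ler_nat.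
  exact: ltn_expl.
have := hde _ xk; set a := G _ _ => h.
rewrite -[G x w](subrK a) addrC (le_trans (ler_normD _ _))// lerD//; first exact: tel2.
by rewrite distrC ltW.
Qed.

Variable K : R.
Hypotheses (K0 : 0 < K) (q4 : q ^+ 4 = 2^-1 `^ alpha)
  (hK : forall x y, comb_var G [:: (1, x); (-1, y)] <= K * enorm (x - y) `^ alpha).

Let D : R := K * (d%:R + 1) `^ alpha.

Let D0 : 0 < D.
Proof. by rewrite mulr_gt0// powR_gt0// ltr_wpDl. Qed.

Let step_variance k j : comb_var G [:: (1, node k.+1 j); (-1, node k (half j))]
  <= D * q ^+ (4 * k.+1).
Proof.
apply: (le_trans (hK _ _)); rewrite /D -mulrA ler_pM2l//.
have -> : q ^+ (4 * k.+1) = (2^-1 ^+ k.+1) `^ alpha.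
  rewrite exprM q4 -powR_mulrn ?powR_ge0// -powRrM (mulrC alpha) powRrM.
  by rewrite powR_mulrn.
rewrite -powRM ?exprn_ge0 ?addr_ge0//.
rewrite ge0_ler_powR ?nnegrE ?enorm_ge0 ?mulr_ge0 ?exprn_ge0 ?addr_ge0 ?(ltW alpha0)//.
by rewrite (le_trans (node_half k j))// ler_wpM2r ?exprn_ge0// lerDl.
Qed.

Let c1 : R := kq ^+ 2 / (2 * D).
Let beta : R := q ^- 2 - 1.

Let kq0 : 0 < kq.
Proof. by case/andP: q01 => _ q1; rewrite kqE divr_gt0// subr_gt0. Qed.

Let c10 : 0 < c1.
Proof. by rewrite /c1 divr_gt0 ?exprn_gt0// mulr_gt0. Qed.

Let beta0 : 0 < beta.
Proof.
case/andP: q01 => q0 q1; rewrite /beta subr_gt0 invf_gt1 ?exprn_gt0//.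
by rewrite exprn_ilt1// ltW.
Qed.

(** A linear growth of the exponents suffices against the [2 ^ (d k)] points of
    level [k]. *)
Let bernoulli k : 1 + k%:R * beta <= q ^- (2 * k).
Proof.
case/andP: q01 => q0 q1; rewrite exprM -exprVn.
have -> : (q ^+ 2)^-1 = 1 + beta by rewrite /beta addrC subrK.
elim: k => [|k IH]; first by rewrite mul0r addr0 expr0.
rewrite exprS -natr1; apply: (@le_trans _ _ ((1 + beta) * (1 + k%:R * beta))).
  have := beta0; have : 0 <= k%:R * beta ^+ 2 by rewrite mulr_ge0 ?sqr_ge0.
  by rewrite expr2; nra.
by rewrite ler_wpM2l// addr_ge0// ltW.
Qed.

Let step_tail t k j : 0 < t -> (P (step_event t (k := k) j) <=
  (2 * (expR (- c1 * t ^+ 2) * expR (- c1 * beta * t ^+ 2) ^+ k.+1))%:E)%E.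
Proof.
move=> t0; case/andP: q01 => q0 q1.
have v0 : 0 < D * q ^+ (4 * k.+1) by rewrite mulr_gt0// exprn_gt0.
have u0 : 0 < t * kq * q ^+ k.+1 by rewrite !mulr_gt0// exprn_gt0.
have := comb_tail gG cG sG v0 (step_variance k (fun i => j i)) u0.
move/le_trans; apply; rewrite lee_fin ler_pM2l// -expRM_natl -expRD ler_expR.
have -> : (t * kq * q ^+ k.+1) ^+ 2 / (2 * (D * q ^+ (4 * k.+1))) =
    c1 * t ^+ 2 * q ^- (2 * k.+1).
  have -> : q ^+ (4 * k.+1) = q ^+ (2 * k.+1) * q ^+ k.+1 ^+ 2.
    by rewrite -exprM -exprD; congr (q ^+ _); rewrite (mulnC _ 2) -mulnDl.
  by rewrite /c1; field; rewrite !gt_eqF ?exprn_gt0.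
have ct : 0 <= c1 * t ^+ 2 by rewrite mulr_ge0 ?sqr_ge0// ltW.
have := ler_wpM2l ct (bernoulli k.+1); set b := _ ^- _; set m := k.+1%:R.
by lra.
Qed.

Let level_tail t k : 0 < t -> 2 ^+ d * expR (- c1 * beta * t ^+ 2) <= 2^-1 ->
  (P (level_event t k) <= (expR (- c1 * t ^+ 2) * 2^-1 ^+ k)%:E)%E.
Proof.
move=> t0 ht.
have := @measure_exists_fin_le _ _ _ P _ _ _
  (fun j => measurable_comb_ge _ _) (fun j => step_tail (k := k) j t0).
move/le_trans; apply; rewrite lee_fin card_ffun !card_ord.
set e := expR (- c1 * t ^+ 2); set f := expR _ in ht *.
have -> : ((2 ^ k.+1) ^ d)%:R * (2 * (e * f ^+ k.+1)) = e * (2 * (2 ^+ d * f) ^+ k.+1).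
  by rewrite -expnM mulnC expnM natrX natrX exprMn; ring.
rewrite ler_wpM2l ?expR_ge0//.
have -> : 2^-1 ^+ k = 2 * 2^-1 ^+ k.+1 :> R by rewrite exprS mulrA divff ?mul1r.
rewrite ler_pM2l// lerXn2r ?nnegrE ?mulr_ge0 ?expR_ge0 ?exprn_ge0//.
Qed.

Let c2 : R := (8 * (C 0 + 1))^-1.

Let root_tail t : 0 < t -> (P (root_event t) <= (2 * expR (- c2 * t ^+ 2))%:E)%E.
Proof.
move=> t0.
have v0 : 0 < C 0 + 1 by rewrite ltr_wpDl.
have := @comb_tail _ _ _ _ _ _ gG cG sG [:: (1, z)] (C 0 + 1) (t / 2) v0.
have -> : comb_var G [:: (1, z)] = C 0.
  by rewrite /comb_var !big_seq1 /= subrr !mul1r.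
rewrite lerDl ler01 divr_gt0// => /(_ isT isT)/le_trans; apply.
rewrite lee_fin ler_pM2l// ler_expR /c2.
rewrite (_ : (t / 2) ^+ 2 / _ = (8 * (C 0 + 1))^-1 * t ^+ 2) ?mulNr//.
by field; rewrite gt_eqF.
Qed.

Lemma chain_event_tail t : 0 < t -> 2 ^+ d * expR (- c1 * beta * t ^+ 2) <= 2^-1 ->
  (P (chain_event t) <= (4 * expR (- minr c1 c2 * t ^+ 2))%:E)%E.
Proof.
move=> t0 ht.
have mlev k : measurable (level_event t k).
  by apply: measurable_exists_fin => j; exact: measurable_comb_ge.
have h1 : (P (\bigcup_k level_event t k) <= (expR (- c1 * t ^+ 2) / (1 - 2^-1))%:E)%E.
  apply: measure_bigcup_geometric => //.
    by apply/andP; split; [rewrite invr_ge0|lra].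
  by move=> k; exact: level_tail.
apply: (le_trans (measureU2 _ _ _)).
- exact: measurable_comb_ge.
- exact: bigcup_measurable.
apply: (le_trans (leeD (root_tail t0) h1)); rewrite -EFinD lee_fin.
have t2 : 0 <= t ^+ 2 by exact: sqr_ge0.
have e1 : expR (- c1 * t ^+ 2) <= expR (- minr c1 c2 * t ^+ 2).
  by rewrite ler_expR !mulNr lerN2 ler_wpM2r// ge_min lexx.
have e2 : expR (- c2 * t ^+ 2) <= expR (- minr c1 c2 * t ^+ 2).
  by rewrite ler_expR !mulNr lerN2 ler_wpM2r// ge_min lexx orbT.
have -> : expR (- c1 * t ^+ 2) / (1 - 2^-1) = 2 * expR (- c1 * t ^+ 2) by field.
by move: e1 e2; lra.
Qed.

End cube.

(** Gaussian tails of the supremum over a unit cube, uniformly in the cube. *)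
Theorem sup_cube_tail : exists K c : R, [/\ 0 < K, 0 < c &
  forall z t, 0 <= t -> exists E : set T,
  [/\ measurable E, (P E <= (K * expR (- c * t ^+ 2))%:E)%E &
   forall w, ~ E w -> forall x,
     (forall i, z ord0 i <= x ord0 i < z ord0 i + 1) -> `|G x w| <= t]].
Proof.
have [K K0 hK] := increment_variance_le.
pose q : R := 2^-1 `^ (alpha / 4).
have q0 : 0 < q by rewrite powR_gt0.
have q4 : q ^+ 4 = 2^-1 `^ alpha.
  by rewrite /q -powR_mulrn ?powR_ge0// -powRrM divfK.
have q1 : q < 1.
  rewrite (_ : 1 = 1 `^ (alpha / 4)); last by rewrite powR1.
  rewrite gt0_ltr_powR ?divr_gt0 ?nnegrE//.
  by rewrite invf_lt1// ltr1n.
have q01 : 0 < q < 1 by rewrite q0.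
pose kq := (1 - q) / 2.
pose c1 : R := kq ^+ 2 / (2 * (K * (d%:R + 1) `^ alpha)).
pose beta : R := q ^- 2 - 1.
pose c2 : R := (8 * (C 0 + 1))^-1.
have kq0 : 0 < kq by rewrite divr_gt0// subr_gt0.
have c10 : 0 < c1.
  by rewrite divr_gt0 ?exprn_gt0// mulr_gt0// mulr_gt0// powR_gt0// ltr_wpDl.
have beta0 : 0 < beta by rewrite subr_gt0 invf_gt1 ?exprn_gt0// exprn_ilt1// ltW.
have c20 : 0 < c2 by rewrite invr_gt0 mulr_gt0// ltr_wpDl.
pose c := minr c1 c2.
have c0 : 0 < c by rewrite lt_min c10.
(* beyond [T0] the exponential wins against the number of pairs of nodes *)
pose T0 : R := ln (2 ^+ d.+1) / (c1 * beta).
have cb0 : 0 < c1 * beta by rewrite mulr_gt0.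
exists (4 + expR (c * T0)), c; split => //.
move=> z t t0; have [tT|tT] := ltP (t ^+ 2) T0.
  exists setT; split => [//||w /(_ I)//].
  rewrite probability_setT lee_fin mulrDl.
  rewrite (@le_trans _ _ (expR (c * T0) * expR (- c * t ^+ 2)))//.
    by rewrite -expRD -expR0 ler_expR mulNr subr_ge0 ler_wpM2l// ltW.
  by rewrite lerDr mulr_ge0// expR_ge0.
have T00 : 0 < T0 by rewrite divr_gt0// ln_gt0// exprn_egt1// ltr1n.
have t_gt0 : 0 < t.
  rewrite lt_neqAle t0 andbT; apply/eqP => tE; move: tT.
  by rewrite -tE expr0n/= leNgt T00.
have ht : 2 ^+ d * expR (- c1 * beta * t ^+ 2) <= 2^-1.
  have : expR (- c1 * beta * t ^+ 2) <= (2 ^+ d.+1)^-1.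
    rewrite -[X in X^-1]lnK ?posrE ?exprn_gt0// -expRN ler_expR mulNr mulNr lerN2.
    by rewrite mulrC -ler_pdivrMr.
  have p0 : 0 < 2 ^+ d :> R by rewrite exprn_gt0.
  rewrite -(ler_pM2l p0) => /le_trans; apply.
  by rewrite exprS invfM mulrCA divff ?mulr1// gt_eqF.
exists (chain_event z kq q t); split.
- exact: measurable_chain_event.
- apply: (le_trans (chain_event_tail z q01 erefl K0 q4 hK t_gt0 ht)).
  by rewrite lee_fin ler_wpM2r ?expR_ge0// lerDl expR_ge0.
- by move=> w nE x cx; exact: (chain_event_bound q01 erefl t0 nE cx).
Qed.

End chaining.

(** * Suprema over large balls *)

Section sup_over_balls.
Context {disp : measure_display} {T : measurableType disp} {R : realType}.
Context {P : probability T R} {d : nat}.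
Variable G : 'rV[R]_d -> {RV P >-> R}.
Hypotheses (gG : gaussian_field G) (cG : centered_field G)
  (sG : stationary_field G) (pG : continuous_paths G).
Local Notation C := (covariance_fun G).
Variable alpha : R.
Hypotheses (alpha0 : 0 < alpha) (hC : holder_at0 C alpha).

(** A ball of radius [rho] is covered by at most [(4 * rho) ^ d] unit cubes. *)
Lemma sup_ball_tail : exists K c : R, [/\ 0 < K, 0 < c &
  forall rho t, 1 <= rho -> 0 <= t -> exists E : set T,
  [/\ measurable E,
   (P E <= ((4 * rho) ^+ d * (K * expR (- c * t ^+ 2)))%:E)%E &
   forall w, ~ E w -> forall x, eball 0 rho x -> `|G x w| <= t]].
Proof.
have [K [c [K0 c0 h]]] := sup_cube_tail gG cG sG pG alpha0 hC.
exists K, c; split => // rho t rho1 t0.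
pose N := (Num.truncn rho).+1.
have rN : rho < N%:R by exact: truncnS_gt.
have N2 : N%:R <= 2 * rho.
  have : (Num.truncn rho)%:R <= rho by rewrite truncn_le (le_trans ler01).
  by rewrite /N -natr1; lra.
pose base (j : {ffun 'I_d -> 'I_(2 * N)}) : 'rV[R]_d := \row_i ((j i)%:R - N%:R).
have /choice[E hE] : forall j, exists E : set T,
    [/\ measurable E, (P E <= (K * expR (- c * t ^+ 2))%:E)%E &
     forall w, ~ E w -> forall x : 'rV[R]_d,
     (forall i, base j ord0 i <= x ord0 i < base j ord0 i + 1) -> `|G x w| <= t].
  by move=> j; exact: h.
have mE j : measurable (E j) by case: (hE j).
exists [set w | exists j, E j w]; split.
- exact: measurable_exists_fin.
- have PE j : (P (E j) <= (K * expR (- c * t ^+ 2))%:E)%E by case: (hE j).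
  apply: (le_trans (measure_exists_fin_le mE PE)); rewrite lee_fin.
  rewrite ler_wpM2r ?mulr_ge0 ?expR_ge0 ?(ltW K0)//.
  rewrite card_ffun !card_ord natrX lerXn2r ?nnegrE ?mulr_ge0//; first exact: le_trans rho1.
  by rewrite natrM; lra.
- move=> w nE x xr.
  have xi i : - N%:R < x ord0 i < N%:R.
    have := le_lt_trans (coord_le_enorm (x - 0) i) xr.
    by rewrite subr0 ltr_norml => /andP[]; lra.
  have dg i : (Num.truncn (x ord0 i + N%:R) < 2 * N)%N.
    have /andP[h1 h2] := xi i.
    by rewrite truncn_lt_nat ?natrM; lra.
  pose j : {ffun 'I_d -> 'I_(2 * N)} := [ffun i => Ordinal (dg i)].
  have [_ _] := hE j; apply; first by move=> Ej; apply: nE; exists j.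
  move=> i; rewrite !mxE ffunE /=.
  have /andP[h1 h2] := xi i.
  have /truncn_itv : 0 <= x ord0 i + N%:R by lra.
  by rewrite -natr1 => /andP[]; lra.
Qed.

(** With the threshold [(n + eps * ln rho) / 2] for the field, the prefactor
    [rho ^ (- eps)] removes [rho] from the bound on the random variable, and the
    Gaussian decay in [eps * ln rho] absorbs the number of cubes. *)
Lemma r_club_moment (eps : R) : 0 < eps ->
  exists C0 : R, 0 < C0 /\
    (ereal_sup [set exp_log2_moment P C0 (r_club (lognormal G) eps rho) |
                rho in [set rho : R | (1 <= rho)%R]] <= 2%:E)%E.
Proof.
move=> e0.
have [K [c [K0 c0 hE]]] := sup_ball_tail.
pose c' : R := c * eps ^+ 2 / 4.
have c'0 : 0 < c' by rewrite divr_gt0// mulr_gt0// exprn_gt0.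
pose U : R := d%:R ^+ 2 / (4 * c').
pose K' : R := 4 ^+ d * K * expR U.
have K'0 : 0 < K' by rewrite !mulr_gt0 ?exprn_gt0// expR_gt0.
have c40 : 0 < c / 4 by rewrite divr_gt0.
have l50 : 0 <= ln 5 :> R by rewrite ln_ge0// ler1n.
have [C0 [C00 hC0]] := exp_square_moment_of_tails K'0 c40 ler01 l50.
exists C0; split => //; apply: ge_ereal_sup => _ [rho /= rho1 <-].
rewrite /exp_log2_moment unlock /=.
have rho0 : 0 < rho by exact: lt_le_trans rho1.
pose l := ln rho; have l0 : 0 <= l by rewrite ln_ge0.
have rhoE : rho = expR l by rewrite lnK.
pose t (n : nat) : R := (n%:R + eps * l) / 2.
have t0 n : 0 <= t n by rewrite divr_ge0// addr_ge0// mulr_ge0// ltW.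
have /choice[E {}hE] := fun n => hE rho (t n) rho1 (t0 n).
have S_ge0 w : 0 <= sup [set lognormal G y w + (lognormal G y w)^-1 | y in eball 0 rho].
  set A := [set _ | _ in _].
  have [hs|/sup_out->//] := pselect (has_sup A).
  have [x Ax] := hs.1; apply: le_trans (ub_le_sup hs.2 Ax).
  by have [y _ <-] := Ax; rewrite addr_ge0 ?invr_ge0 ?expR_ge0.
apply: (hC0 _ _ P (fun w => ln (1 + r_club (lognormal G) eps rho w)) E) => //.
- by move=> w; rewrite ln_ge0// lerDl sqr_ge0.
- by move=> n; case: (hE n).
- move=> n; have [_ + _] := hE n; move/le_trans; apply; rewrite lee_fin.
  rewrite exprMn -!mulrA ler_wpM2l ?exprn_ge0// mulrCA ler_wpM2l ?(ltW K0)//.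
  rewrite rhoE -expRM_natl -!expRD ler_expR /t /c'.
  have key : d%:R * l <= U + c' * l ^+ 2.
    rewrite -subr_ge0 /U.
    have -> : d%:R ^+ 2 / (4 * c') + c' * l ^+ 2 - d%:R * l =
        c' * (d%:R / (2 * c') - l) ^+ 2.
      by field; rewrite gt_eqF.
    by rewrite mulr_ge0 ?sqr_ge0// ltW.
  have cr : 0 <= c * n%:R * eps * l by rewrite !mulr_ge0// ltW.
  move: key; set v := d%:R * l => key.
  have -> : - c * ((n%:R + eps * l) / 2) ^+ 2 =
    - (c / 4) * n%:R ^+ 2 - c' * l ^+ 2 - c * n%:R * eps * l / 2.
    by rewrite /c'; field.
  by move: key cr; rewrite !mulNr; set a := c' * l ^+ 2; set b := _ * n%:R ^+ 2; lra.
- move=> n w nE; have [_ _ /(_ w nE) hb] := hE n.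
  have e1 : 1 <= expR (n%:R) :> R by rewrite -expR0 ler_expR.
  have S2 : sup [set lognormal G y w + (lognormal G y w)^-1 | y in eball 0 rho]
      <= 2 * expR (t n).
    apply: ge_sup.
      exists (lognormal G 0 w + (lognormal G 0 w)^-1); exists 0 => //.
      by rewrite /eball/= subrr enorm0.
    move=> _ [y /hb yr <-]; rewrite /lognormal -expRN.
    move: yr; rewrite ler_norml => /andP[h1 h2].
    have : expR (G y w) <= expR (t n) by rewrite ler_expR.
    have : expR (- G y w) <= expR (t n) by rewrite ler_expR; lra.
    by lra.
  have rc : r_club (lognormal G) eps rho w <= 4 * expR n%:R.
    rewrite /r_club.
    apply: (@le_trans _ _ ((rho `^ (- (eps / 2)) * (2 * expR (t n))) ^+ 2)).
      rewrite lerXn2r ?nnegrE ?mulr_ge0 ?powR_ge0 ?expR_ge0//.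
      by rewrite ler_wpM2l ?powR_ge0.
    rewrite /powR gt_eqF// -/l mulrCA -expRD exprMn -expRM_natl.
    have -> : 2%:R * (- (eps / 2) * l + t n) = n%:R by rewrite /t; field.
    by rewrite (_ : 2 ^+ 2 = 4)//; ring.
  have -> : 1 * n%:R + ln 5 = ln (5 * expR n%:R) :> R.
    by rewrite lnM ?posrE ?expR_gt0// expRK mul1r addrC.
  rewrite ler_ln ?posrE ?mulr_gt0 ?expR_gt0//.
    by move: rc e1; lra.
  by rewrite ltr_pwDl// sqr_ge0.
Qed.

End sup_over_balls.

(** * The minimal radius of a family of bad balls *)

Section minimal_radius.
Context {R : realType} {d : nat}.
Implicit Types (B : 'rV[R]_d -> R -> Prop) (x y z : 'rV[R]_d) (r t : R).
Local Open Scope ereal_scope.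

(** The largest value at [x] of the cones of slope [1/8] that start from the
    radii [r] of the exceptional balls [B y r]. *)
Definition overshoot B x : \bar R := ereal_sup [set u |
  u = 0 \/ exists y r, B y r /\ u = (r - 8^-1 * enorm (x - y))%:E].

(** The junk value [fine +oo = 0] keeps this radius real and Lipschitz when the
    exceptional radii are unbounded. *)
Definition minimal_radius B x : R := (1 + fine (overshoot B x))%R.

Lemma overshoot_ge0 B x : 0 <= overshoot B x.
Proof. by apply: ereal_sup_ubound; left. Qed.

Lemma overshoot_ge B x y r : B y r -> (r - 8^-1 * enorm (x - y))%:E <= overshoot B x.
Proof. by move=> Byr; apply: ereal_sup_ubound; right; exists y, r. Qed.

Lemma overshoot_le B x t : (0 <= t)%R ->
  (forall y r, B y r -> (r - 8^-1 * enorm (x - y) <= t)%R) ->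
  overshoot B x <= t%:E.
Proof.
move=> t0 h; apply: ge_ereal_sup => _ [->|[y [r [Byr ->]]]]; first by rewrite lee_fin.
by rewrite lee_fin; exact: h.
Qed.

Lemma overshoot_Lipschitz B x y :
  overshoot B x <= overshoot B y + (8^-1 * enorm (x - y))%:E.
Proof.
have e0 : (0 <= 8^-1 * enorm (x - y))%R by rewrite mulr_ge0 ?enorm_ge0.
apply: ge_ereal_sup => _ [->|[v [r [Bvr ->]]]].
  by rewrite adde_ge0 ?overshoot_ge0// lee_fin.
apply: le_trans (leeD (overshoot_ge y Bvr) (lexx _)).
rewrite -EFinD lee_fin.
have := enorm_triangle y x v; rewrite (enormB_sym y x); lra.
Qed.

Lemma overshoot_fin B x y : overshoot B x \is a fin_num -> overshoot B y \is a fin_num.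
Proof.
rewrite !ge0_fin_numE ?overshoot_ge0// => h.
by rewrite (le_lt_trans (overshoot_Lipschitz B y x))// lte_add_pinfty// ltry.
Qed.

Lemma minimal_radius_ge1 B x : (1 <= minimal_radius B x)%R.
Proof. by rewrite lerDl fine_ge0// overshoot_ge0. Qed.

Lemma minimal_radius_Lipschitz B x y :
  (`|minimal_radius B x - minimal_radius B y| <= 8^-1 * enorm (x - y))%R.
Proof.
have e0 : (0 <= 8^-1 * enorm (x - y))%R by rewrite mulr_ge0 ?enorm_ge0.
rewrite /minimal_radius opprD addrACA subrr add0r.
have [fx|nfx] := boolP (overshoot B x \is a fin_num).
  have fy := overshoot_fin y fx.
  have := overshoot_Lipschitz B x y; have := overshoot_Lipschitz B y x.
  rewrite (enormB_sym y x) -(fineK fx) -(fineK fy) -!EFinD !lee_fin ler_norml.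
  by move=> h1 h2; apply/andP; split; lra.
have nfy : overshoot B y \isn't a fin_num.
  by apply: contra nfx; exact: overshoot_fin.
have inf u : 0 <= u -> u \isn't a fin_num -> fine u = 0%R by case: u.
by rewrite !inf ?overshoot_ge0// subrr normr0.
Qed.

Lemma minimal_radius_good B x r : overshoot B 0 \is a fin_num ->
  (minimal_radius B x <= r)%R -> ~ B x r.
Proof.
move=> /(overshoot_fin x) fx + Bxr; rewrite /minimal_radius.
have := overshoot_ge x Bxr; rewrite subrr enorm0 mulr0 subr0.
by rewrite -(fineK fx) lee_fin; lra.
Qed.

Lemma minimal_radius_shift B x z :
  minimal_radius B (x + z) = minimal_radius (fun y => B (y + z)%R) x.
Proof.
rewrite /minimal_radius /overshoot; congr (1 + fine (ereal_sup _))%R.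
apply/seteqP; split => u [->|[y [r [Byr ->]]]]; try by left.
- right; exists (y - z)%R, r; rewrite subrK; split => //.
  by congr (_ - _ * enorm _)%:E; rewrite opprB addrA.
- right; exists (y + z)%R, r; split => //.
  by congr (_ - _ * enorm _)%:E; rewrite opprD addrACA subrr addr0.
Qed.

End minimal_radius.

Section measurable_minimal_radius.
Context {R : realType} {n : nat} d (T : measurableType d).
Variable B : T -> 'rV[R]_n -> R -> Prop.
Hypothesis mB : forall y r, measurable [set w | B w y r].
Hypothesis openB : forall w y r, B w y r -> exists2 e : R, 0 < e &
  forall y' r', enorm (y' - y) < e -> `|r' - r| < e -> B w y' r'.
Local Open Scope ereal_scope.

Let node (q : 'rV[rat]_n * rat) : 'rV[R]_n * R := (map_mx ratr q.1, ratr q.2).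

Let value x (p : 'rV[R]_n * R) : R := (p.2 - 8^-1 * enorm (x - p.1))%R.

Let rat_near (a e : R) : (0 < e)%R -> exists q : rat, (`|ratr q - a| < e)%R.
Proof.
move=> e0; have [q] := @rat_in_itvoo R (a - e) (a + e) ltac:(by rewrite ltrD2l gtrN).
rewrite in_itv/= => /andP[h1 h2]; exists q.
by rewrite ltr_norml; apply/andP; split; lra.
Qed.

(** As the exceptional set is open, rational centers and radii determine the
    overshoot. *)
Let overshoot_gt_rat w x (c : \bar R) : 0 <= c -> c < overshoot (B w) x ->
  exists q, B w (node q).1 (node q).2 /\ c < (value x (node q))%:E.
Proof.
move=> c0 /ereal_sup_gt[_ [->|[y [r [Byr ->]]]]].
  by rewrite ltNge c0.
case: c c0 => // c c0; rewrite lte_fin => cv; have [e e0 he] := openB Byr.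
pose v := (r - 8^-1 * enorm (x - y))%R.
pose e1 := Num.min e ((v - c) / 2)%R.
have e10 : (0 < e1)%R by rewrite lt_min e0 divr_gt0// subr_gt0.
have e2 : (0 < e1 / n.+1%:R)%R by rewrite divr_gt0.
have [q1 hq1] := rat_near r e10.
have /choice[f hf] : forall i : 'I_n, exists q : rat,
    (`|ratr q - y ord0 i| < e1 / n.+1%:R)%R by move=> i; exact: rat_near.
pose y' : 'rV[R]_n := map_mx ratr (\row_i f i).
exists (\row_i f i, q1); rewrite /node /= -/y'.
have yy : (enorm (y' - y) < e1)%R.
  apply: (@le_lt_trans _ _ (n%:R * (e1 / n.+1%:R))%R).
    by apply: enorm_le_coord => [|i]; rewrite ?mxE; exact: ltW.
  by rewrite mulrCA gtr_pMr// ltr_pdivrMr// mul1r ltr_nat.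
split.
  apply: he => /=; first by rewrite (lt_le_trans yy)// ge_min lexx.
  by rewrite (lt_le_trans hq1)// ge_min lexx.
rewrite lte_fin /value/=.
have := enorm_triangle x y y'; rewrite (enormB_sym y y').
have : (e1 <= (v - c) / 2)%R by rewrite ge_min lexx orbT.
move: hq1 yy; rewrite ltr_norml /v -/y' => /andP[]; lra.
Qed.

Lemma measurable_minimal_radius x :
  measurable_fun [set: T] (fun w => minimal_radius (B w) x).
Proof.
apply: measurable_funD => //.
apply: measurableT_comp => //.
apply: (measurability _ (ErealGenOInfty.measurableE R)).
move=> _ [_ [c ->] <-]; rewrite setTI.
have [c0|c0] := ltP c 0%R.
  rewrite (_ : _ @^-1` _ = setT) //; apply/seteqP; split => // w _ /=.
  rewrite in_itv/= andbT (lt_le_trans _ (overshoot_ge0 _ _))//.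
have -> : (fun w => overshoot (B w) x) @^-1` `]c%:E, +oo[ =
   \bigcup_q [set w | (c < value x (node q))%R /\ B w (node q).1 (node q).2].
  apply/seteqP; split => w /=.
    rewrite in_itv/= andbT => /(overshoot_gt_rat _)[|q [Bq cq]]; first by rewrite lee_fin.
    by exists q => //; split => //; rewrite -lte_fin.
  move=> [q _ [cq Bq]]; rewrite in_itv/= andbT.
  by apply: lt_le_trans (overshoot_ge x Bq); rewrite lte_fin.
apply: countable_bigcupT_measurable => // q.
have [cq|cq] := boolP (c < value x (node q))%R.
  rewrite (_ : [set w | _] = [set w | B w (node q).1 (node q).2]); first exact: mB.
  by apply/seteqP; split => w /= => [[]|].
by rewrite (_ : [set w | _] = set0)//; apply/seteqP; split => // w [].
Qed.

End measurable_minimal_radius.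

(** * Bad balls of a field *)

Section bad_balls.
Context {R : realType} {n : nat}.
Implicit Types (F : 'rV[R]_n -> R) (x y z : 'rV[R]_n) (r : R).

(** The balls whose mass is not comparable to their volume. *)
Definition bad_ball (lo hi : R) F y r : Prop :=
  0 < r /\ (ball_mass F y r < lo * r ^+ n \/ hi * r ^+ n < ball_mass F y r).

Let poly_near (f : R -> R) : continuous f -> 0 < f 0 -> forall e0 : R, 0 < e0 ->
  exists2 e, 0 < e < e0 & 0 < f e.
Proof.
move=> cf f0 e0 e00.
have /nbhs_ballP[de /= de0 h] : nbhs (0 : R) (f @^-1` `]0, +oo[%classic).
  apply: (cf 0); apply: open_nbhs_nbhs; split; first exact: interval_open.
  by rewrite /= in_itv/= f0.
pose e := minr de e0 / 2.
have m0 : 0 < minr de e0 by rewrite lt_min de0.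
have ed : e < minr de e0 by rewrite /e ltr_pdivrMr// ltr_pMr// ltr1n.
exists e; first by rewrite divr_gt0//= (lt_le_trans ed)// ge_min lexx orbT.
have /h : ball 0 de e.
  rewrite /ball/= sub0r normrN gtr0_norm ?divr_gt0//.
  by rewrite (lt_le_trans ed)// ge_min lexx.
by rewrite /= in_itv/= andbT.
Qed.

(** Moving a ball by [e] changes its mass at most as much as changing its radius
    by [2 * e]. *)
Lemma bad_ball_open lo hi F y r : 0 <= lo -> 0 <= hi ->
  continuous F -> (forall z, 0 <= F z) -> bad_ball lo hi F y r ->
  exists2 e : R, 0 < e & forall y' r', enorm (y' - y) < e -> `|r' - r| < e ->
    bad_ball lo hi F y' r'.
Proof.
move=> lo0 hi0 cF F0 [r0 Br].
have [S S0 hS] := ball_mass_growth cF F0 y (2 * r).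
have r40 : 0 < r / 4 by rewrite divr_gt0.
have cX (a b : R) : continuous (fun e : R => a * (r + b * e) ^+ n).
  have cb : continuous (fun e : R => r + b * e).
    move=> e; apply: cvgD; first exact: cvg_cst.
    by apply: cvgM; [exact: cvg_cst|exact: cvg_id].
  move=> e; apply: cvgM; first exact: cvg_cst.
  exact: (continuous_comp (cb e) (@exprn_continuous _ n _)).
have [e /andP[e0 e4] he] : exists2 e, 0 < e < r / 4 &
   (ball_mass F y r + S * ((r + 2 * e) ^+ n - r ^+ n) < lo * (r - e) ^+ n) \/
   (hi * (r + e) ^+ n < ball_mass F y r - S * (r ^+ n - (r - 2 * e) ^+ n)).
  case: Br => Br.
  - pose f e := lo * (r + (-1) * e) ^+ n - S * (r + 2 * e) ^+ n
      - (ball_mass F y r - S * r ^+ n).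
    have [||e he fe] := @poly_near f _ _ _ r40.
    + move=> e; apply: cvgB; last exact: cvg_cst.
      by apply: cvgB; exact: cX.
    + by rewrite /f !mulr0 !addr0; lra.
    + by exists e => //; left; move: fe; rewrite /f mulN1r mulrBr; lra.
  - pose f e := S * (r + (-2) * e) ^+ n - hi * (r + 1 * e) ^+ n
      + (ball_mass F y r - S * r ^+ n).
    have [||e he fe] := @poly_near f _ _ _ r40.
    + move=> e; apply: cvgD; last exact: cvg_cst.
      by apply: cvgB; exact: cX.
    + by rewrite /f !mulr0 !addr0; lra.
    + by exists e => //; right; move: fe; rewrite /f mulNr mul1r mulrBr; lra.
exists e => // y' r' yy; rewrite ltr_norml => /andP[re1 re2].
have r'0 : 0 < r' by lra.
split => //; case: he => he; [left|right].
- have h1 : ball_mass F y' r' <= ball_mass F y (r + 2 * e).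
    by apply: ball_mass_subset => //; lra.
  have h2 : ball_mass F y (r + 2 * e) <=
      ball_mass F y r + S * ((r + 2 * e) ^+ n - r ^+ n) by apply: hS => //; lra.
  have h3 : lo * (r - e) ^+ n <= lo * r' ^+ n.
    by rewrite ler_wpM2l// lerXn2r ?nnegrE; lra.
  by move: (le_trans h1 h2) h3 he; lra.
- have h1 : ball_mass F y (r - 2 * e) <= ball_mass F y' r'.
    by apply: ball_mass_subset => //; rewrite enormB_sym; lra.
  have h2 : ball_mass F y r <=
      ball_mass F y (r - 2 * e) + S * (r ^+ n - (r - 2 * e) ^+ n).
    by apply: hS => //; lra.
  have h3 : hi * r' ^+ n <= hi * (r + e) ^+ n.
    by rewrite ler_wpM2l// lerXn2r ?nnegrE; lra.
  by move: h1 h2 h3 he; lra.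
Qed.

End bad_balls.

Section measurable_bad_ball.
Context {R : realType} {n : nat} d (T : measurableType d).
Variable F : 'rV[R]_n -> T -> R.
Hypothesis mF : forall z, measurable_fun setT (F z).
Hypothesis cF : forall w, continuous (F ^~ w).
Hypothesis F0 : forall z w, 0 <= F z w.

Lemma measurable_bad_ball lo hi y r :
  measurable [set w | bad_ball lo hi (F ^~ w) y r].
Proof.
have [r0|r0] := ltP 0 r; last first.
  rewrite (_ : mkset _ = set0)//; apply/seteqP; split => // w [+ _].
  by rewrite ltNge r0.
have mm := measurable_ball_mass mF cF F0 y r.
rewrite (_ : mkset _ = [set w | ball_mass (F^~ w) y r < lo * r ^+ n] `|`
   [set w | hi * r ^+ n < ball_mass (F^~ w) y r]).
  apply: measurableU; rewrite -[X in measurable X]setTI.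
    exact: measurable_fun_ltr.
  exact: measurable_fun_ltr.
by apply/seteqP; split => w /= => [[]|].
Qed.

End measurable_bad_ball.

(** * Stationarity through the law of the paths *)

Section radius_of_paths.
Context {R : realType} {n : nat}.
Variables (p : nat) (lo hi : R).
Hypotheses (lo0 : 0 <= lo) (hi0 : 0 <= hi).
Implicit Types (g : 'rV[R]_n -> R) (x y z : 'rV[R]_n).

Definition path_moment g z : R := sum_pow_inv p (expR (g z)).

Definition path_radius g x : R := minimal_radius (bad_ball lo hi (path_moment g)) x.

Lemma sum_pow_invE (u : R) :
  sum_pow_inv p (expR u) = expR (p%:R * u) + expR (- p%:R * u).
Proof. by rewrite /sum_pow_inv mulNr expRN expRM_natl. Qed.

Lemma path_moment_ge0 g z : 0 <= path_moment g z.
Proof. by rewrite /path_moment sum_pow_invE addr_ge0 ?expR_ge0. Qed.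

Lemma continuous_path_moment g : continuous g -> continuous (path_moment g).
Proof.
move=> cg; have -> : path_moment g = (fun z => expR (p%:R * g z) + expR (- p%:R * g z)).
  by apply/funext => z; rewrite /path_moment sum_pow_invE.
have c (s : R) := @continuous_expRM _ _ s _ cg.
by move=> z; exact: (continuousD (c p%:R z) (c (- p%:R) z)).
Qed.

Lemma path_radius_shift g x z : continuous g ->
  path_radius g (x + z) = path_radius (fun y => g (y + z)) x.
Proof.
move=> cg; rewrite /path_radius; etransitivity; first exact: minimal_radius_shift.
have -> : (fun y => bad_ball lo hi (path_moment g) (y + z)) =
    bad_ball lo hi (path_moment (fun y => g (y + z))).
  apply/funext => y; apply/funext => r; rewrite /bad_ball ball_mass_shift//.
    exact: continuous_path_moment.
  exact: path_moment_ge0.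
by [].
Qed.

Lemma measurable_path_radius d (T : measurableType d) (g : 'rV[R]_n -> T -> R) x :
  (forall z, measurable_fun setT (g z)) -> (forall w, continuous (g ^~ w)) ->
  measurable_fun setT (fun w => path_radius (g ^~ w) x).
Proof.
move=> mg cg; rewrite /path_radius.
have cF w : continuous (path_moment (g ^~ w)) by exact: continuous_path_moment.
apply: (@measurable_minimal_radius _ _ _ _
  (fun w => bad_ball lo hi (path_moment (g ^~ w)))).
- move=> y r.
  apply: (@measurable_bad_ball _ _ _ _ (fun z w => path_moment (g ^~ w) z)) => //.
    move=> z; rewrite /path_moment; under eq_fun do rewrite sum_pow_invE.
    by apply: measurable_funD; apply: measurableT_comp => //; exact: measurable_funM.
  by move=> z w; exact: path_moment_ge0.
- by move=> w y r; apply: bad_ball_open => // z; exact: path_moment_ge0.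
Qed.

End radius_of_paths.

(** The space of paths carries the law of a continuous field, so that functionals
    of the field inherit its stationarity. *)
Record path (R : realType) (n : nat) : Type := Path {
  path_fun :> 'rV[R]_n -> R;
  continuous_path : continuous path_fun }.

Section path_space.
Context {R : realType} {n : nat}.
Local Notation path := (path R n).

HB.instance Definition _ := gen_eqMixin path.
HB.instance Definition _ := gen_choiceMixin path.

Let cst_path_continuous : continuous (fun _ : 'rV[R]_n => 0 : R).
Proof. by move=> x; exact: cst_continuous. Qed.

Let cst_path : path := Path cst_path_continuous.

HB.instance Definition _ := isPointed.Build path cst_path.

Definition cylinder : set (set path) := [set S |
  exists k (x : 'I_k -> 'rV[R]_n) (A : set 'rV[R]_k),
    measurable A /\ S = [set g : path | A (\row_i g (x i))]].

Definition path_space := g_sigma_algebraType cylinder.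

Lemma cylinder_setI : setI_closed cylinder.
Proof.
move=> _ _ [k [x [A [mA ->]]]] [l [y [B [mB ->]]]].
exists (k + l)%N, (fun i => match fintype.split i with inl j => x j | inr j => y j end).
exists [set v | A (\row_i v ord0 (lshift l i)) /\ B (\row_i v ord0 (rshift k i))].
have mrow m m' (f : 'I_m' -> 'I_m) (D : set 'rV[R]_m') : measurable D ->
    measurable [set v : 'rV[R]_m | D (\row_i v ord0 (f i))].
  move=> mD; rewrite -[X in measurable X]setTI.
  have mf : measurable_fun setT (fun v : 'rV[R]_m => \row_i v ord0 (f i)).
    apply/measurable_fun_rVP => i; under eq_fun do rewrite mxE.
    exact: measurable_rV_coord.
  exact: mf.
split; first by apply: measurableI; exact: mrow.
apply/seteqP; split => g /=.
  move=> [Ag Bg]; split.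
  - by congr A : Ag; apply/rowP => i; rewrite !mxE (unsplitK (inl i)).
  - by congr B : Bg; apply/rowP => i; rewrite !mxE (unsplitK (inr i)).
move=> [Ag Bg]; split.
- by congr A : Ag; apply/rowP => i; rewrite !mxE (unsplitK (inl i)).
- by congr B : Bg; apply/rowP => i; rewrite !mxE (unsplitK (inr i)).
Qed.

Lemma measurable_evaluation z : measurable_fun setT (fun g : path_space => (g : path) z).
Proof.
move=> _ Y mY; rewrite setTI; apply: sub_sigma_algebra.
exists 1%N, (fun=> z), [set v | Y (v ord0 ord0)]; split.
  rewrite -[X in measurable X]setTI.
  by have := @measurable_rV_coord R 1 ord0; apply.
by apply/seteqP; split => g /=; rewrite mxE.
Qed.

End path_space.

Section path_law.
Context {disp : measure_display} {T : measurableType disp} {R : realType}.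
Context {P : probability T R} {n : nat}.

Lemma measurable_path_map (g : 'rV[R]_n -> T -> R) (cg : forall w, continuous (g ^~ w)) :
  (forall z, measurable_fun setT (g z)) ->
  measurable_fun setT (fun w => Path (cg w) : @path_space R n).
Proof.
move=> mg; apply: (measurability _ (erefl (@cylinder R n).-sigma.-measurable)).
move=> _ [_ [k [x [A [mA ->]]]] <-]; rewrite setTI.
have mf : measurable_fun setT (fun w => \row_i g (x i) w).
  by apply/measurable_fun_rVP => i; under eq_fun do rewrite mxE; exact: mg.
by rewrite -[X in measurable X]setTI; exact: mf.
Qed.

(** A translate of a stationary field has the same law on the space of paths,
    because the cylinders generate its sigma-algebra. *)
Lemma stationary_path_functional (G : 'rV[R]_n -> {RV P >-> R})
    (X : 'rV[R]_n -> {RV P >-> R}) (phi : ('rV[R]_n -> R) -> 'rV[R]_n -> R) :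
  stationary_field G -> continuous_paths G ->
  (forall x w, X x w = phi (fun z => G z w) x) ->
  (forall x, measurable_fun setT (fun g : @path_space R n => phi (g : path R n) x)) ->
  (forall g x z, continuous g -> phi g (x + z) = phi (fun y => g (y + z)) x) ->
  stationary_field X.
Proof.
move=> sG pG Xphi mphi shift k x z A mA.
pose S : set (@path_space R n) := [set g | A (\row_i phi (g : path R n) (x i))].
have mS : measurable S.
  have mf : measurable_fun setT
      (fun g : @path_space R n => \row_i phi (g : path R n) (x i)).
    by apply/measurable_fun_rVP => i; under eq_fun do rewrite mxE; exact: mphi.
  by rewrite -[X in measurable X]setTI; exact: mf.
have cg w : continuous (fun y => G y w : R) by exact: pG.
have cgz w : continuous (fun y : 'rV[R]_n => G (y + z) w : R).
  move=> y; apply: (@continuous_comp _ _ _ (fun y : 'rV[R]_n => y + z) (fun y => G y w : R)).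
    by apply: continuousD; [exact: cvg_id|exact: cst_continuous].
  exact: pG.
have m1 := @measurable_path_map (fun y w => G y w) cg (fun y => measurable_funPT (G y)).
have m2 := @measurable_path_map (fun y w => G (y + z) w) cgz
  (fun y => measurable_funPT (G (y + z))).
have -> : [set w | A (\row_i X (x i + z) w)] =
    (fun w => Path (cgz w) : @path_space R n) @^-1` S.
  apply/seteqP; split => w /=; congr A; apply/rowP => i; rewrite !mxE Xphi shift//.
have -> : [set w | A (\row_i X (x i) w)] =
    (fun w => Path (cg w) : @path_space R n) @^-1` S.
  by apply/seteqP; split => w /=; congr A; apply/rowP => i; rewrite !mxE Xphi.
pose f1 : {mfun T >-> @path_space R n} := HB.pack
  (fun w => Path (cg w) : @path_space R n) (isMeasurableFun.Build _ _ _ _ _ m1).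
pose f2 : {mfun T >-> @path_space R n} := HB.pack
  (fun w => Path (cgz w) : @path_space R n) (isMeasurableFun.Build _ _ _ _ _ m2).
apply: (@g_sigma_algebra_measure_unique _ _ (@path_space R n) (@cylinder R n) _
  (fun=> setT) _ _ (pushforward P f2) (pushforward P f1)) mS.
- by move=> C; exact: sub_sigma_algebra.
- move=> _; exists 0%N, (fun=> 0), setT; split => //.
- by apply/seteqP; split => // g _; exists 0%N.
- exact: cylinder_setI.
- move=> _ [l [y [D [mD ->]]]]; rewrite /pushforward /=.
  exact: (sG l y z D mD).
- move=> _; apply: (@le_lt_trans _ _ 1%E); last exact: ltry.
  exact: (probability_le1 P (measurableT : measurable [set: T])).
Qed.

End path_law.

(** * Tails of the bad balls *)

Section bad_ball_tail.
Context {disp : measure_display} {T : measurableType disp} {R : realType}.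
Context {P : probability T R} {d : nat}.
Variable G : 'rV[R]_d -> {RV P >-> R}.
Hypotheses (gG : gaussian_field G) (cG : centered_field G)
  (sG : stationary_field G) (pG : continuous_paths G).
Local Notation C := (covariance_fun G).
Hypothesis intC : (lebesgue_rV d).-integrable setT (EFin \o C).
Hypothesis d1 : (1 <= d)%N.
Variable p : nat.
Local Notation V := (@unit_volume R d).
Implicit Types (y : 'rV[R]_d) (r : R).

(** The common expectation of [exp (p G)] and [exp (- p G)] at every point. *)
Definition power_moment : R := expR (p%:R ^+ 2 * C 0 / 2).
Local Notation M := power_moment.

(** The expectation of [a ^ p + a ^ - p] is [2 * M], so that averages between [M]
    and [4 * M] are within a factor two of it. *)
Definition field_bad w := bad_ball (M * V) (4 * M * V) (path_moment p (fun z => G z w)).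

(** [expR (8 * d)^-1] is so close to one that replacing a radius by the next or
    the previous one changes volumes by little. *)
Let lam : R := (8 * d%:R)^-1.
Let q : R := expR lam.

Let d0 : 0 < d%:R :> R.
Proof. by rewrite ltr0n. Qed.

Let lam0 : 0 < lam.
Proof. by rewrite invr_gt0 mulr_gt0. Qed.

Let q1 : 1 < q.
Proof. by rewrite -expR0 ltr_expR. Qed.

Let q0 : 0 < q.
Proof. exact: expR_gt0. Qed.

Let q2d : 0 <= q ^+ (2 * d) <= 4 / 3.
Proof.
rewrite exprn_ge0 ?(ltW q0)//= -expRM_natl.
have -> : (2 * d)%:R * lam = 4^-1 :> R.
  by rewrite natrM /lam; field; rewrite gt_eqF.
have := expR_ge1Dx (- 4^-1 : R); rewrite expRN => h.
have e0 := expR_gt0 (4^-1 : R).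
have : (3 / 4) * expR 4^-1 <= 1 :> R.
  by rewrite -ler_pdivlMr// mul1r; lra.
by lra.
Qed.

Let cpath w : continuous (fun z => G z w : R).
Proof. exact: pG. Qed.

Let M0 : 0 < M. Proof. exact: expR_gt0. Qed.
Let V0 : 0 < V. Proof. exact: unit_volume_gt0. Qed.

Let sgn (b : bool) : R := if b then p%:R else - p%:R.

Let dev_event b y r : set T := [set w |
  M / 4 <= `|ball_mean (sgn b) (fun z => G z w) y r - M|].

Let ball_mass_mean w y r : 0 < r ->
  ball_mass (path_moment p (fun z => G z w)) y r =
  (ball_mean p%:R (fun z => G z w) y r + ball_mean (- p%:R) (fun z => G z w) y r)
  * (r ^+ d * V).
Proof.
move=> r0.
have rV : r ^+ d * V != 0 by rewrite gt_eqF// mulr_gt0// exprn_gt0.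
have c s := @continuous_expRM _ _ s _ (@cpath w).
have e0 s z : 0 <= expR (s * G z w) by exact: expR_ge0.
have m s : measurable_fun (eball y r) (fun z => (expR (s * G z w))%:E).
  by apply: measurable_funTS; apply/measurable_EFinP; exact: measurable_continuous_rV.
apply: EFin_inj; rewrite /ball_mean -mulrDl divfK// EFinD.
rewrite !ball_massE//; [|exact: continuous_path_moment|exact: path_moment_ge0].
rewrite -ge0_integralD//; last exact: measurable_eball.
by apply: eq_integral => z _; rewrite -EFinD -sum_pow_invE.
Qed.

(** The ball around [y] lies between two balls around [y'] of comparable volumes, so
    that averages close to the mean on these control its own average. *)
Let good_between w y y' r j : q ^+ j.+1 <= r < q ^+ j.+2 ->
  enorm (y - y') <= q ^+ j * (q - 1) ->
  (forall b, ~ dev_event b y' (q ^+ j) w /\ ~ dev_event b y' (q ^+ j.+3) w) ->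
  ~ field_bad w y r.
Proof.
move=> /andP[r1 r2] yy good [r0].
have cF := continuous_path_moment (p := p) (@cpath w).
have F0 := path_moment_ge0 p (fun z => G z w).
have qj k : 0 < q ^+ k by rewrite exprn_gt0.
have mean rad : (forall b, ~ dev_event b y' rad w) -> 0 < rad ->
    3 / 2 * M * V * rad ^+ d <= ball_mass (path_moment p (fun z => G z w)) y' rad
      <= 5 / 2 * M * V * rad ^+ d.
  move=> h rad0; rewrite ball_mass_mean//.
  have h1 := h true; have h2 := h false.
  move: h1 h2; rewrite /dev_event/= => /negP; rewrite -ltNge ltr_norml => /andP[a1 a2].
  move=> /negP; rewrite -ltNge ltr_norml => /andP[b1 b2].
  have rv : 0 <= rad ^+ d * V by rewrite mulr_ge0 ?exprn_ge0 ?ltW.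
  set a := ball_mean _ _ _ _ in a1 a2 *; set b := ball_mean _ _ _ _ in b1 b2 *.
  have -> : 3 / 2 * M * V * rad ^+ d = (3 / 2 * M) * (rad ^+ d * V) by ring.
  have -> : 5 / 2 * M * V * rad ^+ d = (5 / 2 * M) * (rad ^+ d * V) by ring.
  by rewrite !ler_wpM2r//; lra.
have /andP[lo _] := mean (q ^+ j) (fun b => (good b).1) (qj j).
have /andP[_ hi] := mean (q ^+ j.+3) (fun b => (good b).2) (qj _).
have in1 := ball_mass_subset cF F0 (y := y') (r := q ^+ j) (y' := y) (r' := r).
have in2 := ball_mass_subset cF F0 (y := y) (r := r) (y' := y') (r' := q ^+ j.+3).
have {}in1 : ball_mass (path_moment p (fun z => G z w)) y' (q ^+ j) <=
    ball_mass (path_moment p (fun z => G z w)) y r.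
  apply: in1; rewrite enormB_sym; apply: le_trans r1.
  by rewrite exprS; move: yy; rewrite mulrBr; lra.
have {}in2 : ball_mass (path_moment p (fun z => G z w)) y r <=
    ball_mass (path_moment p (fun z => G z w)) y' (q ^+ j.+3).
  apply: in2; apply: (@le_trans _ _ (q ^+ j.+2 + q ^+ j * (q - 1))).
    by apply: lerD => //; exact: ltW.
  rewrite [q ^+ j.+3]exprS.
  have : q ^+ j * (q - 1) <= q ^+ j.+2 * (q - 1).
    by rewrite ler_wpM2r ?subr_ge0 ?(ltW q1)// ler_weXn2l ?(ltW q1)// leqW.
  by rewrite mulrBr; lra.
have MV : 0 <= M * V by rewrite mulr_ge0 ?ltW.
have scale k : (q ^+ k.+2) ^+ d = q ^+ (2 * d) * (q ^+ k) ^+ d.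
  by rewrite -!exprM -exprD -addn2 mulnDl addnC.
have /andP[_ q43] := q2d.
have s1 : r ^+ d <= 4 / 3 * (q ^+ j) ^+ d.
  apply: (@le_trans _ _ ((q ^+ j.+2) ^+ d)).
    by rewrite lerXn2r ?nnegrE ?(ltW (qj _)) ?(ltW r0)// ltW.
  by rewrite scale ler_wpM2r// exprn_ge0// ltW.
have s2 : (q ^+ j.+3) ^+ d <= 4 / 3 * r ^+ d.
  rewrite scale; apply: ler_pM => //.
  - by rewrite exprn_ge0// ltW.
  - by rewrite exprn_ge0// ltW.
  - by rewrite lerXn2r ?nnegrE ?(ltW (qj _)) ?(ltW r0).
have rd0 : 0 <= r ^+ d by rewrite exprn_ge0// ltW.
have t1 : M * V * r ^+ d <= M * V * (4 / 3 * (q ^+ j) ^+ d) by rewrite ler_wpM2l.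
have t2 : M * V * (q ^+ j.+3) ^+ d <= M * V * (4 / 3 * r ^+ d) by rewrite ler_wpM2l.
have t0 : 0 <= M * V * (q ^+ j) ^+ d by rewrite mulr_ge0// exprn_ge0// ltW.
have t3 : 0 <= M * V * r ^+ d by rewrite mulr_ge0.
have e1 : 3 / 2 * M * V * (q ^+ j) ^+ d = 3 / 2 * (M * V * (q ^+ j) ^+ d) by ring.
have e2 : 5 / 2 * M * V * (q ^+ j.+3) ^+ d = 5 / 2 * (M * V * (q ^+ j.+3) ^+ d) by ring.
have e3 : M * V * (4 / 3 * (q ^+ j) ^+ d) = 4 / 3 * (M * V * (q ^+ j) ^+ d) by ring.
have e4 : M * V * (4 / 3 * r ^+ d) = 4 / 3 * (M * V * r ^+ d) by ring.
have e5 : 4 * M * V * r ^+ d = 4 * (M * V * r ^+ d) by ring.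
move: lo hi in1 in2 t0 t1 t2 t3; rewrite e1 e2 e3 e4 e5.
by move=> ? ? ? ? ? ? ? ? [?|?]; lra.
Qed.

(** The centers of the balls of radius about [q ^+ j] that matter lie in a
    ball of comparable radius, which finitely many nodes represent. *)
Let J : nat := (Num.truncn (16 * q ^+ 2 * d%:R / (q - 1))).+1.

Let step j : R := q ^+ j * (q - 1) / d%:R.

Let grid j (k : {ffun 'I_d -> 'I_J}) : 'rV[R]_d :=
  \row_i ((k i)%:R * step j - 8 * q ^+ j.+2).

Let step0 j : 0 < step j.
Proof. by rewrite divr_gt0// mulr_gt0 ?exprn_gt0// subr_gt0. Qed.

Let grid_near j y : enorm y < 8 * q ^+ j.+2 ->
  exists k, enorm (y - grid j k) <= q ^+ j * (q - 1).
Proof.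
move=> yb; pose u i := (y ord0 i + 8 * q ^+ j.+2) / step j.
have yi i : - (8 * q ^+ j.+2) < y ord0 i < 8 * q ^+ j.+2.
  by rewrite -ltr_norml (le_lt_trans (coord_le_enorm y i)).
have u0 i : 0 <= u i.
  by rewrite divr_ge0 ?(ltW (step0 j))//; have /andP[] := yi i; lra.
have uJ i : (Num.truncn (u i) < J)%N.
  rewrite ltnS; apply: le_truncn; rewrite /u ler_pdivrMr//.
  have -> : 16 * q ^+ 2 * d%:R / (q - 1) * step j = 16 * q ^+ j.+2.
    rewrite /step (_ : q ^+ j.+2 = q ^+ j * q ^+ 2); last by rewrite -exprD addn2.
    field.
    by rewrite !gt_eqF ?subr_gt0.
  by have /andP[] := yi i; lra.
exists [ffun i => Ordinal (uJ i)].
have -> : q ^+ j * (q - 1) = d%:R * step j by rewrite /step [RHS]mulrC divfK// gt_eqF.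
apply: enorm_le_coord => [|i]; first exact: ltW.
rewrite !mxE ffunE/=.
have /andP[h1 h2] := truncn_itv (u0 i).
have : (Num.truncn (u i))%:R * step j <= u i * step j by rewrite ler_wpM2r// ltW.
have : u i * step j <= (Num.truncn (u i)).+1%:R * step j by rewrite ler_wpM2r// ltW.
have -> : u i * step j = y ord0 i + 8 * q ^+ j.+2 by rewrite /u divfK// gt_eqF.
rewrite (_ : _.+1%:R * step j = (Num.truncn (u i))%:R * step j + step j);
  last by rewrite -natr1 mulrDl mul1r.
set v := _%:R * step j; set Q := q ^+ j.+2 => h3 h4.
by rewrite ler_norml; apply/andP; split; have := step0 j; lra.
Qed.

(** The flag [k.1.2] selects the inner or the outer radius, and [k.2] the sign of
    the exponent. *)
Let level_event j : set T := [set w | exists k : {ffun 'I_d -> 'I_J} * bool * bool,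
  dev_event k.2 (grid j k.1.1) (if k.1.2 then q ^+ j else q ^+ j.+3) w].

Definition bad_event n : set T := \bigcup_i level_event (n + i).

Let measurable_dev_event b y r : measurable (dev_event b y r).
Proof.
rewrite -[X in measurable X]setTI; apply: measurable_fun_ler => //.
apply: measurableT_comp => //; apply: measurable_funB => //.
apply: measurable_funM => //.
apply: (@measurable_ball_mass _ _ _ _ (fun z w => expR (sgn b * G z w))).
- move=> z; by apply: measurableT_comp => //; exact: measurable_funM.
- by move=> w; exact: continuous_expRM.
- by move=> z w; exact: expR_ge0.
Qed.

Let measurable_level_event j : measurable (level_event j).
Proof. by apply: measurable_exists_fin => k; exact: measurable_dev_event. Qed.

Lemma measurable_bad_event n : measurable (bad_event n).
Proof. by apply: bigcup_measurable => i _. Qed.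

Lemma bad_event_bound n w : ~ bad_event n w ->
  forall y r, field_bad w y r -> r - 8^-1 * enorm (0 - y) <= q ^+ n.+1.
Proof.
move=> nE y r Byr; rewrite leNgt; apply/negP => rn.
rewrite enormB_sym subr0 in rn.
have y0 := enorm_ge0 y.
have rq : q ^+ n.+1 < r by lra.
have [i /andP[i1 i2]] : exists i, q ^+ (n + i).+1 <= r < q ^+ (n + i).+2.
  have r0 : 0 < r by rewrite (lt_trans _ rq)// exprn_gt0.
  pose t := ln r / lam.
  have rE : r = expR (t * lam) by rewrite /t divfK ?lnK// gt_eqF.
  have qE m : q ^+ m = expR (m%:R * lam) by rewrite -expRM_natl.
  have nt : n.+1%:R <= t.
    by move: rq; rewrite rE qE ltr_expR ltr_pM2r// => /ltW.
  have t0 : 0 <= t by exact: le_trans nt.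
  have /andP[h1 h2] := truncn_itv t0.
  have nK : (n.+1 <= Num.truncn t)%N by rewrite truncn_ge_nat.
  exists (Num.truncn t - n.+1)%N.
  have -> : ((n + (Num.truncn t - n.+1)).+1 = Num.truncn t)%N by rewrite -addSn subnKC.
  by rewrite rE !qE ler_expR ltr_expR !ler_pM2r// !ltr_pM2r// h1 h2.
have yb : enorm y < 8 * q ^+ (n + i).+2.
  have : 0 < q ^+ n.+1 by rewrite exprn_gt0.
  by lra.
have [k hk] := grid_near yb.
apply: (@good_between w y (grid (n + i) k) r (n + i)) Byr => //.
  by rewrite i1 i2.
move=> b; split => h; apply: nE; exists i => //.
  by exists (k, true, b).
by exists (k, false, b).
Qed.

(** At scale [j] the moment of order [k + 1] with [k] about [lam * j / (2 * N)]
    minimizes the exponent [N (k + 1) ^ 2 - lam j (k + 1)], up to an additive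
    constant, and leaves a Gaussian decay in [j]. *)
Lemma bad_event_tail : exists K c : R, [/\ 0 < K, 0 < c &
  forall n, (P (bad_event n) <= (K * expR (- c * n%:R ^+ 2))%:E)%E].
Proof.
have [Th1 [Th11 hT1]] := ball_mean_deviation gG cG sG pG intC d1 (p%:R).
have [Th2 [Th21 hT2]] := ball_mean_deviation gG cG sG pG intC d1 (- p%:R).
pose Th := maxr Th1 Th2.
have Th1' : 1 <= Th by rewrite le_max Th11.
have th0 : 0 <= ln Th by rewrite ln_ge0.
pose N := ln Th + 1.
have N0 : 0 < N by rewrite /N; lra.
pose c := lam ^+ 2 / (4 * N).
have c0 : 0 < c by rewrite divr_gt0 ?exprn_gt0// mulr_gt0.
have tail b y j rad : q ^+ j <= rad ->
    (P (dev_event b y rad) <= (expR N * expR (- c * j%:R ^+ 2))%:E)%E.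
  move=> jr; pose u := lam * j%:R / (2 * N).
  have u0 : 0 <= u by rewrite divr_ge0 ?mulr_ge0// ltW// mulr_gt0.
  pose k := Num.truncn u.
  have /andP[k1 k2] := truncn_itv u0.
  have qj : 1 <= q ^+ j by rewrite exprn_ege1// ltW.
  have rad1 : 1 <= rad by exact: le_trans jr.
  have h : (P (dev_event b y rad) <= (Th ^+ (k.+1 ^ 2) * rad^-1 ^+ k.+1)%:E)%E.
    have r0 : 0 <= rad^-1 by rewrite invr_ge0 (le_trans ler01).
    have T0 (t : R) : 1 <= t -> 0 <= t by exact: le_trans.
    rewrite /dev_event /sgn /power_moment; case: b.
      apply: (le_trans (hT1 y rad k rad1)); rewrite lee_fin ler_wpM2r ?exprn_ge0//.
      by rewrite lerXn2r ?nnegrE ?T0// le_max lexx.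
    have := hT2 y rad k rad1; rewrite sqrrN => /le_trans; apply.
    rewrite lee_fin ler_wpM2r ?exprn_ge0//.
    by rewrite lerXn2r ?nnegrE ?T0// le_max lexx orbT.
  apply: (le_trans h); rewrite lee_fin.
  apply: (@le_trans _ _ (Th ^+ (k.+1 ^ 2) * (q ^+ j)^-1 ^+ k.+1)).
    rewrite ler_wpM2l ?exprn_ge0 ?(le_trans ler01)//.
    rewrite lerXn2r ?nnegrE ?invr_ge0 ?(le_trans ler01)//.
    by rewrite lef_pV2// posrE (lt_le_trans ltr01).
  rewrite -[Th in Th ^+ _]lnK ?posrE ?(lt_le_trans ltr01)//.
  rewrite -!expRM_natl -!expRN -!expRM_natl -!expRD ler_expR natrX.
  move: k1 k2; rewrite -/k -natr1; set v := k%:R => k1 k2.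
  have uE : lam * j%:R = 2 * N * u by rewrite /u [RHS]mulrC divfK// gt_eqF// mulr_gt0.
  have cE : c * j%:R ^+ 2 = N * u ^+ 2.
    rewrite /c /u; field; rewrite gt_eqF//.
  rewrite mulNr cE [X in _ + X](_ : _ = - ((v + 1) * (lam * j%:R))); last by ring.
  rewrite uE /N.
  have : (ln Th + 1) * ((v + 1 - u) ^+ 2) <= (ln Th + 1) * 1.
    by rewrite ler_wpM2l//; [lra|rewrite expr_le1//; lra].
  have := sqr_ge0 (v + 1); set w := (v + 1) ^+ 2 => w0.
  have -> : (v + 1 - u) ^+ 2 = w - 2 * (v + 1) * u + u ^+ 2 by rewrite /w; ring.
  by rewrite !mulrDl; lra.
pose L : R := #|{: {ffun 'I_d -> 'I_J} * bool * bool}|%:R * expR N.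
have L0 : 0 <= L by rewrite mulr_ge0 ?expR_ge0.
have level j : (P (level_event j) <= (L * expR (- c * j%:R ^+ 2))%:E)%E.
  rewrite /L -mulrA; apply: measure_exists_fin_le => k.
    exact: measurable_dev_event.
  apply: tail; case: (k.1.2) => //.
  by rewrite ler_weXn2l ?(ltW q1)// -addn3 leq_addr.
have ec : 0 <= expR (- c) < 1 by rewrite expR_ge0 expR_lt1 oppr_lt0.
have ec1 : 0 < 1 - expR (- c) by rewrite subr_gt0; case/andP: ec.
exists ((L + 1) / (1 - expR (- c))), c; split => //.
  by rewrite divr_gt0// ltr_wpDl.
move=> n; rewrite /bad_event.
apply: (le_trans (@measure_bigcup_geometric _ _ _ P _
  ((L + 1) * expR (- c * n%:R ^+ 2)) (expR (- c)) _ ec _ _)).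
- by rewrite mulr_ge0 ?expR_ge0// addr_ge0.
- by move=> i; exact: measurable_level_event.
- move=> i; apply: (le_trans (level _)); rewrite lee_fin -expRM_natl -mulrA -expRD.
  apply: ler_pM; rewrite ?expR_ge0// ?lerDl// ler_expR natrD !mulNr.
  have : 0 <= c * (n%:R * i%:R) by rewrite mulr_ge0// ltW.
  have : c * i%:R <= c * i%:R ^+ 2.
    rewrite ler_pM2l// -natrX ler_nat; case: (i) => // m.
    by rewrite expnS leq_pmulr.
  by rewrite sqrrD; lra.
- by rewrite lee_fin mulrAC.
Qed.

End bad_ball_tail.

(** * The radius field *)

Section radius_field.
Context {disp : measure_display} {T : measurableType disp} {R : realType}.
Context {P : probability T R} {d : nat}.
Variable G : 'rV[R]_d -> {RV P >-> R}.
Hypotheses (gG : gaussian_field G) (cG : centered_field G)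
  (sG : stationary_field G) (pG : continuous_paths G).
Local Notation C := (covariance_fun G).
Hypothesis intC : (lebesgue_rV d).-integrable setT (EFin \o C).
Hypothesis d1 : (1 <= d)%N.
Variable p : nat.
Local Notation V := (@unit_volume R d).
Local Notation M := (power_moment G p).

Let M0 : 0 < M. Proof. exact: expR_gt0. Qed.
Let V0 : 0 < V. Proof. exact: unit_volume_gt0. Qed.
Let lo0 : 0 <= M * V. Proof. by rewrite mulr_ge0 ?ltW. Qed.
Let hi0 : 0 <= 4 * M * V. Proof. by rewrite !mulr_ge0 ?ltW. Qed.

Let rad x w : R := path_radius p (M * V) (4 * M * V) (fun z => G z w) x.

Let mrad x : measurable_fun setT (rad x).
Proof.
exact: (@measurable_path_radius R d p _ _ lo0 hi0 _ T (fun z w => G z w) x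
  (fun z => measurable_funPT (G z)) pG).
Qed.

Definition radius_field x : {RV P >-> R} :=
  HB.pack (rad x) (isMeasurableFun.Build _ _ T R _ (mrad x)).

Lemma expectation_sum_pow_inv :
  ('E_P[(fun w => sum_pow_inv p (lognormal G 0 w))%R] = (2 * M)%:E)%E.
Proof.
rewrite unlock.
have e (s : R) : s ^+ 2 = p%:R ^+ 2 -> (\int[P]_w (expR (s * G 0 w))%:E = M%:E)%E.
  move=> sp; transitivity (\int[P]_w (expR (s * comb G [:: (1, 0)] w))%:E)%E.
    by apply: eq_integral => w _; rewrite comb1.
  rewrite integral_expR_comb//; congr (expR _)%:E.
  by rewrite /comb_var !big_seq1/= subrr !mul1r sp.
transitivity (\int[P]_w ((expR (p%:R * G 0 w))%:E + (expR (- p%:R * G 0 w))%:E))%E.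
  by apply: eq_integral => w _; rewrite /lognormal sum_pow_invE.
have m (s : R) : measurable_fun setT (fun w => (expR (s * G 0 w))%:E).
  by apply/measurable_EFinP; apply: measurableT_comp => //; exact: measurable_funM.
rewrite ge0_integralD//.
by rewrite !e ?sqrrN// -EFinD; congr EFin; ring.
Qed.

Lemma stationary_radius_field : stationary_field radius_field.
Proof.
apply: (stationary_path_functional (phi := path_radius p (M * V) (4 * M * V)) sG pG).
- by [].
- move=> x; exact: (@measurable_path_radius R d p _ _ lo0 hi0 _ (@path_space R d)
    (fun z g => (g : path R d) z) x (@measurable_evaluation R d) (@continuous_path R d)).
- by move=> g x z cg; exact: path_radius_shift.
Qed.

Let overshoot_bound n w : ~ bad_event G p n w ->
  (overshoot (field_bad G p w) 0 <= (expR (8 * d%:R)^-1 ^+ n.+1)%:E)%E.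
Proof.
move=> nE; apply: overshoot_le; first by rewrite exprn_ge0// expR_ge0.
exact: (bad_event_bound pG d1 nE).
Qed.

Lemma radius_field_moment : exists C0 : R, 0 < C0 /\
  (exp_log2_moment P C0 (radius_field 0) <= 2%:E)%E.
Proof.
have [K [c [K0 c0 hP]]] := bad_event_tail gG cG sG pG intC d1 p.
pose lam : R := (8 * d%:R)^-1.
have lam0 : 0 <= lam by rewrite invr_ge0 mulr_ge0.
have l30 : 0 <= ln 3 :> R by rewrite ln_ge0// ler1n.
have b0 : 0 <= ln 3 + lam by rewrite addr_ge0.
have [C0 [C00 hC0]] := exp_square_moment_of_tails K0 c0 lam0 b0.
exists C0; split => //; rewrite /exp_log2_moment unlock /=.
have r1 w : 1 <= rad 0 w by exact: minimal_radius_ge1.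
apply: (hC0 _ _ P (fun w => ln (1 + rad 0 w)) (bad_event G p)) => //.
- by move=> w; rewrite ln_ge0// lerDl (le_trans ler01).
- by move=> n; exact: measurable_bad_event.
- move=> n w nE; have h := overshoot_bound nE.
  have o0 := overshoot_ge0 (field_bad G p w) 0.
  have fin : overshoot (field_bad G p w) 0 \is a fin_num.
    by rewrite ge0_fin_numE// (le_lt_trans h)// ltry.
  have rq : rad 0 w <= 1 + expR lam ^+ n.+1.
    rewrite /rad /path_radius /minimal_radius lerD2l -lee_fin.
    by move: h; rewrite -{1}(fineK fin).
  have q1 : 1 <= expR lam ^+ n.+1 by rewrite exprn_ege1// -expR0 ler_expR.
  have -> : lam * n%:R + (ln 3 + lam) = ln (3 * expR lam ^+ n.+1).
    rewrite lnM ?posrE ?exprn_gt0 ?expR_gt0// -expRM_natl expRK.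
    by rewrite -natr1; ring.
  rewrite ler_ln ?posrE ?mulr_gt0 ?exprn_gt0 ?expR_gt0//; last by have := r1 w; lra.
  by lra.
Qed.

(** The overshoot is infinite only on the intersection of the bad events, whose
    probabilities tend to zero. *)
Lemma overshoot_fin_ae : {ae P, forall w, overshoot (field_bad G p w) 0 \is a fin_num}.
Proof.
have [K [c [K0 c0 hP]]] := bad_event_tail gG cG sG pG intC d1 p.
exists (\bigcap_n bad_event G p n); split.
- by apply: bigcapT_measurable => n; exact: measurable_bad_event.
- set N := \bigcap_n _.
  have mN : measurable N by apply: bigcapT_measurable => n; exact: measurable_bad_event.
  have PN : P N \is a fin_num by exact: fin_num_measure.
  apply/eqP; rewrite eq_le measure_ge0 andbT -(fineK PN) lee_fin leNgt.
  apply/negP => p0; set x := fine (P N) in p0.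
  pose n := (Num.truncn (K / (c * x))).+1.
  have nb : K / (c * x) < n%:R by exact: truncnS_gt.
  have cx : 0 < c * x by rewrite mulr_gt0.
  have : x <= K * expR (- c * n%:R ^+ 2).
    rewrite -lee_fin fineK//; apply: le_trans (hP n).
    by apply: le_measure; rewrite ?inE//; [exact: measurable_bad_event|move=> w; apply].
  have n1 : (1 : R) <= n%:R by rewrite ler1n.
  have e1 : 1 + c * n%:R <= expR (c * n%:R ^+ 2).
    apply: (le_trans (expR_ge1Dx _)); rewrite ler_expR ler_pM2l// expr2.
    by rewrite ler_peMr// (le_trans ler01).
  rewrite mulNr expRN ler_pdivlMr ?expR_gt0// leNgt => /negP; apply.
  apply: (@lt_le_trans _ _ (x * (1 + c * n%:R))); last by rewrite ler_pM2l.
  by move: nb; rewrite ltr_pdivrMr// mulrDr mulr1 mulrCA (mulrC n%:R); lra.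
- move=> w /= nf n _; apply: contrapT => nE; apply: nf.
  rewrite ge0_fin_numE ?overshoot_ge0//.
  by rewrite (le_lt_trans (overshoot_bound nE))// ltry.
Qed.

Lemma radius_field_avg : {ae P, forall w, forall x r, radius_field x w <= r ->
  ((2^-1)%:E * (2 * M)%:E <=
     ball_avg (fun y => sum_pow_inv p (lognormal G y w)) x r <=
   2%:E * (2 * M)%:E)%E}.
Proof.
apply: filterS overshoot_fin_ae => w fin x r xr.
have r0 : 0 < r.
  by apply: lt_le_trans xr; apply: lt_le_trans (minimal_radius_ge1 _ _).
have := minimal_radius_good fin xr => nb.
have cg : continuous (fun z => G z w : R) by exact: pG.
rewrite (ball_avgE (F := path_moment p (fun z => G z w)))//; last first.
- exact: path_moment_ge0.
- exact: continuous_path_moment.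
set m := ball_mass _ _ _.
have rV : 0 < r ^+ d * V by rewrite mulr_gt0// exprn_gt0.
have lo : M * V * r ^+ d <= m.
  by rewrite leNgt; apply/negP => h; apply: nb; split => //; left.
have hi : m <= 4 * M * V * r ^+ d.
  by rewrite leNgt; apply/negP => h; apply: nb; split => //; right.
rewrite -!EFinM !lee_fin ler_pdivlMr// ler_pdivrMr//.
have -> : 2^-1 * (2 * M) * (r ^+ d * V) = M * V * r ^+ d by field.
have -> : 2 * (2 * M) * (r ^+ d * V) = 4 * M * V * r ^+ d by ring.
by rewrite lo hi.
Qed.

End radius_field.

Theorem proposition1p2 (R : realType) (disp : measure_display)
  (T : measurableType disp) (P : probability T R) (d : nat)
  (G : 'rV[R]_d -> {RV P >-> R}) (gamma : R) :
  (1 <= d)%N ->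
  gaussian_field G ->
  centered_field G ->
  stationary_field G ->
  continuous_paths G ->
  (lebesgue_rV d).-integrable setT (EFin \o covariance_fun G) ->
  0 < gamma < 2^-1 ->
  holder_at0 (covariance_fun G) (2 * gamma) ->
  let a := lognormal G in
  let p := d.+1 in
  let m := 'E_P[(fun w => sum_pow_inv p (a 0 w))%R]%E in
  (exists rd : 'rV[R]_d -> {RV P >-> R},
    [/\ stationary_field rd,
        forall x w, 0 < rd x w,
        forall x y w, `|rd x w - rd y w| <= 8^-1 * enorm (x - y),
        {ae P, forall w, forall x r, rd x w <= r ->
          ((2^-1)%:E * m <= ball_avg (fun y => sum_pow_inv p (a y w)) x r
             <= 2%:E * m)%E}
      & exists C : R, 0 < C /\ (exp_log2_moment P C (rd 0%R) <= 2%:E)%E])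
  /\
  (forall eps : R, 0 < eps <= 1 ->
    exists C : R, 0 < C /\
      (ereal_sup [set exp_log2_moment P C (r_club a eps rho) |
                  rho in [set rho : R | (1 <= rho)%R]] <= 2%:E)%E).
Proof.
move=> d1 gG cG sG pG intC /andP[g0 _] hC a p m; split; last first.
  move=> eps /andP[e0 _].
  by apply: (r_club_moment gG cG sG pG _ hC e0); rewrite mulr_gt0.
exists (radius_field pG p); split.
- exact: stationary_radius_field.
- by move=> x w; apply: lt_le_trans (minimal_radius_ge1 _ _).
- by move=> x y w; exact: minimal_radius_Lipschitz.
- rewrite /m expectation_sum_pow_inv//.
  exact: radius_field_avg.
- exact: radius_field_moment.
Qed.
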